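(* Let $H$ be a finite simple connected unbalanced graph, and let $G_n\sim G(n,p)$ be the Erdős–Rényi random graph with $p=p(n)\in(0,1)$. Let $c_n$ be positive integers with $c_n\to\infty$, and color the vertices of $G_n$ uniformly with $c_n$ colors, independently of the graph. Assume that for some $\lambda>0$ $$\mathbb{E}\,T(H,G_n)=\frac{|V(H)|!\binom{n}{|V(H)|}p^{|E(H)|}}{|Aut(H)|\,c_n^{|V(H)|-1}}\longrightarrow\lambda\qquad (n\to\infty).$$ Then: (a) If $n^{-|V(H)|/|E(H)|}\ll p(n)\ll n^{-\gamma(H)}$, then $T(H,G_n)\to0$ in probability. (b) If $n^{\gamma(H)}p(n)\to\kappa\in(0,\infty)$, then all moments of $T(H,G_n)$ converge (i.e. $\lim_{n\to\infty}\mathbb{E}\,T(H,G_n)^r$ exists and is finite for every integer $r\ge1$). Moreover, if $T(H,G_n)$ converges in distribution to a random variable $W$, then $W$ is not Poisson. (c) If $n^{-\gamma(H)}\ll p(n)\ll1$, then $T(H,G_n)$ converges in distribution to $\mathrm{Pois}(\lambda)$. (d) If $p(n)=p\in(0,1)$ is fixed, then $T(H,G_n)$ converges in distribution to $$\sum_{F\supseteq H:\ |V(F)|=|V(H)|}N(H,F)\,X_F,$$ where $X_F\sim\mathrm{Pois}\!\left(\lambda\cdot\frac{|Aut(H)|}{|Aut(F)|}\,p^{|E(F)|-|E(H)|}(1-p)^{\binom{|V(H)|}{2}-|E(F)|}\right)$ and the collection $\{X_F: F\supseteq H,\ |V(F)|=|V(H)|\}$ is independent.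
   Context: For a finite connected graph $H$, $m(H)=\max_{H_1\subseteq H}\frac{|E(H_1)|}{|V(H_1)|}$, the maximum over all non-empty subgraphs $H_1$ of $H$; $H$ is balanced if $m(H)=\frac{|E(H)|}{|V(H)|}$ and unbalanced otherwise. For unbalanced $H$, $$\gamma(H)=\min_{H_1\subset H}\frac{|V(H)|-|V(H_1)|}{|E(H_1)|(|V(H)|-1)-|E(H)|(|V(H_1)|-1)},$$ the minimum over all (non-empty) proper subgraphs $H_1$ of $H$ for which the denominator is positive; this is well-defined and positive for unbalanced $H$. Coloring: given $G_n$, the vertices receive independent colors $X_v$, each uniform on $\{1,\dots,c_n\}$. $T(H,G_n)$ is the number of monochromatic copies of $H$ in $G_n$: with $V(H)=\{1,\dots,|V(H)|\}$ and $(a_{ij}(G_n))$ the adjacency matrix, $$T(H,G_n)=\frac{1}{|Aut(H)|}\sum_{\boldsymbol s}\prod_{(a,b)\in E(H)}a_{s_as_b}(G_n)\,\mathbf 1\{X_{s_1}=\cdots=X_{s_{|V(H)|}}\},$$ the sum over all tuples of distinct vertices of $G_n$. $\mathbb{E}$ is over both the graph and the coloring. The sum over $F\supseteq H$ with $|V(F)|=|V(H)|$ is over isomorphism classes (unlabelled graphs) $F$ on $|V(H)|$ vertices containing a copy of $H$ as a subgraph ($F=H$ included). $N(H,F)$ is the number of copies of $H$ in $F$ (subgraphs of $F$ isomorphic to $H$, not necessarily induced). $Aut(\cdot)$ is the automorphism group. $a_n\ll b_n$ means $a_n/b_n\to0$. *)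

(* Defs.v *)
From HB Require Import structures.
From mathcomp Require Import all_boot all_order all_algebra all_fingroup.
From mathcomp Require Import all_classical all_reals all_analysis.
From mathcomp Require Import measurable_realfun.
From mathcomp Require Import ring.

Set Implicit Arguments.
Unset Strict Implicit.
Unset Printing Implicit Defensive.

Import Order.TTheory GRing.Theory Num.Theory.
Import numFieldNormedType.Exports.

Local Open Scope classical_set_scope.
Local Open Scope ring_scope.

(* A finite simple graph with vertex set V is given by its set of edges, an
   edge being an unordered pair {x, y} with x != y. *)
Record sgraph (V : finType) := SGraph {
  edges : {set {set V}};
  edges_card2 : [forall e in edges, #|e| == 2%N] }.

HB.instance Definition _ (V : finType) := [isSub for @edges V].
HB.instance Definition _ (V : finType) := [Finite of sgraph V by <:].

Definition adj (V : finType) (G : sgraph V) : rel V :=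
  fun x y => [set x; y]%SET \in edges G.

Definition sg_connected (V : finType) (G : sgraph V) : bool :=
  (0 < #|V|)%N && [forall x, forall y, connect (adj G) x y].

Definition is_iso (V : finType) (G1 G2 : sgraph V) (s : {perm V}) : bool :=
  [forall x, forall y, adj G2 (s x) (s y) == adj G1 x y].

Definition sg_iso (V : finType) : rel (sgraph V) :=
  fun G1 G2 => [exists s : {perm V}, is_iso G1 G2 s].

Definition sg_aut (V : finType) (G : sgraph V) : {set {perm V}} :=
  [set s : {perm V} | is_iso G G s]%SET.

(* K = (vertex set, edge set) is a (not necessarily induced) subgraph of H with
   at least one vertex. *)
Definition nonempty_subgraph (V : finType) (H : sgraph V)
    (K : {set V} * {set {set V}}) : bool :=
  [&& K.1 != finset.set0, K.2 \subset edges H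
    & [forall e in K.2, e \subset K.1]].

Definition proper_subgraph (V : finType) (H : sgraph V)
    (K : {set V} * {set {set V}}) : bool :=
  nonempty_subgraph H K && (K != (finset.setT, edges H)).

Section Density.
Context (R : realType) (V : finType) (H : sgraph V).

Definition max_density : R :=
  \big[Num.max/0]_(K : {set V} * {set {set V}} | nonempty_subgraph H K)
    (#|K.2|%:R / #|K.1|%:R).

Definition balanced : Prop := max_density = #|edges H|%:R / #|V|%:R.

Definition gamma_denom (K : {set V} * {set {set V}}) : R :=
  #|K.2|%:R * (#|V|%:R - 1) - #|edges H|%:R * (#|K.1|%:R - 1).

(* The set is finite, and nonempty when H is unbalanced, so that this infimum
   is then a minimum. *)
Definition gamma : R :=
  inf [set (#|V|%:R - #|K.1|%:R) / gamma_denom K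
      | K in [set K : {set V} * {set {set V}} |
               proper_subgraph H K /\ 0 < gamma_denom K]].

End Density.

(* Number of subgraphs of F isomorphic to H; H and F having the same vertex set,
   such subgraphs are spanning. *)
Definition ncopies (V : finType) (H F : sgraph V) : nat :=
  #|[set K : sgraph V | sg_iso H K & edges K \subset edges F]%SET|.

(* One representative of each isomorphism class of graphs on #|V| vertices that
   contain a copy of H. *)
Definition supergraph_classes (V : finType) (H : sgraph V) : {set sgraph V} :=
  let D := [set F : sgraph V | (0 < ncopies H F)%N]%SET in
  transversal (equivalence_partition (@sg_iso V) D) D.

(* T(H, G) for the vertex coloring X of G.  For an injective s and an edge
   e = {a, b} of H, the image s @: e is the pair {s a, s b}. *)
Definition mono_copies (R : realType) (V U C : finType) (H : sgraph V)
    (G : sgraph U) (X : {ffun U -> C}) : R :=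
  #|sg_aut H|%:R^-1 *
  \sum_(s : {ffun V -> U} | injectiveb s)
    (\prod_(e in edges H) (s @: e \in edges G)%:R) *
    [forall a, forall b, X (s a) == X (s b)]%:R.

(* Graphs on n vertices together with a coloring of the vertices by c colors. *)
Notation colored_graph n c := (sgraph 'I_n * {ffun 'I_n -> 'I_c})%type.

Section RandomColoredGraph.
Context (R : realType) (n c : nat) (p : R).

(* Law of an Erdos-Renyi graph G(n, p) with an independent uniform coloring. *)
Definition cg_mass (w : colored_graph n c) : R :=
  p ^+ #|edges w.1| * (1 - p) ^+ ('C(n, 2) - #|edges w.1|) * (c ^ n)%:R^-1.

Definition cg_expect (f : colored_graph n c -> R) : R :=
  \sum_(w : colored_graph n c) f w * cg_mass w.

Definition cg_prob (A : pred (colored_graph n c)) : R :=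
  \sum_(w : colored_graph n c | A w) cg_mass w.

End RandomColoredGraph.

(* T(H, G_n), as a function on the sample space of graphs and colorings. *)
Definition Tmono (R : realType) (V : finType) (H : sgraph V) (n c : nat)
  (w : colored_graph n c) : R := mono_copies R H w.1 w.2.

Section Convergence.
Context (R : realType) (p : nat -> R) (c : nat -> nat).
Context (T : forall n : nat, colored_graph n (c n) -> R).

Definition cvg_in_probability (l : R) : Prop :=
  forall eps : R, 0 < eps ->
    cg_prob (p n) (fun w => eps < `|@T n w - l|) @[n --> \oo] --> (0 : R).

Definition cvg_in_distribution (d : measure_display) (Omega : measurableType d)
    (P : probability Omega R) (W : {RV P >-> R}) : Prop :=
  forall x : R, {for x, continuous (cdf W)} ->
    (cg_prob (p n) (fun w => @T n w <= x))%:E @[n --> \oo] --> cdf W x.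

End Convergence.

Definition much_smaller (R : realType) (a b : nat -> R) : Prop :=
  a n / b n @[n --> \oo] --> (0 : R).

Definition nat_to_real (R : realType) (k : nat) : R := k%:R.

Lemma measurable_nat_to_real (R : realType) :
  measurable_fun [set: nat] (@nat_to_real R).
Proof. by []. Qed.

HB.instance Definition _ (R : realType) :=
  isMeasurableFun.Build _ _ nat R (@nat_to_real R) (@measurable_nat_to_real R).

(* The library's poisson_prob has an unused nat argument, set here to 0; for
   rate 0 it is the Dirac mass at 0. *)
Definition poisson_rv (R : realType) (rate : R) :
  {RV (poisson_prob rate 0 : probability nat R) >-> R} := @nat_to_real R.

Definition is_poisson (R : realType) (rate : R) (d : measure_display)
    (Omega : measurableType d) (P : probability Omega R) (W : {RV P >-> R}) :
    Prop :=
  forall A : set R, measurable A ->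
    distribution P W A = distribution (poisson_prob rate 0) (poisson_rv rate) A.

Definition mutually_independent (R : realType) (d : measure_display)
    (Omega : measurableType d) (P : probability Omega R) (I : finType)
    (S : {set I}) (X : I -> {RV P >-> R}) : Prop :=
  forall (J : {set I}) (A : I -> set R),
    J \subset S -> (forall i, measurable (A i)) ->
    P (\bigcap_(i in [set` J]) (X i @^-1` A i)) =
    (\prod_(i in J) P (X i @^-1` A i))%E.

Definition supergraph_rate (R : realType) (V : finType) (H F : sgraph V)
    (lam p : R) : R :=
  lam * (#|sg_aut H|%:R / #|sg_aut F|%:R) * p ^+ (#|edges F| - #|edges H|) *
  (1 - p) ^+ ('C(#|V|, 2) - #|edges F|).

Definition pairs (n : nat) : {set {set 'I_n}} := [set e : {set 'I_n} | #|e| == 2%N]%SET.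

Lemma sum_sgraph (R : realType) n (f : {set {set 'I_n}} -> R) :
  \sum_(G : sgraph 'I_n) f (edges G) = \sum_(E : {set {set 'I_n}} | E \subset pairs n) f E.
Proof.
have h (E : {set {set 'I_n}}) : (E \subset pairs n) = [forall e in E, #|e| == 2%N].
  apply/fintype.subsetP/forallP => [H e|H e eE].
    by apply/implyP => /H; rewrite inE.
  by move: (H e); rewrite eE inE.
under [RHS]eq_bigl do rewrite h.
rewrite (reindex_omap (@edges _) (fun E => insub E : option (sgraph 'I_n))) /=; last first.
  by move=> E hE; rewrite insubT.
apply: eq_bigl => G; have := edges_card2 G => ->.
by rewrite (valK G) eqxx.
Qed.

Lemma cg_edges_subset (R : realType) n (p : R) (S : {set {set 'I_n}}) :
  S \subset pairs n ->
  \sum_(G : sgraph 'I_n) (S \subset edges G)%:R *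
    (p ^+ #|edges G| * (1 - p) ^+ ('C(n, 2) - #|edges G|)) = p ^+ #|S|.
Proof.
move=> Sp.
rewrite (sum_sgraph (fun E => (S \subset E)%:R * (p ^+ #|E| * (1 - p) ^+ ('C(n, 2) - #|E|)))).
pose K := pairs n.
pose F (e : {set 'I_n}) : R := if e \in K then p else 0.
pose G (e : {set 'I_n}) : R := if e \in S then 0 else if e \in K then 1 - p else 1.
have -> : p ^+ #|S| = \prod_e (F e + G e).
  rewrite (bigID (mem S)) /= [X in _ = _ * X]big1 ?mulr1.
    rewrite -prodr_const; apply: eq_bigr => e eS.
    by rewrite /F /G eS (fintype.subsetP Sp _ eS) addr0.
  move=> e eS; rewrite /F /G (negbTE eS); case: ifP => _; last by rewrite add0r.
  by rewrite addrC subrK.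
rewrite bigA_distr.
rewrite [RHS](bigID (fun E : {set {set 'I_n}} => E \subset K)) /=.
rewrite [X in _ = _ + X]big1 ?addr0; last first.
  move=> E /fintype.subsetPn [e eE eK].
  by rewrite (bigD1 e) //= eE /F (negbTE eK) mul0r.
apply: eq_bigr => E EK.
case: (boolP (S \subset E)) => [SE|/fintype.subsetPn[e eS eE]]; last first.
  by rewrite mul0r (bigD1 e) //= (negbTE eE) /G eS mul0r.
rewrite mul1r (bigID (mem E)) /=.
congr (_ * _).
  rewrite -prodr_const; apply: eq_bigr => e eE.
  by rewrite eE /F (fintype.subsetP EK _ eE).
rewrite (bigID (mem K)) /= [X in _ = _ * X]big1 ?mulr1; last first.
  move=> e /andP[eE eK]; rewrite (negbTE eE) /G (negbTE eK).
  by case: ifP => // /(fintype.subsetP SE); rewrite (negbTE eE).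
have -> : ('C(n,2) - #|E|)%N = #|K :\: E|.
  by rewrite cardsDS // /K /pairs card_draws card_ord.
rewrite -prodr_const; apply: eq_big => [e|e]; rewrite !inE // => /andP[eE eK].
rewrite (negbTE eE) /G inE eK; case: ifP => // /(fintype.subsetP SE); by rewrite (negbTE eE).
Qed.

Lemma card_mono_coloring (V : finType) n c (s : {ffun V -> 'I_n}) :
  injective s -> (0 < #|V|)%N ->
  #|[set X : {ffun 'I_n -> 'I_c} | [forall a, forall b, X (s a) == X (s b)]]%SET|
   = (c * c ^ (n - #|V|))%N.
Proof.
move=> si V0; have [a0 _] := card_gt0P V0.
pose M (k : 'I_c) := [set X : {ffun 'I_n -> 'I_c} | [forall a, X (s a) == k]]%SET.
have -> : [set X : {ffun 'I_n -> 'I_c} | [forall a, forall b, X (s a) == X (s b)]]%SET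
  = (\bigcup_(k : 'I_c) M k)%SET.
  apply/finset.setP => X; rewrite inE; apply/idP/finset.bigcupP.
    move=> /forallP h; exists (X (s a0)) => //; rewrite inE; apply/forallP => a.
    by move: (forallP (h a) a0).
  case=> k _; rewrite inE => /forallP h; apply/forallP => a; apply/forallP => b.
  by rewrite (eqP (h a)) (eqP (h b)).
have cM k : #|M k| = (c ^ (n - #|V|))%N.
  pose fam (i : 'I_n) := if i \in codom s then pred1 k else predT.
  have -> : #|M k| = #|family fam|.
    apply: eq_card => X; rewrite inE; apply/forallP/familyP => [h i|h a].
      rewrite /fam; case: ifP => // /codomP[a ->]; exact: h.
    by move: (h (s a)); rewrite /fam codom_f.
  rewrite card_family foldrE big_map big_enum /=.
  rewrite (bigID (mem (codom s))) /= big1 ?mul1n; last first.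
    by move=> i ic; rewrite /fam ic card1.
  under eq_bigr => i ic do rewrite /fam (negbTE ic) card_ord.
  rewrite prod_nat_const; congr (_ ^ _)%N.
  have := cardC (mem (codom s)); rewrite card_ord (card_codom si) => hh.
  transitivity #|[predC mem (codom s)]|; first exact: eq_card.
  by apply/eqP; rewrite -(eqn_add2l #|V|) hh subnKC // -hh leq_addr.
rewrite -sum1_card partition_disjoint_bigcup /=; last first.
  move=> i j ij; rewrite -finset.setI_eq0; apply/eqP/finset.setP => X; rewrite !inE.
  apply/negP => /andP[/forallP/(_ a0)/eqP h1 /forallP/(_ a0)/eqP h2].
  by move: ij; rewrite -h1 -h2 eqxx.
under eq_bigr do rewrite sum1_card cM.
by rewrite sum_nat_const card_ord.
Qed.

Lemma cg_expect_Tmono (R : realType) (V : finType) (H : sgraph V) (n c : nat) (p : R) :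
  (0 < c)%N -> (0 < #|V|)%N ->
  cg_expect p (@Tmono R V H n c) =
  ((#|V|)`! * 'C(n, #|V|))%:R * p ^+ #|edges H| /
  (#|sg_aut H|%:R * c%:R ^+ (#|V|.-1)).
Proof.
move=> c0 V0.
rewrite /cg_expect /Tmono /mono_copies /cg_mass /=.
have AA (a d : R) (F : {ffun V -> 'I_n} -> R) : a * (\sum_(s : {ffun V -> 'I_n} | injectiveb s) F s) * d = \sum_(s : {ffun V -> 'I_n} | injectiveb s) a * (F s * d).
  by rewrite -mulrA mulr_suml mulr_sumr.
under eq_bigr => w _ do rewrite AA.
rewrite exchange_big /=.
have key (s : {ffun V -> 'I_n}) : injectiveb s ->
 \sum_(w : colored_graph n c) #|sg_aut H|%:R^-1 * (
   \prod_(e in edges H) (s @: e \in edges w.1)%:R * [forall a, forall b, w.2 (s a) == w.2 (s b)]%:R *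
   (p ^+ #|edges w.1| * (1 - p) ^+ ('C(n, 2) - #|edges w.1|) * (c ^ n)%:R^-1)) =
  #|sg_aut H|%:R^-1 * p ^+ #|edges H| * (c%:R ^+ (#|V|.-1))^-1.
  move=> /injectiveP si.
  rewrite -big_distrr /= -mulrA; congr (_ * _).
  rewrite -(pair_bigA _ (fun (G : sgraph 'I_n) (X : {ffun 'I_n -> 'I_c}) => \prod_(e in edges H) (s @: e \in edges G)%:R * [forall a, forall b, X (s a) == X (s b)]%:R *
   (p ^+ #|edges G| * (1 - p) ^+ ('C(n, 2) - #|edges G|) * (c ^ n)%:R^-1))) /=.
  pose S := [set (s @: e)%SET | e : {set V} in edges H]%SET.
  have Sp : S \subset pairs n.
    apply/fintype.subsetP => _ /finset.imsetP[e eH ->]; rewrite inE card_imset //.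
    by move: (forallP (edges_card2 H) e); rewrite eH.
  have cS : #|S| = #|edges H| by rewrite card_imset //; exact: imset_inj.
  rewrite -cS -(cg_edges_subset p Sp) mulr_suml; apply: eq_bigr => G _.
  have -> : \prod_(e in edges H) (s @: e \in edges G)%:R = (S \subset edges G)%:R :> R.
    case: (boolP (S \subset edges G)) => [/fintype.subsetP SG|/fintype.subsetPn [_ /finset.imsetP[e eH ->] eG]].
      by rewrite big1 // => e eH; rewrite SG // imset_f.
    by rewrite (bigD1 e) //= (negbTE eG) mul0r.
  under eq_bigr => X _ do rewrite mulrAC !mulrA.
  rewrite -big_distrr /= -!mulrA; do 3 congr (_ * _).
  rewrite -natr_sum.
  rewrite (_ : (\sum_i _)%N = (c * c ^ (n - #|V|))%N); last first.
    rewrite -(card_mono_coloring _ si V0) -sum1_card big_mkcond /=.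
    by rewrite [RHS]big_mkcond /=; apply: eq_bigr => X _; rewrite inE; case: ifP.
  have vn : (#|V| <= n)%N by rewrite -(card_ord n); exact: leq_card si.
  have c00 : c%:R != 0 :> R by rewrite pnatr_eq0 -lt0n.
  have -> : (c ^ n = c ^ (n - #|V|) * (c * c ^ #|V|.-1))%N.
    by rewrite -expnS prednK // -expnD subnK.
  rewrite !natrM !natrX.
  have u1 : c%:R ^+ (n - #|V|) != 0 :> R by rewrite expf_neq0.
  have u2 : c%:R ^+ #|V|.-1 != 0 :> R by rewrite expf_neq0.
  by field; rewrite u1 u2 c00.
rewrite (eq_bigr _ key) sumr_const.
have -> : #|(fun s : {ffun V -> 'I_n} => injectiveb s)| = ((#|V|)`! * 'C(n, #|V|))%N.
  rewrite mulnC bin_ffact -[n in (n ^_ _)%N](card_ord n) -card_inj_ffuns.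
  by apply: eq_card => s; rewrite inE.
rewrite -[LHS]mulr_natl invfM -!mulrA; congr (_ * _); exact: mulrCA.
Qed.

(* Main.v *)
Require Import Defs.
From mathcomp Require Import all_boot all_order all_algebra all_fingroup.
From mathcomp Require Import all_classical all_reals all_analysis.
From mathcomp Require Import measurable_realfun.
From mathcomp Require Import ring lra zify.

(**
The number [T] of monochromatic copies is studied through its law in the dense
and sparse Poisson regimes, through a first moment below the threshold, and
through its moments at the threshold.

Above the threshold, condition on a given copy being present and monochromatic.
If no other copy partially overlaps it, [T] is the number of copies of [H] in
the graph induced on the vertex set of this copy, plus the number of copies
disjoint from it, and these two numbers are independent ([mono_count_split],
[expect_indep]). Summing over the copies yields
  [k P(T = k) = sum_j r_j P(T = k - j) + error]
where [r_j] is the expected number of copies weighted by the probability that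
the vertex set of a copy carries exactly [j] of them ([panjer_approx]). Without
the error, this is the Panjer recursion, which characterizes, up to
normalization, Poisson laws when only [r_1] is nonzero and compound Poisson laws
in general ([compound_rec]); as the means are bounded, no mass escapes and the
recursion passes to the limit ([panjer_limit], [mono_pmf_cvg]). The error is a sum over the subgraphs [K] of
[H] along which two copies may overlap. Eliminating the number of colors through
the convergence of the mean, the contribution of [K] is controlled by a power of
[n ^ gamma * p], because [gamma] is a minimum over [K]
([overlap_ratio_sparse]). If [p] tends to [0], a vertex set carrying a copy
carries with high probability no other one, and the limit is Poisson; if [p] is
constant, the graph induced on the vertex set of a copy is random, which gives
the compound Poisson law ([multiplicity_classes], a double counting of labelled supergraphs by
isomorphism classes).

Below the threshold, the subgraph [K] attaining the minimum has itself few
monochromatic copies: their expected number tends to [0], and every copy of [H]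
contains one ([below_threshold]).

At the threshold, expand a moment over tuples of copies, grouped by the way in
which they overlap ([moment_patterns]). Each term is of the form
[n ^ m * p ^ E / c ^ r]. Gluing the copies one after the other, the inequalities
defining [gamma] show that the exponent of [n] in this term, once [p] and [c]
are expressed through [n], is never positive ([rank_bound]); hence each term
converges ([pattern_term_cvg]), and so do the moments. In the second moment, the
pairs of disjoint copies and the pairs of copies with the same vertex set give at
least [lam ^ 2 + lam], and the pairs overlapping along a minimizer add a positive
limit ([second_moment_excess]). A Poisson limit would have parameter [lam],
since the convergence of all moments makes mean and second moment pass to the
limit, and its second moment would be exactly [lam ^ 2 + lam].
*)

Set Implicit Arguments.
Unset Strict Implicit.
Unset Printing Implicit Defensive.

Import Order.TTheory GRing.Theory Num.Theory.
Import numFieldNormedType.Exports.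

Local Open Scope classical_set_scope.
Local Open Scope ring_scope.

(** * Relabellings and isomorphism classes *)

Section Relabel.
Variable V : finType.
Implicit Types (G H F K : sgraph V) (s t : {perm V}).

Lemma edge_card2 (U : finType) (G : sgraph U) e : e \in edges G -> #|e| = 2%N.
Proof. by move=> eG; have /forallP/(_ e) := edges_card2 G; rewrite eG => /eqP. Qed.

Lemma edgesI (U : finType) : injective (@edges U).
Proof. exact: val_inj. Qed.

Fact relabel_subproof G (s : {perm V}) :
  [forall e in [set [set s x | x in e] | e : {set V} in edges G]%SET, #|e| == 2%N].
Proof.
apply/forallP => e; apply/implyP => /finset.imsetP[e' e'G ->].
by rewrite card_imset ?(edge_card2 e'G) //; exact: perm_inj.
Qed.

Definition relabel s G : sgraph V := SGraph (relabel_subproof G s).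

Arguments relabel : simpl never.

Lemma edges_relabel s G :
  edges (relabel s G) = [set [set s x | x in e] | e : {set V} in edges G]%SET.
Proof. by []. Qed.

Lemma imsetM_perm (s t : {perm V}) (e : {set V}) :
  [set (s * t)%g x | x in e]%SET = [set t x | x in [set s x | x in e]]%SET.
Proof. by rewrite -imset_comp; apply: eq_imset => x; rewrite permM. Qed.

Lemma imset_perm1 (e : {set V}) : [set (1 : {perm V})%g x | x in e]%SET = e.
Proof.
by rewrite -[RHS]imset_id; apply: eq_imset => x; rewrite perm1.
Qed.

Lemma relabelM s t G : relabel (s * t)%g G = relabel t (relabel s G).
Proof.
apply: edgesI; rewrite !edges_relabel -imset_comp; apply: eq_imset => e /=.
exact: imsetM_perm.
Qed.

Lemma relabel1 G : relabel 1%g G = G.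
Proof.
apply: edgesI; rewrite !edges_relabel -[RHS]imset_id; apply: eq_imset => e.
exact: imset_perm1.
Qed.

Lemma relabelK s : cancel (relabel s) (relabel s^-1).
Proof. by move=> G; rewrite -relabelM mulgV relabel1. Qed.

Lemma relabelVK s : cancel (relabel s^-1) (relabel s).
Proof. by move=> G; rewrite -relabelM mulVg relabel1. Qed.

Lemma mem_relabel s G (e : {set V}) : ([set s x | x in e]%SET \in edges (relabel s G)) = (e \in edges G).
Proof. by rewrite edges_relabel mem_imset //; apply: imset_inj; exact: perm_inj. Qed.

Lemma adj_relabel s G x y : adj (relabel s G) (s x) (s y) = adj G x y.
Proof. by rewrite /adj -[RHS](mem_relabel s) imsetU !imset_set1. Qed.

Lemma eq_adj G1 G2 : (forall x y, adj G1 x y = adj G2 x y) -> G1 = G2.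
Proof.
move=> h; apply: edgesI; apply/finset.setP => e.
have [/cards2P[x [y [xy ->]]]|n2] := boolP (#|e| == 2%N); first exact: h.
by apply/idP/idP => /edge_card2 /eqP; rewrite (negbTE n2).
Qed.

Lemma is_isoE G1 G2 s : is_iso G1 G2 s = (G2 == relabel s G1).
Proof.
apply/idP/eqP => [/forallP h|->].
  apply: eq_adj => x y.
  rewrite -[x](permKV s) -[y](permKV s) adj_relabel.
  by move/forallP: (h ((s^-1)%g x)) => /(_ ((s^-1)%g y))/eqP.
by apply/forallP => x; apply/forallP => y; rewrite adj_relabel.
Qed.

Lemma sg_isoP G1 G2 : reflect (exists s, G2 = relabel s G1) (sg_iso G1 G2).
Proof.
apply: (iffP existsP) => -[s]; first by rewrite is_isoE => /eqP->; exists s.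
by move=> ->; exists s; rewrite is_isoE.
Qed.

Lemma sg_iso_refl : reflexive (@sg_iso V).
Proof. by move=> G; apply/sg_isoP; exists 1%g; rewrite relabel1. Qed.

Lemma sg_iso_sym : symmetric (@sg_iso V).
Proof.
suff h G1 G2 : sg_iso G1 G2 -> sg_iso G2 G1 by move=> G1 G2; apply/idP/idP; exact: h.
by move=> /sg_isoP[s ->]; apply/sg_isoP; exists s^-1%g; rewrite relabelK.
Qed.

Lemma sg_iso_trans : transitive (@sg_iso V).
Proof.
move=> G2 G1 G3 /sg_isoP[s ->] /sg_isoP[t ->]; apply/sg_isoP.
by exists (s * t)%g; rewrite relabelM.
Qed.

Lemma card_relabel s G : #|edges (relabel s G)| = #|edges G|.
Proof. by rewrite edges_relabel card_imset //; apply: imset_inj; exact: perm_inj. Qed.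

Lemma sg_autE G s : (s \in sg_aut G) = (relabel s G == G).
Proof. by rewrite inE is_isoE eq_sym. Qed.

Lemma sg_aut_gt0 G : (0 < #|sg_aut G|)%N.
Proof. by apply/card_gt0P; exists 1%g; rewrite sg_autE relabel1. Qed.

(** The relabellings carrying [G] onto a fixed isomorphic graph form a coset of
    the automorphism group. *)
Lemma card_relabel_fiber G K : #|[set s | relabel s G == K]%SET| = (sg_iso G K * #|sg_aut G|)%N.
Proof.
have [/sg_isoP[t ->]|nK] := boolP (sg_iso G K); last first.
  apply/eqP; rewrite mul0n cards_eq0; apply/eqP/finset.setP => s; rewrite !inE.
  apply/negbTE; apply: contra nK => /eqP<-; apply/sg_isoP; by exists s.
rewrite mul1n.
rewrite -[RHS](@card_imset _ _ (fun s => s * t)%g _ (@mulIg _ t)).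
apply: eq_card => s; rewrite inE; apply/eqP/finset.imsetP => [h|[u]].
  exists (s * t^-1)%g; last by rewrite mulgKV.
  by rewrite sg_autE relabelM h relabelK.
by rewrite sg_autE => /eqP h ->; rewrite relabelM h.
Qed.

(** Group the relabellings by the labelled copy of [H] that they produce. *)
Lemma card_relabel_sub H F :
  #|[set s | edges (relabel s H) \subset edges F]%SET| = (#|sg_aut H| * ncopies H F)%N.
Proof.
rewrite -sum1_card (partition_big (fun s => relabel s H)
   (fun K => K \in [set K : sgraph V | sg_iso H K & edges K \subset edges F]%SET)); last first.
  by move=> s; rewrite !inE => ->; rewrite andbT; apply/sg_isoP; exists s.
rewrite mulnC -sum_nat_const; apply: eq_bigr => K; rewrite inE => /andP[HK KF].
have <- : #|[set s | relabel s H == K]%SET| = #|sg_aut H|.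
  by rewrite card_relabel_fiber HK mul1n.
rewrite -sum1_card; apply: eq_bigl => s; rewrite !inE; have [->|] := eqVneq (relabel s H) K; first by rewrite KF.
by rewrite andbF.
Qed.

Lemma card_perms : #|{perm V}| = (#|V|)`!.
Proof.
rewrite -[#|V| in RHS]cardsT -card_perm -cardsT; apply: eq_card => s.
by rewrite !inE; symmetry; apply/fintype.subsetP => x _; rewrite inE.
Qed.

(** Orbit-stabilizer for the relabelling action. *)
Lemma card_iso_class G : (#|[set K | sg_iso G K]%SET| * #|sg_aut G|)%N = (#|V|)`!.
Proof.
rewrite -card_perms -[RHS]sum1_card (partition_big (fun s => relabel s G)
  (fun K => K \in [set K | sg_iso G K]%SET)) /=; last first.
  by move=> s _; rewrite inE; apply/sg_isoP; exists s.
rewrite -sum_nat_const; apply: eq_bigr => K; rewrite inE => GK.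
have <- : #|[set s | relabel s G == K]%SET| = #|sg_aut G|.
  by rewrite card_relabel_fiber GK mul1n.
by rewrite -sum1_card; apply: eq_bigl => s; rewrite inE.
Qed.

(** Relabelling permutes the copies. *)
Lemma ncopies_relabel H F s : ncopies H (relabel s F) = ncopies H F.
Proof.
apply/eqP; rewrite -(eqn_pmul2l (sg_aut_gt0 H)) -!card_relabel_sub.
rewrite -(@card_imset _ _ (fun t => t * s)%g [set t | edges (relabel t H) \subset edges F]%SET (@mulIg _ s)).
apply/eqP/eq_card => t; rewrite inE; apply/idP/finset.imsetP => [h|[u]].
  exists (t * s^-1)%g; last by rewrite mulgKV.
  rewrite inE relabelM -[F](relabelK s).
  by apply/imsetS.
by rewrite inE => h ->; rewrite relabelM; apply/imsetS.
Qed.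

Lemma ncopies_self H : ncopies H H = 1%N.
Proof.
apply/eqP/cards1P; exists H; apply/finset.setP => K; rewrite !inE.
apply/andP/eqP => [[/sg_isoP[s ->] h]|->]; last by rewrite sg_iso_refl.
by apply: edgesI; apply/eqP; rewrite eqEcard h card_relabel leqnn.
Qed.

Lemma ncopies_gt0 H F : edges H \subset edges F -> (0 < ncopies H F)%N.
Proof. by move=> HF; apply/card_gt0P; exists H; rewrite inE sg_iso_refl. Qed.

Lemma supergraph_partition H (D := [set F : sgraph V | (0 < ncopies H F)%N]%SET) :
  finset.partition (equivalence_partition (@sg_iso V) D) D.
Proof.
apply: equivalence_partitionP => x y z _ _ _; split; first exact: sg_iso_refl.
by move=> xy; apply/idP/idP; apply: sg_iso_trans; rewrite // sg_iso_sym.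
Qed.

Lemma supergraph_classes_gt0 H F : F \in supergraph_classes H -> (0 < ncopies H F)%N.
Proof.
move=> /(fintype.subsetP (transversal_sub (transversalP (supergraph_partition H)))).
by rewrite inE.
Qed.

(** Double counting of the pairs of a labelled graph and a copy of [H] in it:
    a sum over labelled supergraphs of [H] is a sum over isomorphism classes. *)
Lemma sum_supergraph_classes (R : realType) H (g : sgraph V -> R) :
  (forall s F, g (relabel s F) = g F) ->
  \sum_(K : sgraph V | edges H \subset edges K) g K =
  \sum_(F in supergraph_classes H)
     (ncopies H F)%:R * (#|sg_aut H|%:R / #|sg_aut F|%:R) * g F.
Proof.
move=> gI.
have fact0 : (#|V|)`!%:R != 0 :> R by rewrite pnatr_eq0 -lt0n fact_gt0.
have shift s : \sum_(K : sgraph V | edges H \subset edges K) g K =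
    \sum_(K : sgraph V | edges (relabel s H) \subset edges K) g K.
  rewrite [RHS](reindex (relabel s)) /=; last first.
    by exists (relabel s^-1) => G _; rewrite ?relabelK ?relabelVK.
  apply: eq_big => K; last by rewrite gI.
  apply/idP/idP => [/(imsetS (fun e : {set V} => [set s x | x in e]%SET))//|h].
  rewrite -[H](relabelK s) -[K](relabelK s).
  exact: (imsetS (fun e : {set V} => [set (s^-1)%g x | x in e]%SET) h).
have E : (#|V|)`!%:R * \sum_(K : sgraph V | edges H \subset edges K) g K =
   \sum_(K : sgraph V) (#|sg_aut H| * ncopies H K)%:R * g K.
  transitivity (\sum_(s : {perm V}) \sum_(K : sgraph V | edges (relabel s H) \subset edges K) g K).
    rewrite -(eq_bigr _ (fun s _ => shift s)).
    by rewrite sumr_const -[RHS]mulr_natl -card_perms; congr (_%:R * _); exact: eq_card.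
  rewrite (exchange_big_dep xpredT) //=; apply: eq_bigr => K _.
  rewrite sumr_const -[LHS]mulr_natl -card_relabel_sub; congr (_%:R * _).
  by apply: eq_card => s; rewrite inE.
apply: (mulfI fact0); rewrite E mulr_sumr.
pose D := [set F : sgraph V | (0 < ncopies H F)%N]%SET.
have partD := supergraph_partition H; rewrite -/D in partD.
rewrite (bigID (mem D)) /= [X in _ + X]big1 ?addr0; last first.
  by move=> K; rewrite inE -leqNgt leqn0 => /eqP->; rewrite muln0 mul0r.
rewrite -(eq_bigl (mem D) _ (fun=> erefl)) (set_partition_big _ partD) /=.
have trD := transversalP partD.
rewrite /supergraph_classes -/D; set P := equivalence_partition _ D in partD trD *.
rewrite [RHS](reindex_onto (fun B => transversal_repr H (transversal P D) B) (finset.pblock P)) /=; last first.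
  by move=> F FT; rewrite (pblockK trD).
apply: eq_big => [B|B BP].
  apply/idP/andP => [BP|[]].
    split; first exact: (repr_mem_transversal trD).
    apply/eqP; exact: (transversal_reprK trD).
  by move=> h /eqP <-; rewrite pblock_mem // (cover_partition partD) (fintype.subsetP (transversal_sub trD)).
set F := transversal_repr H _ B.
have FB : F \in B by apply: (repr_mem_pblock trD).
have FD : F \in D by rewrite -(cover_partition partD); apply/finset.bigcupP; exists B.
have BE : B = [set K | sg_iso F K]%SET.
  rewrite -(def_pblock (partition_trivIset partD) BP FB).
  apply/finset.setP => K; rewrite inE.
  have [KD|KD] := boolP (K \in D).
    rewrite pblock_equivalence_partition // => x y z _ _ _; split; first exact: sg_iso_refl.
    by move=> xy; apply/idP/idP; apply: sg_iso_trans; rewrite // sg_iso_sym.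
  transitivity false; last first.
    apply/esym/negbTE/negP => /sg_isoP[s KE]; case/negP: KD; move: FD.
    by rewrite !inE KE ncopies_relabel.
  apply/negbTE; apply: contra KD => h.
  rewrite -(cover_partition partD); apply/finset.bigcupP; exists (finset.pblock P F) => //.
  by rewrite pblock_mem // (cover_partition partD).
have -> : \sum_(K in B) (#|sg_aut H| * ncopies H K)%:R * g K =
   \sum_(K in B) (#|sg_aut H| * ncopies H F)%:R * g F.
  apply: eq_bigr => K; rewrite BE inE => /sg_isoP[s ->].
  by rewrite ncopies_relabel gI.
rewrite sumr_const BE -mulr_natl -(card_iso_class F) !natrM.
have : #|sg_aut F|%:R != 0 :> R by rewrite pnatr_eq0 -lt0n sg_aut_gt0.
by move=> h; field.
Qed.

End Relabel.

(** * Monochromatic copies as embeddings *)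

Section Embeddings.
Variables (V U C : finType) (H : sgraph V).
Implicit Types (G : sgraph U) (X : {ffun U -> C}) (s : {ffun V -> U}).

Definition mono_embedding G X s : bool :=
  [&& injectiveb s, [forall e in edges H, s @: e \in edges G]
    & [forall a, forall b, X (s a) == X (s b)]].

Definition vimage s : {set U} := [set s a | a : V]%SET.

Lemma mem_vimage s v : s v \in vimage s.
Proof. exact: imset_f. Qed.

Definition mono_count G X : nat :=
  #|[set s | mono_embedding G X s]%SET| %/ #|sg_aut H|.

Fact pullback_subproof s G :
  [forall e in [set e : {set V} | (#|e| == 2%N) && (s @: e \in edges G)]%SET, #|e| == 2%N].
Proof. by apply/forallP => e; apply/implyP; rewrite inE => /andP[]. Qed.

Definition pullback s G : sgraph V := SGraph (pullback_subproof s G).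

Lemma mem_pullback s G (e : {set V}) :
  (e \in edges (pullback s G)) = (#|e| == 2%N) && (s @: e \in edges G).
Proof. by rewrite inE. Qed.

Lemma injectiveb_comp_perm s (t : {perm V}) : injectiveb [ffun x => s (t x)] = injectiveb s.
Proof.
apply/injectiveP/injectiveP => si x y.
  move=> sxy; have := si (t^-1 x)%g (t^-1 y)%g; rewrite !ffunE !permKV => /(_ sxy) /(congr1 t).
  by rewrite !permKV.
by rewrite !ffunE => /si /perm_inj.
Qed.

Lemma vimage_comp_perm s (t : {perm V}) : vimage [ffun x => s (t x)] = vimage s.
Proof.
apply/finset.setP => u; apply/finset.imsetP/finset.imsetP => [[a _ ->]|[a _ ->]].
  by exists (t a) => //; rewrite ffunE.
by exists (t^-1 a)%g => //; rewrite ffunE permKV.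
Qed.

(** Seen through the embedding [s], precomposing with [t] amounts to
    relabelling [H] inside the graph that [s] pulls back. *)
Lemma mono_embedding_comp_perm G X s (t : {perm V}) : mono_embedding G X s ->
  mono_embedding G X [ffun x => s (t x)] = (edges (relabel t H) \subset edges (pullback s G)).
Proof.
case/and3P=> si sH sX; rewrite /mono_embedding injectiveb_comp_perm si andTb.
have -> : [forall a, forall b, X ([ffun x => s (t x)] a) == X ([ffun x => s (t x)] b)].
  apply/forallP => a; apply/forallP => b; rewrite !ffunE.
  by move/forallP: (forallP sX (t a)).
rewrite andbT.
have E (e : {set V}) : [ffun x => s (t x)] @: e = s @: [set t x | x in e]%SET.
  by rewrite -imset_comp; apply: eq_imset => x; rewrite ffunE.
apply/forallP/fintype.subsetP => [h e|h e].
  rewrite edges_relabel => /finset.imsetP[e' e'H ->]; rewrite mem_pullback.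
  rewrite (card_imset _ (@perm_inj _ t)) (edge_card2 e'H) eqxx /=.
  by have := h e'; rewrite e'H E.
apply/implyP => eH; rewrite E.
by have := h [set t x | x in e]%SET; rewrite mem_relabel mem_pullback => /(_ eH)/andP[].
Qed.

(** Embeddings with the same image differ by a relabelling of [H], so that the
    copies of [H] on a fixed monochromatic vertex set are counted inside the
    graph pulled back along any one of them. *)
Lemma card_same_image G X s0 : mono_embedding G X s0 ->
  #|[set s | mono_embedding G X s & vimage s == vimage s0]%SET| =
  (#|sg_aut H| * ncopies H (pullback s0 G))%N.
Proof.
move=> h0; have /and3P[/injectiveP s0i _ _] := h0; rewrite -card_relabel_sub.
pose F (t : {perm V}) : {ffun V -> U} := [ffun x => s0 (t x)].
have Fi : injective F.
  by move=> t u /ffunP tu; apply/permP => x; apply: s0i; have := tu x; rewrite !ffunE.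
rewrite -[RHS](card_imset _ Fi); apply: eq_card => s; rewrite inE.
apply/andP/finset.imsetP => [[hs /eqP ims]|[t]]; last first.
  by rewrite inE => ht ->; rewrite mono_embedding_comp_perm // ht vimage_comp_perm eqxx.
have q x : s x \in codom s0.
  have : s x \in vimage s0 by rewrite -ims imset_f.
  by case/finset.imsetP => y _ ->; exact: codom_f.
pose f x := iinv (q x).
have sf x : s0 (f x) = s x by rewrite /f f_iinv.
have fi : injective f.
  have /and3P[/injectiveP si _ _] := hs.
  by move=> x y fxy; apply: si; rewrite -!sf fxy.
have sE : s = F (perm fi) by apply/ffunP => x; rewrite ffunE permE sf.
by exists (perm fi) => //; rewrite inE -(mono_embedding_comp_perm _ h0) -/(F _) -sE.
Qed.

(** Split according to the image of the embeddings: by the previous lemma,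
    each image contributes a multiple of the number of automorphisms. *)
Lemma aut_dvd_embeddings G X (Q : pred {set U}) :
  (#|sg_aut H| %| #|[set s | mono_embedding G X s & Q (vimage s)]%SET|)%N.
Proof.
rewrite -[X in (_ %| X)%N]sum1_card (partition_big vimage xpredT) //=; apply: dvdn_sum => S _.
rewrite sum1_card.
have [[s0 hs0]|n0] := pselect (exists s0, [&& mono_embedding G X s0, Q (vimage s0) & vimage s0 == S]).
  have /and3P[h0 q0 /eqP S0] := hs0.
  rewrite (_ : #|_| = #|[set s | mono_embedding G X s & vimage s == vimage s0]%SET|).
    by rewrite card_same_image // dvdn_mulr.
  apply: eq_card => s; rewrite !inE -S0 [LHS]inE inE.
  by have [->|] := eqVneq (vimage s) (vimage s0); rewrite ?andbF // q0 !andbT.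
rewrite (_ : #|_| = 0%N) ?dvdn0 //; apply/eqP/pred0P => s /=.
rewrite !inE; apply/negP => /andP[/andP[a b] c]; apply: n0.
by exists s; rewrite a b c.
Qed.

Lemma aut_dvd_card_embeddings G X :
  (#|sg_aut H| %| #|[set s | mono_embedding G X s]%SET|)%N.
Proof.
have := aut_dvd_embeddings G X xpredT.
by under eq_finset do rewrite andbT.
Qed.

Definition disjoint_count G X s0 : nat :=
  #|[set s | mono_embedding G X s & [disjoint vimage s & vimage s0]]%SET| %/ #|sg_aut H|.

Definition meeting s0 s : bool := ~~ [disjoint vimage s & vimage s0].

Definition overlapping s0 s : bool := meeting s0 s && (vimage s != vimage s0).

Lemma vimage_neq0 s : (0 < #|V|)%N -> vimage s != finset.set0.
Proof. by move=> /card_gt0P[a _]; apply/finset.set0Pn; exists (s a); rewrite imset_f. Qed.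

(** On the event that [s0] is a monochromatic copy partially overlapped by no
    other one, the count splits into a part living on the image of [s0] and a
    part living on its complement. *)
Lemma mono_count_split G X s0 : (0 < #|V|)%N -> mono_embedding G X s0 ->
  (forall s, overlapping s0 s -> ~~ mono_embedding G X s) ->
  mono_count G X = (ncopies H (pullback s0 G) + disjoint_count G X s0)%N.
Proof.
move=> V0 h0 hov; rewrite /mono_count /disjoint_count.
have a0 := sg_aut_gt0 H.
rewrite -[X in (X + _)%N](mulKn _ a0) -(card_same_image h0) -divnDl; last first.
  by rewrite card_same_image // dvdn_mulr.
congr (_ %/ _)%N.
rewrite -cardsUI [X in (_ + X)%N](_ : _ = 0%N) ?addn0; last first.
  apply/eqP; rewrite cards_eq0; apply/eqP/finset.setP => s; rewrite !inE.
  apply/negP => /andP[/andP[_ /eqP->]] /andP[_].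
  by rewrite -setI_eq0 finset.setIid (negbTE (vimage_neq0 _ V0)).
apply: eq_card => s; rewrite !inE.
have [hs|//] := boolP (mono_embedding G X s); rewrite /=.
have := contraTN (hov s) hs; rewrite negb_and negbK negbK.
by rewrite orbC => ->.
Qed.

Lemma mono_countE G X : #|[set s | mono_embedding G X s]%SET| = (mono_count G X * #|sg_aut H|)%N.
Proof. by rewrite /mono_count divnK ?aut_dvd_card_embeddings. Qed.

(** The normalized sum is a natural number, since the division by the number
    of automorphisms is exact. *)
Lemma mono_copiesE (R : realType) G X : mono_copies R H G X = (mono_count G X)%:R.
Proof.
have a0 : #|sg_aut H|%:R != 0 :> R by rewrite pnatr_eq0 -lt0n sg_aut_gt0.
apply: (mulfI a0); rewrite /mono_copies mulVKf // -natrM mulnC -mono_countE.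
rewrite -sum1_card natr_sum [RHS]big_mkcond [LHS]big_mkcond /=; apply: eq_bigr => s _.
rewrite inE /mono_embedding; case: (injectiveb s) => //=.
case: (boolP [forall e in edges H, s @: e \in edges G]) => [/forallP h|].
  rewrite big1 ?mul1r => [|e eH]; first by case: [forall a, forall b, X (s a) == X (s b)].
  by have := h e; rewrite eH => /= ->.
case/forallPn => e; rewrite negb_imply => /andP[eH eG].
by rewrite (bigD1 e) //= (negbTE eG) !mul0r.
Qed.

End Embeddings.
Arguments pullback : simpl never.

(** * Expectation over random colored graphs *)

Section Expectation.
Variables (R : realType) (n c : nat) (p : R).
Hypotheses (p01 : 0 < p < 1) (c0 : (0 < c)%N).
Implicit Types (f g : colored_graph n c -> R) (A B : pred (colored_graph n c)).

Let E := @cg_expect R n c p.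
Let Pr := @cg_prob R n c p.

Definition graph_mass (G : sgraph 'I_n) : R :=
  p ^+ #|edges G| * (1 - p) ^+ ('C(n, 2) - #|edges G|).

Lemma cg_mass_ge0 (w : colored_graph n c) : 0 <= cg_mass p w.
Proof.
have /andP[p0 p1] := p01.
by rewrite /cg_mass !mulr_ge0 ?exprn_ge0 ?subr_ge0 ?invr_ge0 // ltW.
Qed.

Lemma edges_sub_pairs m (G : sgraph 'I_m) : edges G \subset pairs m.
Proof. by apply/fintype.subsetP => e /edge_card2 h; rewrite inE h. Qed.

Lemma card_pairs m : #|pairs m| = 'C(m, 2).
Proof. by rewrite /pairs card_draws card_ord. Qed.

(** Independence of the edges: expand a product, over all pairs of vertices,
    of the contributions of a present and of an absent edge. *)
Lemma graph_mass_cylinder (S D : {set {set 'I_n}}) :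
  S \subset pairs n -> D \subset pairs n -> [disjoint S & D]%B ->
  \sum_(G : sgraph 'I_n) (S \subset edges G)%:R * [disjoint D & edges G]%B%:R * graph_mass G
  = p ^+ #|S| * (1 - p) ^+ #|D|.
Proof.
move=> Sp Dp SD.
rewrite /graph_mass (sum_sgraph (fun E => (S \subset E)%:R * [disjoint D & E]%B%:R *
  (p ^+ #|E| * (1 - p) ^+ ('C(n, 2) - #|E|)))).
pose K := pairs n.
pose F (e : {set 'I_n}) : R := if e \in D then 0 else if e \in K then p else 0.
pose J (e : {set 'I_n}) : R := if e \in S then 0 else if e \in K then 1 - p else 1.
have nDS e : e \in S -> e \in D = false by move=> eS; rewrite (disjointFr SD).
have -> : p ^+ #|S| * (1 - p) ^+ #|D| = \prod_e (F e + J e).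
  rewrite (bigID (mem S)) /=; congr (_ * _).
    rewrite -prodr_const; apply: eq_bigr => e eS.
    by rewrite /F /J eS nDS // (fintype.subsetP Sp _ eS) addr0.
  rewrite (bigID (mem D)) /= [X in _ = _ * X]big1 ?mulr1.
    rewrite -prodr_const; apply: eq_big => e.
      by apply/idP/andP => [eD|[]//]; split => //; apply/negP => /nDS; rewrite eD.
    by move=> eD; rewrite /F /J eD add0r (fintype.subsetP Dp _ eD); case: ifP => // /nDS; rewrite eD.
  move=> e /andP[eS eD]; rewrite /F /J (negbTE eS) (negbTE eD); case: ifP => _; last by rewrite add0r.
  by rewrite addrC subrK.
rewrite bigA_distr.
rewrite [RHS](bigID (fun E : {set {set 'I_n}} => E \subset K)) /=.
rewrite [X in _ = _ + X]big1 ?addr0; last first.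
  move=> E' /fintype.subsetPn [e eE eK].
  by rewrite (bigD1 e) //= eE /F (negbTE eK) if_same mul0r.
apply: eq_bigr => E' EK.
case: (boolP (S \subset E')) => [SE|/fintype.subsetPn[e eS eE]]; last first.
  by rewrite !mul0r (bigD1 e) //= (negbTE eE) /J eS mul0r.
case: (boolP [disjoint D & E']%B) => [DE|]; last first.
  rewrite -setI_eq0 => /finset.set0Pn[e]; rewrite inE => /andP[eD eE].
  by rewrite mulr0 mul0r (bigD1 e) //= eE /F eD mul0r.
rewrite !mul1r (bigID (mem E')) /=.
congr (_ * _).
  rewrite -prodr_const; apply: eq_bigr => e eE.
  by rewrite eE /F (fintype.subsetP EK _ eE) (disjointFl DE eE).
rewrite (bigID (mem K)) /= [X in _ = _ * X]big1 ?mulr1; last first.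
  move=> e /andP[eE eK]; rewrite (negbTE eE) /J (negbTE eK).
  by case: ifP => // /(fintype.subsetP SE); rewrite (negbTE eE).
have -> : ('C(n,2) - #|E'|)%N = #|K :\: E'|.
  by rewrite cardsDS // /K card_pairs.
rewrite -prodr_const; apply: eq_big => [e|e]; rewrite !inE // => /andP[eE eK].
rewrite (negbTE eE) /J inE eK; case: ifP => // /(fintype.subsetP SE); by rewrite (negbTE eE).
Qed.

Lemma expect_prod (g : sgraph 'I_n -> R) (h : {ffun 'I_n -> 'I_c} -> R) :
  E (fun w => g w.1 * h w.2) =
  (\sum_(G : sgraph 'I_n) g G * graph_mass G) * ((\sum_X h X) * (c ^ n)%:R^-1).
Proof.
rewrite /E /cg_expect mulr_suml mulr_suml.
rewrite -(pair_bigA _ (fun G X => g G * h X * (graph_mass G * (c ^ n)%:R^-1))) /=.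
apply: eq_bigr => G _; rewrite mulr_sumr; apply: eq_bigr => X _.
by rewrite mulrACA.
Qed.

Lemma expect_cylinder (S D : {set {set 'I_n}}) (Q : {set {ffun 'I_n -> 'I_c}}) :
  S \subset pairs n -> D \subset pairs n -> [disjoint S & D]%B ->
  E (fun w => [&& S \subset edges w.1, [disjoint D & edges w.1]%B & w.2 \in Q]%:R) =
  p ^+ #|S| * (1 - p) ^+ #|D| * (#|Q|%:R / (c ^ n)%:R).
Proof.
move=> Sp Dp SD.
have q : #|Q|%:R = \sum_X (X \in Q)%:R :> R.
  by rewrite -sum1_card natr_sum big_mkcond; apply: eq_bigr => X _; case: (X \in Q).
rewrite -(graph_mass_cylinder Sp Dp SD) q -expect_prod.
apply: eq_bigr => w _; congr (_ * _).
by case: (S \subset _); case: ([disjoint _ & _]%B); case: (w.2 \in Q); rewrite ?mulr0 ?mul0r ?mulr1 ?mul1r.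
Qed.

Lemma expect_edges_colors (S : {set {set 'I_n}}) (Q : {set {ffun 'I_n -> 'I_c}}) :
  S \subset pairs n ->
  E (fun w => ((S \subset edges w.1) && (w.2 \in Q))%:R) =
  p ^+ #|S| * (#|Q|%:R / (c ^ n)%:R).
Proof.
move=> Sp; have := @expect_cylinder S finset.set0 Q Sp (finset.sub0set _).
rewrite disjoint_sym -setI_eq0 finset.set0I eqxx cards0 expr0 mulr1 => <- //.
apply: eq_bigr => w _; rewrite -setI_eq0 finset.set0I eqxx /=.
by [].
Qed.

Lemma c_exp_neq0 k : (c ^ k)%:R != 0 :> R.
Proof. by rewrite pnatr_eq0 -lt0n expn_gt0 c0. Qed.

Lemma sum_cg_mass : \sum_(w : colored_graph n c) cg_mass p w = 1.
Proof.
have := @expect_edges_colors finset.set0 finset.setT (finset.sub0set _).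
rewrite cards0 expr0 mul1r cardsT card_ffun !card_ord divff ?c_exp_neq0 // => <-.
by apply: eq_bigr => w _; rewrite finset.sub0set inE mul1r.
Qed.

Lemma eq_expect f g : f =1 g -> E f = E g.
Proof. by move=> fg; apply: eq_bigr => w _; rewrite fg. Qed.

Lemma expect_cst a : E (fun=> a) = a.
Proof. by rewrite /E /cg_expect -mulr_sumr sum_cg_mass mulr1. Qed.

Lemma expect0 : E (fun=> 0) = 0.
Proof. by rewrite /E /cg_expect big1 // => w _; rewrite mul0r. Qed.

Lemma expectD f g : E (fun w => f w + g w) = E f + E g.
Proof. by rewrite /E /cg_expect -big_split; apply: eq_bigr => w _; rewrite mulrDl. Qed.

Lemma expectZ a f : E (fun w => a * f w) = a * E f.
Proof. by rewrite /E /cg_expect mulr_sumr; apply: eq_bigr => w _; rewrite mulrA. Qed.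

Lemma expectB f g : E (fun w => f w - g w) = E f - E g.
Proof. by rewrite /E /cg_expect -sumrB; apply: eq_bigr => w _; rewrite mulrBl. Qed.

Lemma expect_sum (I : Type) (r : seq I) (Q : pred I) (F : I -> colored_graph n c -> R) :
  E (fun w => \sum_(i <- r | Q i) F i w) = \sum_(i <- r | Q i) E (F i).
Proof.
by rewrite /E /cg_expect exchange_big /=; apply: eq_bigr => w _; rewrite mulr_suml.
Qed.

Lemma le_expect f g : (forall w, f w <= g w) -> E f <= E g.
Proof. by move=> fg; apply: ler_sum => w _; rewrite ler_wpM2r ?cg_mass_ge0. Qed.

Lemma expect_ge0 f : (forall w, 0 <= f w) -> 0 <= E f.
Proof. by move=> f0; apply: sumr_ge0 => w _; rewrite mulr_ge0 ?cg_mass_ge0. Qed.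

Lemma probE A : Pr A = E (fun w => (A w)%:R).
Proof.
rewrite /Pr /cg_prob big_mkcond; apply: eq_bigr => w _.
by case: (A w); rewrite ?mul1r ?mul0r.
Qed.

Lemma prob_ge0 A : 0 <= Pr A.
Proof. by rewrite probE; apply: expect_ge0 => w; rewrite ler0n. Qed.

Lemma prob_le1 A : Pr A <= 1.
Proof.
rewrite probE -[leRHS](expect_cst 1); apply: le_expect => w.
by case: (A w).
Qed.

Lemma norm_expect f : `|E f| <= E (fun w => `|f w|).
Proof.
apply: le_trans (ler_norm_sum _ _ _) _; apply: ler_sum => w _.
by rewrite normrM [`|cg_mass _ _|]ger0_norm // cg_mass_ge0.
Qed.

End Expectation.

Section Independence.
Variables (R : realType) (n c : nat) (p : R).
Hypothesis c0 : (0 < c)%N.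
Variable (S : {set 'I_n}).
Implicit Types (w : colored_graph n c).

Fact mix_subproof (G G' : sgraph 'I_n) :
  [forall e in (edges G :&: powerset S :|: edges G' :\: powerset S)%SET, #|e| == 2%N].
Proof.
apply/forallP => e; apply/implyP; rewrite !inE => /orP[/andP[/edge_card2->]//|].
by move=> /andP[_ /edge_card2->].
Qed.

(** An edge with an end outside [S] is taken from [w']: a copy inside [S] then
    sees only [w], and a copy disjoint from [S] sees only [w']. *)
Definition mix w w' : colored_graph n c :=
  (SGraph (mix_subproof w.1 w'.1), [ffun i => if i \in S then w.2 i else w'.2 i]).

Lemma mem_mix w w' e : (e \in edges (mix w w').1) =
  if e \subset S then e \in edges w.1 else e \in edges w'.1.
Proof. by rewrite !inE; case: (e \subset S); rewrite ?andbT ?andbF ?orbF. Qed.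

Lemma mix_color w w' i : (mix w w').2 i = if i \in S then w.2 i else w'.2 i.
Proof. by rewrite ffunE. Qed.

Lemma mixK w w' : mix (mix w w') (mix w' w) = w.
Proof.
case: w => G X; case: w' => G' X'; congr pair.
  apply: edgesI; apply/finset.setP => e.
  by rewrite mem_mix; case: ifP => h; rewrite mem_mix h.
by apply/ffunP => i; rewrite mix_color; case: ifP => h; rewrite mix_color h.
Qed.

Lemma card_mix w w' : (#|edges (mix w w').1| + #|edges (mix w' w).1| =
  #|edges w.1| + #|edges w'.1|)%N.
Proof.
have h u u' : #|edges (mix u u').1| =
    (#|edges u.1 :&: powerset S| + #|edges u'.1 :\: powerset S|)%N.
  rewrite /= cardsU [X in (_ - X)%N](_ : _ = 0%N) ?subn0 //.
  apply/eqP; rewrite cards_eq0; apply/eqP/finset.setP => e; rewrite !inE.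
  by case: (e \subset S); rewrite ?andbF.
rewrite !h addnACA [(_ + #|edges w.1 :\: _|)%N]addnC addnACA.
by rewrite !cardsID.
Qed.

Lemma mix_mass w w' : cg_mass p (mix w w') * cg_mass p (mix w' w) =
  cg_mass p w * cg_mass p w'.
Proof.
rewrite /cg_mass.
have q (a b a' b' x : R) : a * b * x * (a' * b' * x) = (a * a') * (b * b') * (x * x) by ring.
rewrite !q -!exprD card_mix.
have le (G : sgraph 'I_n) : (#|edges G| <= 'C(n, 2))%N.
  by rewrite -card_pairs; apply: subset_leq_card; exact: edges_sub_pairs.
congr (_ * (1 - p) ^+ _ * _).
have := card_mix w w'; have := (le (mix w w').1, le (mix w' w).1, le w.1, le w'.1).
move: (#|_|) (#|_|) (#|_|) (#|_|) => a b a' b' [[[]]]; lia.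
Qed.

(** Resampling one half of two independent copies preserves their joint law,
    hence functions of disjoint halves are independent. *)
Lemma expect_indep (a b : colored_graph n c -> R) :
  (forall w w', a (mix w w') = a w) -> (forall w w', b (mix w w') = b w') ->
  cg_expect p (fun w => a w * b w) = cg_expect p a * cg_expect p b.
Proof.
move=> ha hb.
rewrite -[LHS]mulr1 -[X in _ * X = _](@sum_cg_mass R n c p c0) /cg_expect !big_distrlr /=.
rewrite !pair_bigA /=.
rewrite (reindex (fun u : colored_graph n c * colored_graph n c => (mix u.1 u.2, mix u.2 u.1))) /=.
  apply: eq_bigr => -[w w'] _ /=; rewrite ha hb -mulrA mix_mass.
  by rewrite mulrACA mulrA.
by exists (fun u : colored_graph n c * colored_graph n c => (mix u.1 u.2, mix u.2 u.1)) =>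
  -[w w'] _ /=; rewrite !mixK.
Qed.

End Independence.

(** * An approximate Panjer recursion *)

Section EmbeddingProbabilities.
Variables (R : realType) (V : finType) (H : sgraph V) (n c : nat) (p : R).
Hypotheses (V0 : (0 < #|V|)%N) (p01 : 0 < p < 1) (c0 : (0 < c)%N).
Implicit Types (s : {ffun V -> 'I_n}) (w : colored_graph n c).

Let E := @cg_expect R n c p.
Let Pr := @cg_prob R n c p.
Let Z s w : bool := mono_embedding H w.1 w.2 s.
Let T w : nat := mono_count H w.1 w.2.
Let a := #|sg_aut H|.

Definition mono_colorings (U C : finType) (s : {ffun V -> U}) : {set {ffun U -> C}} :=
  [set X : {ffun U -> C} | [forall a, forall b, X (s a) == X (s b)]]%SET.

Lemma mono_colorings_ratio s : injective s ->
  #|mono_colorings 'I_c s|%:R / (c ^ n)%:R = c%:R ^- #|V|.-1 :> R.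
Proof.
move=> si; rewrite card_mono_coloring // -expnS.
have vn : (#|V| <= n)%N by rewrite -[n in (_ <= n)%N](card_ord n); exact: leq_card si.
have -> : (c ^ n = c ^ (n - #|V|).+1 * c ^ #|V|.-1)%N.
  by rewrite -expnD addSnnS prednK // subnK.
by rewrite natrM invfM mulrA divff ?c_exp_neq0 // mul1r natrX.
Qed.

Lemma image_edges_pairs s (S : {set {set V}}) : injective s ->
  (forall e, e \in S -> #|e| = 2%N) -> [set s @: e | e : {set V} in S]%SET \subset pairs n.
Proof.
move=> si S2; apply/fintype.subsetP => _ /finset.imsetP[e eS ->].
by rewrite inE card_imset // S2.
Qed.

Lemma prob_embedding_pullback s (K : sgraph V) : edges H \subset edges K ->
  E (fun w => (Z s w && (pullback s w.1 == K))%:R) =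
  (injectiveb s)%:R * (p ^+ #|edges K| * (1 - p) ^+ ('C(#|V|, 2) - #|edges K|) * c%:R ^- #|V|.-1).
Proof.
move=> HK; case: (boolP (injectiveb s)) => [/injectiveP si|si]; last first.
  rewrite mul0r -[RHS](expect0 n c p).
  by apply: eq_expect => w; rewrite /Z /mono_embedding (negbTE si).
rewrite mul1r.
pose vp := [set e : {set V} | #|e| == 2%N]%SET.
have Kvp : edges K \subset vp by apply/fintype.subsetP => e /edge_card2 h; rewrite inE h.
pose im (S : {set {set V}}) := [set s @: e | e : {set V} in S]%SET.
have imi : injective (fun e : {set V} => s @: e) by apply: imset_inj.
have cD : #|im (vp :\: edges K)%SET| = ('C(#|V|, 2) - #|edges K|)%N.
  by rewrite card_imset // cardsDS // card_draws.
rewrite -(mono_colorings_ratio si) -cD -[#|edges K|](card_imset _ imi) -expect_cylinder //.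
- apply: eq_expect => w; congr (nat_of_bool _)%:R.
  rewrite /Z /mono_embedding; have -> : injectiveb s by apply/injectiveP.
  rewrite /= inE andbA; case: [forall a, forall b, _]; rewrite ?andbF // !andbT.
  apply/andP/andP => [[/forallP h /eqP PK]|[/fintype.subsetP h1 h2]].
    split.
      apply/fintype.subsetP => _ /finset.imsetP[e eK ->].
      by move: eK; rewrite -PK mem_pullback => /andP[].
    rewrite disjoint_subset; apply/fintype.subsetP => _ /finset.imsetP[e eK ->]; rewrite inE.
    move: eK; rewrite !inE -PK mem_pullback => /andP[+ e2]; rewrite e2.
    by [].
  split.
    apply/forallP => e; apply/implyP => eH; apply: h1; apply: imset_f.
    exact: (fintype.subsetP HK).
  apply/eqP/edgesI/finset.setP => e; rewrite mem_pullback.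
  apply/andP/idP => [[e2 eG]|eK].
    apply: contraTT eG => eK; rewrite (disjointFr h2) //; apply: imset_f.
    by rewrite !inE eK.
  by rewrite (edge_card2 eK); split => //; apply: h1; apply: imset_f.
- by apply: image_edges_pairs => // e /edge_card2.
- by apply: image_edges_pairs => // e; rewrite !inE => /andP[_ /eqP].
- rewrite disjoint_subset; apply/fintype.subsetP => _ /finset.imsetP[e eK ->]; rewrite inE.
  by apply/negP => /finset.imsetP[e']; rewrite inE => /andP[eK' _] /imi ee'; rewrite -ee' eK in eK'.
Qed.

Lemma prob_embedding s : injective s ->
  E (fun w => (Z s w)%:R) = p ^+ #|edges H| * c%:R ^- #|V|.-1.
Proof.
move=> si.
have imi : injective (fun e : {set V} => s @: e) by apply: imset_inj.
rewrite -(mono_colorings_ratio si) -(card_imset _ imi) -expect_edges_colors //.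
  apply: eq_expect => w; congr (nat_of_bool _)%:R.
  rewrite /Z /mono_embedding; have -> : injectiveb s by apply/injectiveP.
  rewrite /= inE; congr andb; apply/forallP/fintype.subsetP => [h _ /finset.imsetP[e eH ->]|h e].
    by have := h e; rewrite eH.
  by apply/implyP => eH; apply: h; apply: imset_f.
by apply: image_edges_pairs => // e /edge_card2.
Qed.

Lemma sum_embeddings w : \sum_s (Z s w)%:R = a%:R * (T w)%:R :> R.
Proof.
rewrite -natrM mulnC -mono_countE -sum1_card natr_sum [RHS]big_mkcond /=.
by apply: eq_bigr => s _; rewrite inE /Z; case: ifP.
Qed.

Lemma aut_neq0 : a%:R != 0 :> R.
Proof. by rewrite pnatr_eq0 -lt0n sg_aut_gt0. Qed.

Lemma TmonoE w : Tmono R H w = (T w)%:R.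
Proof. exact: mono_copiesE. Qed.

Lemma sum_prob_embeddings :
  \sum_(s : {ffun V -> 'I_n}) E (fun w => (Z s w)%:R) = a%:R * E (@Tmono R V H n c).
Proof.
rewrite -expect_sum -expectZ; apply: eq_expect => w.
by rewrite sum_embeddings TmonoE.
Qed.

Definition supergraph_mass (K : sgraph V) : R :=
  p ^+ (#|edges K| - #|edges H|) * (1 - p) ^+ ('C(#|V|, 2) - #|edges K|).

(** The expected number of copies of [H], weighted by the probability that the
    vertex set of a given one carries exactly [j] of them. *)
Definition multiplicity_rate (j : nat) : R :=
  E (@Tmono R V H n c) *
  \sum_(K : sgraph V | (edges H \subset edges K) && (ncopies H K == j)) supergraph_mass K.

(** Sum over the graph that an embedding induces on its image. *)
Lemma sum_multiplicity j :
  a%:R^-1 * (\sum_s E (fun w => (Z s w && (ncopies H (pullback s w.1) == j))%:R)) =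
  multiplicity_rate j.
Proof.
rewrite /multiplicity_rate -[E _](mulKf aut_neq0) -sum_prob_embeddings -mulrA; congr (_ * _).
rewrite mulr_suml; apply: eq_bigr => s _.
have [/injectiveP si|si] := boolP (injectiveb s); last first.
  rewrite -[E (fun w => (Z s w)%:R)](_ : 0 = _); last first.
    rewrite -[LHS](expect0 n c p).
    by apply: eq_expect => w; rewrite /Z /mono_embedding (negbTE si).
  rewrite mul0r -[RHS](expect0 n c p).
  by apply: eq_expect => w; rewrite /Z /mono_embedding (negbTE si).
rewrite prob_embedding // mulr_sumr.
transitivity (E (fun w => \sum_(K : sgraph V | (edges H \subset edges K) && (ncopies H K == j))
    (Z s w && (pullback s w.1 == K))%:R)).
  apply: eq_expect => w; case: (boolP (Z s w)) => [Zs|]; last by rewrite big1.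
  have Hs : edges H \subset edges (pullback s w.1).
    apply/fintype.subsetP => e eH; rewrite mem_pullback (edge_card2 eH) eqxx /=.
    by have /and3P[_ /forallP/(_ e)] := Zs; rewrite eH.
  rewrite /=; case: (boolP (ncopies H _ == j)) => hj.
    rewrite (bigD1 (pullback s w.1)) /= ?Hs ?hj // eqxx big1 ?addr0 // => K /andP[_].
    by rewrite eq_sym => /negbTE->.
  rewrite big1 // => K /andP[_ Kj]; case: eqP => // KE; by rewrite KE Kj in hj.
etransitivity; first exact: expect_sum.
apply: eq_bigr => K /andP[HK _].
etransitivity; first exact: (prob_embedding_pullback s HK).
have -> : injectiveb s by apply/injectiveP.
rewrite mul1r /supergraph_mass.
rewrite -[in p ^+ #|edges K|](subnKC (subset_leq_card HK)) exprD.
by set y := (c%:R ^+ _)^-1; set u := p ^+ _; set t := p ^+ _; set x := (1 - p) ^+ _; ring.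
Qed.

Definition overlap_error : R :=
  \sum_s \sum_(s' | overlapping s s') E (fun w => (Z s w && Z s' w)%:R).

Definition meeting_error : R :=
  \sum_s \sum_(s' | meeting s s') E (fun w => (Z s w)%:R) * E (fun w => (Z s' w)%:R).

Let D s w : nat := disjoint_count H w.1 w.2 s.
Let M s w : nat := ncopies H (pullback s w.1).

Lemma mix_embedding_in s s1 w w' : vimage s1 \subset vimage s ->
  Z s1 (mix (vimage s) w w') = Z s1 w.
Proof.
move=> /fintype.subsetP s1s; rewrite /Z /mono_embedding; congr [&& _, _ & _].
  apply: eq_forallb => e; rewrite mem_mix.
  case: ifP => // /negP[]; apply/fintype.subsetP => _ /finset.imsetP[x _ ->].
  exact/s1s/mem_vimage.
by apply: eq_forallb => x; apply: eq_forallb => y; rewrite !mix_color !s1s ?mem_vimage.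
Qed.

Lemma mix_embedding_out s s1 w w' : [disjoint vimage s1 & vimage s]%B ->
  Z s1 (mix (vimage s) w w') = Z s1 w'.
Proof.
move=> ds; have ns x : s1 x \in vimage s = false by rewrite (disjointFr ds) ?mem_vimage.
rewrite /Z /mono_embedding; congr [&& _, _ & _].
  apply: eq_forallb => e; case: (boolP (e \in edges H)) => //= /edge_card2 e2; rewrite mem_mix.
  have /card_gt0P[x xe] : (0 < #|e|)%N by rewrite e2.
  case: ifP => // /fintype.subsetP/(_ (s1 x)); rewrite ns imset_f //.
  by move/(_ isT).
by apply: eq_forallb => x; apply: eq_forallb => y; rewrite !mix_color !ns.
Qed.

Lemma mix_pullback s w w' : pullback s (mix (vimage s) w w').1 = pullback s w.1.
Proof.
apply/edgesI/finset.setP => e; rewrite !mem_pullback mem_mix.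
case: ifP => // /negP[]; apply/fintype.subsetP => _ /finset.imsetP[x _ ->].
exact: mem_vimage.
Qed.

Lemma mix_disjoint_count s w w' : D s (mix (vimage s) w w') = D s w'.
Proof.
rewrite /D /disjoint_count; congr (_ %/ _)%N; apply: eq_card => s1; rewrite !inE.
case: (boolP [disjoint vimage s1 & vimage s]%B) => [ds|_]; last by rewrite !andbF.
by rewrite !andbT -/(Z s1 w') -(mix_embedding_out w w' ds).
Qed.

Lemma disjoint_count_eq s w : (forall s', meeting s s' -> ~~ Z s' w) -> T w = D s w.
Proof.
move=> h; rewrite /T /D /mono_count /disjoint_count; congr (_ %/ _)%N.
apply: eq_card => s'; rewrite !inE.
have [hs|//] := boolP (mono_embedding _ _ _ _).
by have := contraTN (h s') hs; rewrite /meeting negbK => ->.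
Qed.

(** The two counts can differ only if some copy meets [s]. *)
Lemma prob_disjoint_count s l :
  `|E (fun w => (D s w == l)%:R) - Pr (fun w => T w == l)| <=
  \sum_(s' | meeting s s') E (fun w => (Z s' w)%:R).
Proof.
rewrite /Pr probE -expectB -expect_sum.
apply: le_trans (norm_expect p01 _) _; apply: le_expect => // w.
have [/existsP[s' /andP[ms' Zs']]|/existsPn h] := boolP [exists s', meeting s s' && Z s' w].
  rewrite (bigD1 s') //= Zs'.
  apply: (@le_trans _ _ 1); last by rewrite lerDl sumr_ge0.
  by case: (_ == _); case: (_ == _); rewrite ?subrr ?subr0 ?sub0r ?normrN ?normr0 ?normr1.
rewrite (@disjoint_count_eq s) ?subrr ?normr0 ?sumr_ge0 // => s' ms.
by have := h s'; rewrite ms.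
Qed.

(** Replace the count by the sum of its parts inside and outside the image of
    [s], which is exact unless some copy partially overlaps [s]; these two
    parts are independent; finally restore the full count in the outside part,
    at the cost of the copies meeting [s]. *)
Lemma embedding_step s k :
  `|E (fun w => (Z s w && (T w == k))%:R) -
    \sum_(j < k.+1) E (fun w => (Z s w && (M s w == j))%:R) * Pr (fun w => T w == (k - j)%N)| <=
  \sum_(s' | overlapping s s') E (fun w => (Z s w && Z s' w)%:R) +
  \sum_(s' | meeting s s') E (fun w => (Z s w)%:R) * E (fun w => (Z s' w)%:R).
Proof.
pose F := E (fun w => (Z s w && ((M s w + D s w)%N == k))%:R).
have FE : F = \sum_(j < k.+1) E (fun w => (Z s w && (M s w == j))%:R) * E (fun w => (D s w == k - j)%N%:R).
  rewrite /F -[RHS](eq_bigr _ (fun (j : 'I_k.+1) _ => @expect_indep R n c p c0 (vimage s)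
     (fun w => (Z s w && (M s w == j))%:R) (fun w => (D s w == k - j)%N%:R) _ _)); last first.
  - by move=> j _ w w'; rewrite mix_disjoint_count.
  - by move=> j _ w w'; rewrite mix_embedding_in // /M mix_pullback.
  rewrite -expect_sum; apply: eq_expect => w.
  case: (Z s w); last by rewrite big1 // => i _; rewrite mul0r.
  rewrite /=; case: (leqP (M s w) k) => Mk.
    rewrite (bigD1 (Ordinal (Mk : (M s w < k.+1)%N))) //= eqxx mul1r big1 ?addr0 => [|i ni].
      by congr (nat_of_bool _)%:R; apply/eqP/eqP => ?; lia.
    by rewrite (_ : M s w == i = false) ?mul0r //; apply: contraNF ni => /eqP h; apply/eqP/val_inj.
  rewrite big1 => [|i _]; last first.
    rewrite (_ : M s w == i = false) ?mul0r //; apply/eqP => h; have := ltn_ord i; rewrite -h; lia.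
  by rewrite (_ : (_ == k) = false) //; apply/eqP; lia.
rewrite -[X in `|X|](subrKA F); apply: le_trans (ler_normD _ _) _; apply: lerD.
  rewrite -expectB -expect_sum; apply: le_trans (norm_expect p01 _) _; apply: le_expect => // w.
  case: (boolP (Z s w)) => Zs /=; last by rewrite subrr normr0 sumr_ge0.
  have [/existsP[s' /andP[ms' Zs']]|/existsPn h] := boolP [exists s', overlapping s s' && Z s' w].
    rewrite (bigD1 s') //= Zs'.
    apply: (@le_trans _ _ 1); last by rewrite lerDl sumr_ge0.
    by case: (_ == _); case: (_ == _); rewrite ?subrr ?subr0 ?sub0r ?normrN ?normr0 ?normr1.
  rewrite /T (mono_count_split V0 Zs) ?subrr ?normr0 ?sumr_ge0 // => s' ms.
  by have := h s'; rewrite ms.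
rewrite FE -sumrB; apply: le_trans (ler_norm_sum _ _ _) _.
rewrite -mulr_sumr.
apply: (@le_trans _ _ (\sum_(j < k.+1) E (fun w => (Z s w && (M s w == j))%:R) *
   \sum_(s' | meeting s s') E (fun w => (Z s' w)%:R))).
  apply: ler_sum => j _; rewrite -mulrBr normrM ger0_norm; last by apply: expect_ge0.
  by apply: ler_wpM2l; [apply: expect_ge0|exact: prob_disjoint_count].
rewrite -mulr_suml; apply: ler_wpM2r.
  by apply: sumr_ge0 => s' _; apply: expect_ge0.
rewrite -expect_sum; apply: le_expect => // w; case: (Z s w) => /=; last by rewrite big1.
have [Mk|Mk] := ltnP (M s w) k.+1; last first.
  rewrite big1 // => i _; rewrite (_ : M s w == i = false) //; apply/eqP => h.
  by have := ltn_ord i; rewrite -h; lia.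
rewrite (bigD1 (Ordinal Mk)) //= eqxx big1 ?addr0 // => i ni.
by rewrite (_ : M s w == i = false) //; apply: contraNF ni => /eqP h; apply/eqP/val_inj.
Qed.

(** An approximate Panjer recursion: conditioning on one of the copies counted
    by [T] turns the law of [T] into itself, shifted by the number of copies on
    the same vertex set, up to copies that partially overlap or meet by chance. *)
Lemma panjer_approx k :
  `|k%:R * Pr (fun w => T w == k) -
    \sum_(j < k.+1) multiplicity_rate j * Pr (fun w => T w == (k - j)%N)| <=
  a%:R^-1 * (overlap_error + meeting_error).
Proof.
have -> : k%:R * Pr (fun w => T w == k) =
    a%:R^-1 * \sum_s E (fun w => (Z s w && (T w == k))%:R).
  apply: (mulfI aut_neq0); rewrite mulVKf ?aut_neq0 // /Pr probE -expectZ -expectZ -expect_sum.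
  apply: eq_expect => w; case: (boolP (T w == k)) => [/eqP<-|_]; last first.
    by rewrite !mulr0 big1 // => s _; rewrite andbF.
  by rewrite mulr1 -sum_embeddings; apply: eq_bigr => s _; rewrite andbT.
have -> : \sum_(j < k.+1) multiplicity_rate j * Pr (fun w => T w == (k - j)%N) =
  a%:R^-1 * \sum_s \sum_(j < k.+1) E (fun w => (Z s w && (M s w == j))%:R) *
     Pr (fun w => T w == (k - j)%N).
  rewrite exchange_big mulr_sumr /=; apply: eq_bigr => j _.
  by rewrite -sum_multiplicity -mulrA mulr_suml.
rewrite -mulrBr -sumrB normrM ger0_norm ?invr_ge0 //.
apply: ler_wpM2l; first by rewrite invr_ge0.
apply: le_trans (ler_norm_sum _ _ _) _; rewrite /overlap_error /meeting_error -big_split /=.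
by apply: ler_sum => s _; exact: embedding_step.
Qed.

End EmbeddingProbabilities.

(** * Maps counted by their kernel *)

Section KernelPatterns.
Variable I : finType.

(** The kernel of a map, encoded by the choice of a representative in each of
    its classes: two maps get the same pattern exactly when they identify the
    same points. *)
Definition kernel_pattern (U : finType) (f : {ffun I -> U}) : {ffun I -> I} :=
  [ffun x => odflt x [pick y | f y == f x]].

Lemma kernel_patternK (U : finType) (f : {ffun I -> U}) x : f (kernel_pattern f x) = f x.
Proof. by rewrite ffunE; case: pickP => [y /eqP//|/(_ x)]; rewrite eqxx. Qed.

Lemma kernel_patternP (U : finType) (f : {ffun I -> U}) x y :
  (kernel_pattern f x == kernel_pattern f y) = (f x == f y).
Proof.
apply/eqP/eqP => [h|h]; first by rewrite -(kernel_patternK f x) h kernel_patternK.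
rewrite !ffunE; have -> : [pick z | f z == f x] = [pick z | f z == f y] by rewrite h.
by case: pickP => // /(_ y); rewrite eqxx.
Qed.

Lemma eq_kernel_pattern (U U' : finType) (f : {ffun I -> U}) (g : {ffun I -> U'}) :
  (forall x y, (f x == f y) = (g x == g y)) -> kernel_pattern f = kernel_pattern g.
Proof. by move=> h; apply/ffunP => x; rewrite !ffunE; congr odflt; apply: eq_pick => y /=. Qed.

Definition is_pattern (k : {ffun I -> I}) := kernel_pattern k == k.

Lemma kernel_pattern_is_pattern (U : finType) (f : {ffun I -> U}) : is_pattern (kernel_pattern f).
Proof. by apply/eqP/eq_kernel_pattern => x y; rewrite kernel_patternP. Qed.

Lemma kernel_pattern_idem (U : finType) (f : {ffun I -> U}) x :
  kernel_pattern f (kernel_pattern f x) = kernel_pattern f x.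
Proof. by apply/eqP; rewrite kernel_patternP kernel_patternK. Qed.

Definition image_size (U : finType) (f : {ffun I -> U}) : nat := #|[set f x | x : I]%SET|.

Lemma image_size_pattern (U : finType) (f : {ffun I -> U}) :
  image_size (kernel_pattern f) = image_size f.
Proof.
rewrite /image_size -[LHS](@card_in_imset _ _ f).
  apply: eq_card => u; apply/finset.imsetP/finset.imsetP => [[y /finset.imsetP[x _ ->] ->]|[x _ ->]].
    by exists x; rewrite // kernel_patternK.
  by exists (kernel_pattern f x); rewrite ?kernel_patternK // imset_f.
move=> y z /finset.imsetP[x _ ->] /finset.imsetP[x' _ ->].
by rewrite !kernel_patternK => h; apply/eqP; rewrite kernel_patternP h.
Qed.

(** Maps with a given kernel are the injections of its set of classes. *)
Lemma card_kernel_pattern n (k : {ffun I -> I}) : is_pattern k ->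
  #|[set f : {ffun I -> 'I_n} | kernel_pattern f == k]%SET| = n ^_ (image_size k).
Proof.
move=> /eqP kk.
pose D := {y : I | y \in [set k x | x : I]%SET}.
have kD x : k x \in [set k x | x : I]%SET by apply: imset_f.
have kidem x : k (k x) = k x by have := kernel_pattern_idem k x; rewrite kk.
pose F (g : {ffun D -> 'I_n}) : {ffun I -> 'I_n} := [ffun x => g (Sub (k x) (kD x))].
have Fi : injective F.
  move=> g h /ffunP gh; apply/ffunP => -[d dD].
  have /finset.imsetP[x _ dx] := dD.
  have := gh x; rewrite !ffunE.
  by rewrite (_ : Sub (k x) (kD x) = exist _ d dD :> D) //; apply: val_inj; rewrite /= dx.
rewrite -[n](card_ord n) /image_size -[#|imset _ _|]card_sig -card_inj_ffuns card_ord.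
rewrite -[RHS](card_imset _ Fi); apply: eq_card => f; rewrite inE.
apply/eqP/finset.imsetP => [fk|[g]].
  have fP x y : (k x == k y) = (f x == f y) by rewrite -fk kernel_patternP.
  have fk' x : f (k x) = f x by rewrite -fk kernel_patternK.
  exists [ffun d : D => f (val d)].
    rewrite inE; apply/injectiveP => -[d dD] [d' dD']; rewrite !ffunE /= => /eqP.
    rewrite -fP => /eqP dd'; apply: val_inj => /=.
    have /finset.imsetP[x _ dx] := dD; have /finset.imsetP[x' _ dx'] := dD'.
    by move: dd'; rewrite dx dx' !kidem.
  by apply/ffunP => x; rewrite !ffunE /= fk'.
rewrite inE => /injectiveP gi ->; rewrite -[RHS]kk; apply: eq_kernel_pattern => x y.
rewrite !ffunE; apply/eqP/eqP => [/gi/(congr1 val)//|h].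
by congr (g _); apply: val_inj.
Qed.

Lemma sum_by_pattern (R : realType) n (h : {ffun I -> 'I_n} -> R) (h' : {ffun I -> I} -> R) :
  (forall f, h f = h' (kernel_pattern f)) ->
  \sum_f h f = \sum_(k | is_pattern k) (n ^_ (image_size k))%:R * h' k.
Proof.
move=> hh; rewrite (partition_big (@kernel_pattern _) is_pattern) /=; last first.
  by move=> f _; exact: kernel_pattern_is_pattern.
apply: eq_bigr => k kp; rewrite -card_kernel_pattern // -sum1_card natr_sum mulr_suml.
rewrite big_mkcond [RHS]big_mkcond; apply: eq_bigr => f _; rewrite inE.
by case: eqP => // <-; rewrite hh mul1r.
Qed.

Lemma ffact_le n m : (n ^_ m <= n ^ m)%N.
Proof.
elim: m n => [|m IH] n; first by rewrite ffactn0.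
by rewrite ffactnSr expnSr leq_mul ?IH ?leq_subr.
Qed.

Lemma card_image_size n m :
  (#|[set f : {ffun I -> 'I_n} | image_size f == m]%SET| <= #|{ffun I -> I}| * n ^ m)%N.
Proof.
rewrite -sum1_card (partition_big (@kernel_pattern _) xpredT) //=.
rewrite -sum_nat_const big_mkcond [leqRHS]big_mkcond; apply: leq_sum => k _ /=.
have [/andP[kp /eqP km]|nk] := boolP (is_pattern k && (image_size k == m)).
  rewrite -{2}km; apply: leq_trans (ffact_le _ _); rewrite -card_kernel_pattern // -sum1_card.
  rewrite big_mkcond [leqRHS]big_mkcond; apply: leq_sum => f _ /=; rewrite !inE.
  by case: (kernel_pattern f == k); rewrite ?andbF // andbT; case: ifP.
rewrite big_pred0 // => f; rewrite inE; apply: contraNF nk => /andP[/eqP fm /eqP fk].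
by rewrite -fk kernel_pattern_is_pattern image_size_pattern fm eqxx.
Qed.

End KernelPatterns.

Section ColoringCount.

(** Such a coloring is determined by its values on the representatives. *)
Lemma card_idempotent_colorings (U C : finType) (rep : U -> U) :
  (forall u, rep (rep u) = rep u) ->
  #|[set X : {ffun U -> C} | [forall u, X (rep u) == X u]]%SET| =
  (#|C| ^ #|[set u | rep u == u]%SET|)%N.
Proof.
move=> rr; pose D := {u : U | u \in [set u | rep u == u]%SET}.
have rD u : rep u \in [set u | rep u == u]%SET by rewrite inE rr.
pose F (g : {ffun D -> C}) : {ffun U -> C} := [ffun u => g (Sub (rep u) (rD u))].
have Fi : injective F.
  move=> g h /ffunP gh; apply/ffunP => -[d dD].
  have := gh d; rewrite !ffunE.
  rewrite (_ : Sub (rep d) (rD d) = exist _ d dD :> D) //; apply: val_inj => /=.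
  by move: dD; rewrite inE => /eqP.
rewrite -[#|[set u | _]%SET|]card_sig -card_ffun -[RHS]cardsT -[RHS](card_imset _ Fi).
apply: eq_card => X; rewrite inE; apply/forallP/finset.imsetP => [h|[g _ ->] u].
  exists [ffun d : D => X (val d)] => //.
  by apply/ffunP => u; rewrite !ffunE /= (eqP (h u)).
by rewrite !ffunE; apply/eqP; congr (g _); apply: val_inj; rewrite /= rr.
Qed.

Variables (I U : finType) (r : rel I) (f : {ffun I -> U}).
Hypothesis r_sym : symmetric r.

Definition joined_rel (W : finType) (g : {ffun I -> W}) : rel I :=
  fun x y => r x y || (g x == g y).

Definition joined_classes (W : finType) (g : {ffun I -> W}) : nat :=
  #|[set x | roots (joined_rel g) x]%SET|.

Lemma joined_classes_pattern : joined_classes (kernel_pattern f) = joined_classes f.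
Proof.
apply: eq_card => x; rewrite !inE; apply: eq_roots => y z.
by rewrite /joined_rel kernel_patternP.
Qed.

Lemma joined_connect_sym : connect_sym (joined_rel f).
Proof. by apply: sym_connect_sym => x y; rewrite /joined_rel r_sym eq_sym. Qed.

(** Forced equalities of colors identify the vertices of a class of the relation
    generated by [r] and the kernel of [f]; the classes, and the vertices not
    hit by [f], are colored freely. *)
Lemma card_joined_colorings (C : finType) :
  #|[set X : {ffun U -> C} | [forall x, forall y, r x y ==> (X (f x) == X (f y))]]%SET| =
  (#|C| ^ (#|U| - image_size f + joined_classes f))%N.
Proof.
pose e := joined_rel f; have es := joined_connect_sym.
pose rep u := if [pick x | f x == u] is Some x then f (fingraph.root e x) else u.
have repf x : rep (f x) = f (fingraph.root e x).
  rewrite /rep; case: pickP => [y /eqP fy|/(_ x)]; last by rewrite eqxx.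
  by congr (f _); apply/(fingraph.rootP es)/connect1; rewrite /joined_rel fy eqxx orbT.
have repn u : u \notin [set f x | x : I]%SET -> rep u = u.
  by rewrite /rep; case: pickP => // y /eqP <-; rewrite imset_f.
have rr u : rep (rep u) = rep u.
  have [/finset.imsetP[x _ ->]|un] := boolP (u \in [set f x | x : I]%SET).
    by rewrite !repf root_root.
  by rewrite !(repn u un).
transitivity #|[set X : {ffun U -> C} | [forall u, X (rep u) == X u]]%SET|.
  apply: eq_card => X; rewrite !inE; apply/forallP/forallP => h u.
    have [/finset.imsetP[x _ ->]|un] := boolP (u \in [set f x | x : I]%SET); last by rewrite repn.
    rewrite repf; have := connect_root e x; move: (fingraph.root e x) => y /connectP[q].
    elim: q x => [x _ ->//|z q IH x /= /andP[exz zq] yz].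
    rewrite (eqP (IH z zq yz)); case/orP: exz => [rxz|/eqP->//].
    by have /forallP/(_ z) := h x; rewrite rxz /= eq_sym.
  apply/forallP => y; apply/implyP => ruy.
  rewrite -(eqP (h (f u))) -(eqP (h (f y))) !repf.
  by rewrite (_ : fingraph.root e u = fingraph.root e y) //; apply/(fingraph.rootP es)/connect1; rewrite /joined_rel ruy.
rewrite card_idempotent_colorings //; congr (_ ^ _)%N.
have fri : {in [set x | roots e x]%SET &, injective f}.
  move=> x y; rewrite !inE => /eqP rx /eqP ry fxy; rewrite -rx -ry; apply/(fingraph.rootP es)/connect1.
  by rewrite /joined_rel fxy eqxx orbT.
rewrite /joined_classes -/e -(card_in_imset fri).
have -> : [set u | rep u == u]%SET = (~: [set f x | x : I] :|: f @: [set x | roots e x])%SET.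
  apply/finset.setP => u; rewrite !inE.
  have [/finset.imsetP[x _ ->]|un] := boolP (u \in [set f x | x : I]%SET); last by rewrite repn ?eqxx.
  rewrite repf /=; apply/eqP/finset.imsetP => [h|[y]].
    by exists (fingraph.root e x) => //; rewrite inE (roots_root es).
  rewrite inE => /eqP ry fxy.
  by rewrite fxy -[X in _ = f X]ry; congr (f _); apply/(fingraph.rootP es)/connect1; rewrite /joined_rel fxy eqxx orbT.
rewrite cardsU [X in (_ - X)%N](_ : _ = 0%N) ?subn0; last first.
  apply/eqP; rewrite cards_eq0; apply/eqP/finset.setP => u; rewrite !inE.
  by apply/negP => /andP[/negP un /finset.imsetP[x _ ux]]; apply: un; rewrite ux imset_f.
by congr (_ + _)%N; rewrite cardsCs finset.setCK.
Qed.

Lemma joined_classes_le : (joined_classes f <= image_size f)%N.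
Proof.
have es := joined_connect_sym.
have fri : {in [set x | roots (joined_rel f) x]%SET &, injective f}.
  move=> x y; rewrite !inE => /eqP rx /eqP ry fxy; rewrite -rx -ry; apply/(fingraph.rootP es)/connect1.
  by rewrite /joined_rel fxy eqxx orbT.
rewrite /joined_classes -(card_in_imset fri); apply: subset_leq_card.
by apply/fintype.subsetP => _ /finset.imsetP[x _ ->]; apply: imset_f.
Qed.

Lemma joined_classes_gt0 (x : I) : (0 < joined_classes f)%N.
Proof.
by apply/card_gt0P; exists (fingraph.root (joined_rel f) x); rewrite inE roots_root //; exact: joined_connect_sym.
Qed.

End ColoringCount.

(** * Unions of copies and the exponent gamma *)

Section CopyList.
Variables (V U : finType) (H : sgraph V).
Hypothesis V0 : (0 < #|V|)%N.
Implicit Types (s : {ffun V -> U}) (ss : seq {ffun V -> U}).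

Fixpoint vset ss : {set U} :=
  if ss is s :: ss' then (vimage s :|: vset ss')%SET else finset.set0.

Fixpoint eset ss : {set {set U}} :=
  if ss is s :: ss' then ([set s @: e | e : {set V} in edges H] :|: eset ss')%SET
  else finset.set0.

Definition list_colorings (C : finType) ss : {set {ffun U -> C}} :=
  [set X : {ffun U -> C} | all (fun s => [forall a, forall b, X (s a) == X (s b)]) ss]%SET.

Lemma eset_vset ss e : e \in eset ss -> e \subset vset ss.
Proof.
elim: ss => [|s ss IH] /=; rewrite inE // => /orP[/finset.imsetP[e' _ ->]|/IH h].
  apply/fintype.subsetP => _ /finset.imsetP[x _ ->]; rewrite inE mem_vimage //.
by apply: (fintype.subset_trans h); exact: finset.subsetUr.
Qed.

Definition old_vertices s ss : {set V} := [set a | s a \in vset ss]%SET.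
Definition old_edges s ss : {set {set V}} := [set e in edges H | s @: e \in eset ss]%SET.

Lemma card_vset_cons s ss : injective s ->
  (#|vset (s :: ss)| + #|old_vertices s ss| = #|V| + #|vset ss|)%N.
Proof.
move=> si; rewrite /= cardsU.
have -> : #|old_vertices s ss| = #|vimage s :&: vset ss|%SET.
  rewrite -(card_imset _ si); apply: eq_card => u; rewrite !inE.
  apply/finset.imsetP/andP => [[a + ->]|[/finset.imsetP[a _ ->] h]].
    by rewrite inE => h; rewrite h mem_vimage.
  by exists a; rewrite // inE.
have : (#|vimage s :&: vset ss|%SET <= #|vset ss|)%N by apply: subset_leq_card; exact: finset.subsetIr.
have := cardsUI (vimage s) (vset ss).
have -> : #|vimage s| = #|V| by rewrite /vimage card_imset // cardsT.
by move=> _ h; rewrite subnK // (leq_trans h) // leq_addl.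
Qed.

Lemma card_eset_cons s ss : injective s ->
  (#|eset (s :: ss)| + #|old_edges s ss| = #|edges H| + #|eset ss|)%N.
Proof.
move=> si; have imi : injective (fun e : {set V} => s @: e) by apply: imset_inj.
have -> : #|old_edges s ss| = #|[set s @: e | e : {set V} in edges H] :&: eset ss|%SET.
  rewrite -(card_imset _ imi); apply: eq_card => u; rewrite !inE.
  apply/finset.imsetP/andP => [[e + ->]|[/finset.imsetP[e eH ->] h]].
    by rewrite inE => /andP[eH h]; split => //; exact: imset_f.
  by exists e; rewrite // inE eH.
by rewrite /= -[#|edges H|](card_imset _ imi) cardsUI.
Qed.

Lemma old_subgraph s ss : injective s -> (0 < #|old_vertices s ss|)%N ->
  nonempty_subgraph H (old_vertices s ss, old_edges s ss).
Proof.
move=> si v0; apply/and3P; split => /=; first by rewrite -card_gt0.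
  by apply/fintype.subsetP => e; rewrite inE => /andP[].
apply/forallP => e; apply/implyP; rewrite inE => /andP[_ /eset_vset /fintype.subsetP h].
by apply/fintype.subsetP => x xe; rewrite inE h // imset_f.
Qed.

Lemma old_edges_eq0 s ss : #|old_vertices s ss| = 0%N -> #|old_edges s ss| = 0%N.
Proof.
move=> /eqP; rewrite cards_eq0 => /eqP v0; apply/eqP; rewrite cards_eq0; apply/eqP/finset.setP => e.
rewrite !inE; apply/negP => /andP[eH /eset_vset /fintype.subsetP h].
have /card_gt0P[x xe] : (0 < #|e|)%N by rewrite (edge_card2 eH).
have : x \in old_vertices s ss by rewrite inE h // imset_f.
by rewrite v0 inE.
Qed.

(** Recoloring, in a coloring compatible with one more copy, the new vertices
    of that copy, all but one if none is old, gives distinct colorings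
    compatible with the previous copies. *)
Lemma list_colorings_cons s ss : injective s ->
  (#|list_colorings bool (s :: ss)| * 2 ^ (#|V| - maxn #|old_vertices s ss| 1) <=
   #|list_colorings bool ss|)%N.
Proof.
move=> si; have /card_gt0P[a0 _] := V0.
pose A := old_vertices s ss.
pose B : {set V} := if A == finset.set0 then [set a0]%SET else A.
have cB : #|B| = maxn #|A| 1.
  rewrite /B; case: eqP => [->|/eqP]; first by rewrite cards0 cards1.
  by rewrite -card_gt0 => h; rewrite (maxn_idPl _).
have AB : A \subset B by rewrite /B; case: eqP => // ->; exact: finset.sub0set.
(* The vertex [b] keeps its color, which reveals the original common color. *)
have [b bB] : exists b, b \in B.
  by apply/card_gt0P; rewrite cB leq_maxr.
rewrite -/A -cB.
have -> : (#|V| - #|B| = #|~: B|)%N by rewrite -(cardsC B) addKn.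
rewrite -card_powerset -cardsX.
pose F (Xy : {ffun U -> bool} * {set V}) : {ffun U -> bool} :=
  [ffun u => Xy.1 u (+) (u \in s @: Xy.2)].
have Fi : {in finset.setX (list_colorings bool (s :: ss)) (powerset (~: B)) &, injective F}.
  move=> [X y] [X' y']; rewrite !inE /= => /andP[/andP[/forallP hX _] yB] /andP[/andP[/forallP hX' _] yB'] /ffunP FF.
  have bn (z : {set V}) : z \subset (~: B)%SET -> b \in z = false.
    by move=> /fintype.subsetP h; apply/negP => /h; rewrite inE bB.
  have Xb : X (s b) = X' (s b).
    by have := FF (s b); rewrite !ffunE /= !(mem_imset _ _ si) !bn // !addbF.
  have yy : y = y'.
    apply/finset.setP => x; have := FF (s x); rewrite !ffunE /= !(mem_imset _ _ si).
    have /forallP/(_ b)/eqP-> := hX x; have /forallP/(_ b)/eqP-> := hX' x.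
    by rewrite Xb => /addbI.
  rewrite -yy in FF *; congr pair; apply/ffunP => u; have := FF u; rewrite !ffunE /=.
  exact: addIb.
rewrite -(card_in_imset Fi); apply: subset_leq_card; apply/fintype.subsetP => _ /finset.imsetP[[X y] + ->].
rewrite !inE /= => /andP[/andP[_ /allP hX] /fintype.subsetP yB]; apply/allP => t tss.
have tn x : t x \in s @: y = false.
  apply/negP => /finset.imsetP[z zy tz]; have := yB z zy; rewrite inE => /negP; apply.
  apply: (fintype.subsetP AB); rewrite inE -tz.
  elim: (ss) tss => // t' ss' IH; rewrite inE /= => /orP[/eqP<-|/IH h]; rewrite inE ?mem_vimage //.
  by rewrite h orbT.
apply/forallP => x; apply/forallP => z; rewrite !ffunE /= !tn !addbF.
by have /forallP/(_ x)/forallP/(_ z) := hX t tss.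
Qed.

End CopyList.

Section GammaFacts.
Variables (R : realType) (V : finType) (H : sgraph V).
Hypothesis V0 : (0 < #|V|)%N.
Hypothesis unbalanced : ~ balanced R H.

Let D := @gamma_denom R V H.
Let v : R := #|V|%:R.
Let e : R := #|edges H|%:R.
Let g := gamma R H.
Let ratio (K : {set V} * {set {set V}}) : R := (v - #|K.1|%:R) / D K.

Lemma nonempty_subgraph_full : nonempty_subgraph H (finset.setT, edges H).
Proof.
apply/and3P; split => //=; last by apply/forallP => x; apply/implyP => _; exact: finset.subsetT.
by rewrite -card_gt0 cardsT.
Qed.

Lemma exists_denser : exists2 K, nonempty_subgraph H K & e * #|K.1|%:R < #|K.2|%:R * v.
Proof.
apply/not_exists2P => h; apply: unbalanced; apply/eqP; rewrite eq_le; apply/andP; split.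
  apply: bigmax_le => [|K hK]; first by rewrite divr_ge0.
  have K0 : (0 : R) < #|K.1|%:R by rewrite ltr0n; case/and3P: hK; rewrite -card_gt0.
  rewrite ler_pdivrMr // mulrAC ler_pdivlMr ?ltr0n //.
  by have [//|/negP] := h K; rewrite -leNgt.
have := @le_bigmax_cond _ _ _ 0 _ (nonempty_subgraph H)
  (fun K : {set V} * {set {set V}} => #|K.2|%:R / #|K.1|%:R : R) nonempty_subgraph_full.
by rewrite /= cardsT.
Qed.

Lemma card_subgraph K : nonempty_subgraph H K ->
  [/\ (0 < #|K.1|)%N, (#|K.1| <= #|V|)%N & (#|K.2| <= #|edges H|)%N].
Proof.
by case/and3P => k0 k2 _; split; [rewrite card_gt0|exact: max_card|exact: subset_leq_card].
Qed.

Lemma card_edges_gt0 : (0 < #|edges H|)%N.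
Proof.
have [K /card_subgraph[k0 kv ke] h] := exists_denser.
rewrite lt0n; apply/eqP => e0; move: ke; rewrite e0 leqn0 => /eqP k2.
by move: h; rewrite /e e0 k2 !mul0r ltxx.
Qed.

Lemma card_vertices_gt1 : (1 < #|V|)%N.
Proof.
have /card_gt0P[x xH] := card_edges_gt0.
by rewrite -(edge_card2 xH); exact: max_card.
Qed.

Lemma gamma_denom_full : D (finset.setT, edges H) = 0.
Proof. by rewrite /D /gamma_denom /= cardsT subrr. Qed.

Lemma gamma_denom_gt0_proper K : nonempty_subgraph H K -> 0 < D K ->
  proper_subgraph H K /\ (#|K.1| < #|V|)%N.
Proof.
move=> hK DK; have [k0 kv ke] := card_subgraph hK; split.
  by rewrite /proper_subgraph hK; apply: contraTneq DK => ->; rewrite gamma_denom_full ltxx.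
rewrite ltnNge; apply: contraTN DK => vk.
have KV : #|K.1| = #|V| :> nat by apply/eqP; rewrite eqn_leq kv.
rewrite -leNgt /D /gamma_denom KV -mulrBl mulr_le0_ge0 ?subr_le0 ?ler_nat //.
by rewrite subr_ge0 ler1n.
Qed.

Lemma denser_gamma_denom K : nonempty_subgraph H K -> e * #|K.1|%:R < #|K.2|%:R * v -> 0 < D K.
Proof.
move=> hK h; have [k0 kv ke] := card_subgraph hK.
have ke' : #|K.2|%:R <= e by rewrite ler_nat.
by rewrite /D /gamma_denom -/v -/e; lra.
Qed.

Lemma gamma_attained : exists K,
  [/\ nonempty_subgraph H K, (#|K.1| < #|V|)%N, 0 < D K & g * D K = v - #|K.1|%:R].
Proof.
have [K1 h1 d1] := exists_denser; have D1 := denser_gamma_denom h1 d1.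
pose P K := proper_subgraph H K && (0 < D K).
have P1 : P K1 by rewrite /P D1 andbT; case: (gamma_denom_gt0_proper h1 D1).
have [K /andP[pK DK] Kmin] := @Order.TotalTheory.arg_minP _ R _ K1 P ratio P1.
have hK : nonempty_subgraph H K by case/andP: pK.
exists K; split => //; first by case: (gamma_denom_gt0_proper hK DK).
suff -> : g = ratio K by rewrite /ratio divfK ?gt_eqF.
apply/eqP; rewrite eq_le; apply/andP; split.
  apply: ge_inf; last by exists K.
  exists (ratio K) => _ [K' [pK' DK'] <-].
  by apply: Kmin; rewrite /P pK' DK'.
apply: lb_le_inf; first by exists (ratio K); exists K.
by move=> _ [K' [pK' DK'] <-]; apply: Kmin; rewrite /P pK' DK'.
Qed.

Lemma gamma_gt0 : 0 < g.
Proof.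
have [K [hK kv DK gD]] := gamma_attained.
by rewrite -(pmulr_lgt0 _ DK) gD subr_gt0 ltr_nat.
Qed.

(** Clearing the denominator in the definition of [gamma] gives a bound that
    remains true for the subgraphs excluded from the minimum. *)
Lemma gamma_denom_le K : nonempty_subgraph H K -> g * D K <= v - #|K.1|%:R.
Proof.
move=> hK; have [k0 kv ke] := card_subgraph hK.
have [DK|DK] := ltP 0 (D K); last first.
  apply: (@le_trans _ _ 0); first by rewrite mulr_ge0_le0 // ltW // gamma_gt0.
  by rewrite subr_ge0 ler_nat.
rewrite -ler_pdivlMr //; apply: ge_inf; last first.
  by exists K => //; split => //; case: (gamma_denom_gt0_proper hK DK).
exists 0 => _ [K' [/andP[pK' _] DK'] <-].
have [k0' kv' ke'] := card_subgraph pK'.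
by rewrite divr_ge0 ?(ltW DK') // subr_ge0 ler_nat.
Qed.

(** Apply the previous bound to a subgraph [K] denser than [H]: for such a [K]
    the quotient defining [gamma] is at most [v / e]. *)
Lemma gamma_edges_le : g * e <= v.
Proof.
have [K hK d] := exists_denser; have DK := denser_gamma_denom hK d.
have := gamma_denom_le hK; have [k0 kv ke] := card_subgraph hK.
have g0 := gamma_gt0; rewrite /D /gamma_denom -/v -/e in DK *.
have v0 : 0 < v - 1 by rewrite subr_gt0 ltr1n card_vertices_gt1.
have e0 : 0 < e by rewrite ltr0n card_edges_gt0.
have k1 : 1 <= #|K.1|%:R :> R by rewrite ler1n.
set a : R := #|K.1|%:R in d k1 *; set b : R := #|K.2|%:R in d DK *.
move=> gD.
have h1 : g * e * (b * (v - 1) - e * (a - 1)) <= e * (v - a).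
  by rewrite [g * e]mulrC -mulrA ler_wpM2l // ltW.
have h2 : e * (v - a) <= v * (b * (v - 1) - e * (a - 1)).
  rewrite -subr_ge0; have -> : v * (b * (v - 1) - e * (a - 1)) - e * (v - a) = (v - 1) * (b * v - e * a).
    by ring.
  by apply: mulr_ge0; [exact: ltW|rewrite subr_ge0 ltW].
have := le_trans h1 h2; rewrite ler_pM2r //.
Qed.

End GammaFacts.

Section RankBound.
Variables (R : realType) (V U : finType) (H : sgraph V).
Hypothesis V0 : (0 < #|V|)%N.
Hypothesis unbalanced : ~ balanced R H.
Let v : R := #|V|%:R.
Let e : R := #|edges H|%:R.
Let g := gamma R H.

(** Glue the copies one by one. When the part of the new copy that is old has
    at least one vertex, the defining inequality of [gamma] for this part says
    that the exponent of [n] in the expected number of monochromatic copies of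
    the union does not increase. The number [rho] is a lower bound for the
    number of independent constraints on the colors, read off from the number
    of admissible colorings with two colors. *)
Lemma rank_bound (ss : seq {ffun V -> U}) : (forall s, s \in ss -> injective s) ->
  exists2 rho : nat, (#|list_colorings bool ss| * 2 ^ rho <= 2 ^ #|U|)%N &
  (v - 1) * (#|vset ss|%:R - g * #|eset H ss|%:R) <= rho%:R * (v - g * e).
Proof.
elim: ss => [_|s ss IH hs].
  exists 0%N; last by rewrite /= !cards0 mulr0 subrr mulr0 mul0r.
  have <- : #|{ffun U -> bool}| = (2 ^ #|U|)%N by rewrite card_ffun card_bool.
  by rewrite expn0 muln1 max_card.
have si : injective s by apply: hs; rewrite inE eqxx.
have [|rho r1 r2] := IH; first by move=> t tss; apply: hs; rewrite inE tss orbT.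
have cV := card_vset_cons ss si; have cE := card_eset_cons H ss si.
exists (rho + (#|V| - maxn #|old_vertices s ss| 1))%N.
  apply: leq_trans r1; rewrite addnC expnD mulnA leq_mul2r list_colorings_cons //.
  by rewrite orbT.
have g0 : 0 < g by apply: gamma_gt0.
have ge : g * e <= v by apply: gamma_edges_le.
have v1 : 1 < v by rewrite ltr1n (@card_vertices_gt1 R V H).
have ov : (#|old_vertices s ss| <= #|V|)%N := max_card _.
move/(congr1 (fun k : nat => k%:R : R)): cV; rewrite !natrD -/v => cV.
move/(congr1 (fun k : nat => k%:R : R)): cE; rewrite !natrD -/e => cE.
move: r2 cV cE; set a : R := #|vset (s :: ss)|%:R; set b : R := #|eset H (s :: ss)|%:R.
set a' : R := #|vset ss|%:R; set b' : R := #|eset H ss|%:R.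
have [ old0 | old0 ] := posnP (#|old_vertices s ss|).
  rewrite (old_edges_eq0 H old0) old0 max0n natrB // -/v !addr0 => r2 -> ->.
  by lra.
have := gamma_denom_le V0 unbalanced (old_subgraph H si old0); rewrite /gamma_denom /= -/v -/e -/g.
rewrite (maxn_idPl old0) natrB // -/v.
set x : R := #|old_vertices s ss|%:R; set y : R := #|old_edges H s ss|%:R.
move=> gK r2 h1 h2.
have -> : a = v + a' - x by rewrite -h1 addrK.
have -> : b = e + b' - y by rewrite -h2 addrK.
by lra.
Qed.

End RankBound.

Section CopyFamilies.
Variables (J V : finType) (H : sgraph V).

Definition copy_row (U : finType) (f : {ffun J * V -> U}) j : {ffun V -> U} := [ffun a => f (j, a)].
Definition copy_rows (U : finType) (f : {ffun J * V -> U}) := [seq copy_row f j | j <- enum J].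
Definition inj_rows (U : finType) (f : {ffun J * V -> U}) := [forall j, injectiveb (copy_row f j)].
Definition edge_size (U : finType) (f : {ffun J * V -> U}) := #|eset H (copy_rows f)|.
Definition same_row : rel (J * V) := fun x y => x.1 == y.1.
(** Each row is monochromatic and rows with a common vertex share their color:
    this is the number of colors left to choose. *)
Definition class_count (U : finType) (f : {ffun J * V -> U}) := joined_classes same_row f.

Lemma copy_rowE (U : finType) (f : {ffun J * V -> U}) j a : copy_row f j a = f (j, a).
Proof. by rewrite ffunE. Qed.

Lemma same_row_sym : symmetric same_row.
Proof. by move=> x y; rewrite /same_row eq_sym. Qed.

Lemma mem_vset (U : finType) (f : {ffun J * V -> U}) : vset (copy_rows f) = [set f x | x : J * V]%SET.
Proof.
have h (ss : seq {ffun V -> U}) u : (u \in vset ss) = has (fun s => u \in vimage s) ss.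
  by elim: ss => [|s ss IH] /=; rewrite inE // IH.
apply/finset.setP => u; rewrite h has_map; apply/hasP/finset.imsetP => [[j _ /finset.imsetP[a _ ->]]|[[j a] _ ->]].
  by exists (j, a); rewrite // copy_rowE.
by exists j; rewrite ?mem_enum //=; apply/finset.imsetP; exists a; rewrite // copy_rowE.
Qed.

Lemma card_vset_rows (U : finType) (f : {ffun J * V -> U}) : #|vset (copy_rows f)| = image_size f.
Proof. by rewrite mem_vset. Qed.

Lemma mem_eset_seq (U : finType) (ss : seq {ffun V -> U}) e :
  (e \in eset H ss) = has (fun s : {ffun V -> U} => e \in [set s @: e' | e' : {set V} in edges H]%SET) ss.
Proof. by elim: ss => [|s ss IH] /=; rewrite inE // IH. Qed.

Lemma mem_eset_rows (U : finType) (f : {ffun J * V -> U}) e :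
  reflect (exists j, exists2 e' : {set V}, e' \in edges H & e = copy_row f j @: e') (e \in eset H (copy_rows f)).
Proof.
rewrite mem_eset_seq has_map; apply: (iffP hasP) => [[j _ /finset.imsetP[e' eH ->]]|[j [e' eH ->]]].
  by exists j, e'.
by exists j; rewrite ?mem_enum //=; apply: imset_f.
Qed.

(** A map is injective on the representatives of its kernel, hence on the
    edges of the pattern. *)
Lemma edge_size_pattern (U : finType) (f : {ffun J * V -> U}) :
  edge_size (kernel_pattern f) = edge_size f.
Proof.
set k := kernel_pattern f.
have rowk j (e : {set V}) : f @: (copy_row k j @: e) = copy_row f j @: e.
  by rewrite -imset_comp; apply: eq_imset => a; rewrite /= !copy_rowE kernel_patternK.
rewrite /edge_size -[LHS](@card_in_imset _ _ (fun e : {set J * V} => f @: e)).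
  apply: eq_card => e; apply/finset.imsetP/mem_eset_rows => [[e' /mem_eset_rows[j [e'' eH ->]] ->]|[j [e' eH ->]]].
    by exists j, e''; rewrite // rowk.
  by exists (copy_row k j @: e'); rewrite ?rowk //; apply/mem_eset_rows; exists j, e'.
have fi : {in [set k x | x : J * V]%SET &, injective f}.
  move=> _ _ /finset.imsetP[x _ ->] /finset.imsetP[y _ ->]; rewrite !kernel_patternK => h.
  by apply/eqP; rewrite kernel_patternP h.
have sub e : e \in eset H (copy_rows k) -> {subset e <= [set k x | x : J * V]%SET}.
  by move=> /eset_vset; rewrite mem_vset => /fintype.subsetP.
move=> e e' he he' ee'; apply/finset.setP => x.
have hx (A B : {set J * V}) : A \in eset H (copy_rows k) -> B \in eset H (copy_rows k) -> f @: A = f @: B -> x \in A -> x \in B.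
  move=> hA hB AB xA; have : f x \in f @: B by rewrite -AB imset_f.
  by case/finset.imsetP => y yB /(fi _ _ (sub _ hA _ xA) (sub _ hB _ yB)) ->.
by apply/idP/idP; apply: hx.
Qed.

Lemma inj_rows_pattern (U : finType) (f : {ffun J * V -> U}) :
  inj_rows (kernel_pattern f) = inj_rows f.
Proof.
apply: eq_forallb => j; apply/injectiveP/injectiveP => h a b.
  by rewrite !copy_rowE => fab; apply: h; apply/eqP; rewrite !copy_rowE kernel_patternP fab.
by rewrite !copy_rowE => /eqP; rewrite kernel_patternP => /eqP fab; apply: h; rewrite !copy_rowE.
Qed.

Lemma class_count_pattern (U : finType) (f : {ffun J * V -> U}) :
  class_count (kernel_pattern f) = class_count f.
Proof. exact: joined_classes_pattern. Qed.

Lemma card_list_colorings_rows (U C : finType) (f : {ffun J * V -> U}) :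
  #|list_colorings C (copy_rows f)| = (#|C| ^ (#|U| - image_size f + class_count f))%N.
Proof.
rewrite /class_count -(card_joined_colorings f same_row_sym); apply: eq_card => X; rewrite !inE all_map.
apply/allP/forallP => [h [j a]|h j _ /=].
  apply/forallP => -[j' b]; apply/implyP => /eqP /= <-.
  by have /(_ (mem_enum _ _))/= := h j; move=> /forallP/(_ a)/forallP/(_ b); rewrite !ffunE.
apply/forallP => a; apply/forallP => b; rewrite !ffunE.
by have /forallP/(_ (j, b)) := h (j, a); rewrite /same_row eqxx.
Qed.

Lemma class_count_le (U : finType) (f : {ffun J * V -> U}) : (class_count f <= image_size f)%N.
Proof. exact: joined_classes_le same_row_sym. Qed.

Lemma image_size_le (U : finType) (f : {ffun J * V -> U}) : (image_size f <= #|U|)%N.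
Proof. exact: max_card. Qed.

Lemma inj_rowsP (U : finType) (f : {ffun J * V -> U}) :
  reflect (forall s, s \in copy_rows f -> injective s) (inj_rows f).
Proof.
apply: (iffP forallP) => [h s /mapP[j _ ->]|h j]; first exact/injectiveP.
by apply/injectiveP/h/map_f; rewrite mem_enum.
Qed.

(** The colorings with two colors compatible with the rows of [f] are counted
    exactly, so that the number of constraints in [rank_bound] is at most the
    number of vertices minus the number of color classes. *)
Lemma pattern_exponent_le (R : realType) (U : finType) (f : {ffun J * V -> U}) :
  (0 < #|V|)%N -> ~ balanced R H -> inj_rows f ->
  (#|V|%:R - 1) * ((image_size f)%:R - gamma R H * (edge_size f)%:R) <=
  (image_size f - class_count f)%N%:R * (#|V|%:R - gamma R H * #|edges H|%:R) :> R.
Proof.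
move=> V0 unb /inj_rowsP /(rank_bound V0 unb)[rho].
rewrite card_list_colorings_rows card_bool -expnD leq_exp2l // => h.
rewrite card_vset_rows => /le_trans; apply; rewrite ler_wpM2r //.
  by rewrite subr_ge0 gamma_edges_le.
have := image_size_le f; have := class_count_le f.
rewrite ler_nat; lia.
Qed.

End CopyFamilies.

Section FamilyProbability.
Variables (R : realType) (J V : finType) (H : sgraph V) (n c : nat) (p : R).
Hypotheses (c0 : (0 < c)%N).

Lemma prob_family (f : {ffun J * V -> 'I_n}) :
  cg_expect p (fun w : colored_graph n c => [forall j, mono_embedding H w.1 w.2 (copy_row f j)]%:R) =
  (inj_rows f)%:R * (p ^+ edge_size H f * c%:R ^- (image_size f - class_count f)).
Proof.
have [fi|fi] := boolP (inj_rows f); last first.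
  rewrite mul0r -[RHS](expect0 n c p); apply: eq_expect => w.
  have /forallPn[j nj] := fi.
  rewrite (_ : [forall j, _] = false) //; apply/negP => /forallP/(_ j)/and3P[].
  by rewrite (negbTE nj).
rewrite mul1r.
have -> : c%:R ^- (image_size f - class_count f) =
   #|list_colorings 'I_c (copy_rows f)|%:R / (c ^ n)%:R :> R.
  rewrite card_list_colorings_rows !card_ord.
  have := image_size_le f; rewrite card_ord => mn; have kn := class_count_le f.
  move: (image_size f) (class_count f) mn kn => m k mn kn.
  have -> : (c ^ n = c ^ (n - m + k) * c ^ (m - k))%N by rewrite -expnD; congr expn; lia.
  by rewrite [in RHS]natrM invfM mulrA divff ?c_exp_neq0 // mul1r natrX.
rewrite -expect_edges_colors; last first.
  apply/fintype.subsetP => e /mem_eset_rows[j [e' eH ->]]; rewrite inE.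
  by rewrite card_imset ?(edge_card2 eH) //; apply/injectiveP; have /forallP := fi.
apply: eq_expect => w; congr (nat_of_bool _)%:R; apply/forallP/andP => [h|[/fintype.subsetP h1 h2] j].
  split.
    apply/fintype.subsetP => e /mem_eset_rows[j [e' eH ->]].
    by have /and3P[_ /forallP/(_ e')] := h j; rewrite eH.
  by rewrite inE; apply/allP => _ /mapP[j _ ->]; have /and3P[] := h j.
apply/and3P; split; first by have /forallP := fi.
  apply/forallP => e; apply/implyP => eH; apply: h1; apply/mem_eset_rows; by exists j, e.
by move: h2; rewrite inE => /allP; apply; apply: map_f; rewrite mem_enum.
Qed.

End FamilyProbability.

(** * Limits of real sequences *)

Section SequenceLimits.
Variable R : realType.
Implicit Types (u w : nat -> R) (l : R).

Lemma cvg_expn u l k : u n @[n --> \oo] --> l -> u n ^+ k @[n --> \oo] --> l ^+ k.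
Proof.
move=> ul; have := @exprn_continuous R k l; apply: cvg_comp => //.
Qed.

Lemma cvg_bigsum (I : Type) (r : seq I) (P : pred I) (F : I -> nat -> R) (L : I -> R) :
  (forall i, P i -> F i n @[n --> \oo] --> L i) ->
  \sum_(i <- r | P i) F i n @[n --> \oo] --> \sum_(i <- r | P i) L i.
Proof.
move=> h; elim: r => [|i r IH].
  rewrite big_nil; under eq_fun do rewrite big_nil; exact: cvg_cst.
rewrite big_cons; under eq_fun do rewrite big_cons.
by case: ifP => Pi //; apply: cvgD => //; exact: h.
Qed.

Lemma cvg_bigsum0 (I : Type) (r : seq I) (P : pred I) (F : I -> nat -> R) :
  (forall i, P i -> F i n @[n --> \oo] --> 0) ->
  \sum_(i <- r | P i) F i n @[n --> \oo] --> 0.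
Proof. by move=> h; have := @cvg_bigsum I r P F (fun=> 0) h; rewrite big1_eq. Qed.

Lemma cvg_eventually (N : nat) u w l : (forall n, (N <= n)%N -> u n = w n) ->
  u n @[n --> \oo] --> l -> w n @[n --> \oo] --> l.
Proof.
move=> h ul; apply: cvg_trans ul; apply: near_eq_cvg; near=> n; apply: h.
by near: n; exact: nbhs_infty_ge.
Unshelve. all: by end_near. Qed.

Lemma cvg_squeeze0 (N : nat) u w : (forall n, (N <= n)%N -> `|u n| <= w n) ->
  w n @[n --> \oo] --> 0 -> u n @[n --> \oo] --> 0.
Proof.
move=> h w0; apply/cvgr0Pnorm_lt => eps eps0; near=> n.
apply: (@le_lt_trans _ _ (w n)).
  by apply: h; near: n; exact: nbhs_infty_ge.
apply: le_lt_trans (ler_norm _) _.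
by near: n; move/cvgr0Pnorm_lt : w0; apply.
Unshelve. all: by end_near. Qed.

Lemma cvg_root0 u k : (0 < k)%N -> (forall n, 0 <= u n) ->
  u n ^+ k @[n --> \oo] --> 0 -> u n @[n --> \oo] --> 0.
Proof.
move=> k0 u0 uk; apply/cvgr0Pnorm_lt => eps eps0; near=> n.
rewrite ger0_norm // -(@ltr_pXn2r _ k) ?nnegrE ?(ltW eps0) //.
rewrite -[ltLHS]ger0_norm ?exprn_ge0 //.
by near: n; move/cvgr0Pnorm_lt : uk; apply; rewrite exprn_gt0.
Unshelve. all: by end_near. Qed.

Lemma cvg_powR u l x : 0 < l -> u n @[n --> \oo] --> l -> u n `^ x @[n --> \oo] --> l `^ x.
Proof.
move=> l0 ul; have c : {for l, continuous (@powR R ^~ x)}.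
  apply: differentiable_continuous; apply/derivable1_diffP; apply: derivable_powR.
  by rewrite in_itv /= l0.
exact: (cvg_comp _ _ ul c).
Qed.

Lemma cvg_natV : (n%:R : R)^-1 @[n --> \oo] --> 0.
Proof. by rewrite -cvg_shiftS; exact: cvg_harmonic. Qed.

Lemma cvg_natXV k : (0 < k)%N -> (n%:R : R) ^- k @[n --> \oo] --> 0.
Proof.
move=> k0; have := @cvg_expn _ _ k cvg_natV; rewrite expr0n gtn_eqF //.
by under eq_fun do rewrite exprVn.
Qed.

(** A suitable power of the sequence is bounded by the inverse of [n]. *)
Lemma cvg_nat_powR_neg x : x < 0 -> (n%:R : R) `^ x @[n --> \oo] --> 0.
Proof.
move=> x0; have x0' : 0 < - x by rewrite oppr_gt0.
(* [k] makes the exponent [x * k] at most [-1]. *)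
set k := Num.bound (- x)^-1.
have kx : 1 <= - x * k%:R.
  rewrite mulrC -ler_pdivrMr // mul1r; apply: ltW.
  by apply: archi_boundP; rewrite invr_ge0 ltW.
have k0 : (0 < k)%N.
  by rewrite lt0n; apply: contraTneq kx => ->; rewrite mulr0 -ltNge ltr01.
apply: (cvg_root0 k0) => [n|]; first exact: powR_ge0.
apply: (@cvg_squeeze0 1 _ (fun n => n%:R^-1)); last exact: cvg_natV.
move=> n n0; rewrite ger0_norm ?exprn_ge0 ?powR_ge0 //.
rewrite -powR_mulrn ?powR_ge0 // -powRrM -powR_inv1 //.
by apply: ler_powR; [rewrite ler1n|rewrite -[x]opprK mulNr lerN2].
Qed.

Lemma cvg_ffact k : (n ^_ k)%:R / n%:R ^+ k @[n --> \oo] --> (1 : R).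
Proof.
elim: k => [|k IH].
  by under eq_fun do rewrite ffactn0 expr0 divr1; exact: cvg_cst.
have h : (n - k)%N%:R / n%:R @[n --> \oo] --> (1 : R).
  apply: (@cvg_eventually k.+1 (fun n => 1 - k%:R * n%:R^-1)).
    move=> n kn; rewrite natrB ?(ltnW kn) // mulrBl divff // pnatr_eq0; by case: n kn.
  rewrite -[X in _ --> X]subr0; apply: cvgB; first exact: cvg_cst.
  by rewrite -(mulr0 k%:R); apply: cvgM; [exact: cvg_cst|exact: cvg_natV].
rewrite -[X in _ --> X]mulr1; apply: cvg_trans (cvgM IH h); apply: near_eq_cvg; near=> n.
by rewrite /= ffactnSr natrM exprSr invfM mulrACA.
Unshelve. all: by end_near. Qed.

End SequenceLimits.

Arguments vset : simpl never.
Arguments eset : simpl never.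

(** * Pairs of overlapping copies *)

Section Pairs.
Variables (V U : finType) (H : sgraph V).
Hypothesis V0 : (0 < #|V|)%N.
Implicit Types (s : {ffun V -> U}).

Definition join_pair s s' : {ffun bool * V -> U} :=
  [ffun x => if x.1 then s x.2 else s' x.2].

Lemma row_join_pair s s' b : copy_row (join_pair s s') b = if b then s else s'.
Proof. by apply/ffunP => a; rewrite copy_rowE ffunE; case: b. Qed.

Lemma rows_join_pair s s' : copy_rows (join_pair s s') = [:: s; s'].
Proof.
rewrite /copy_rows (_ : enum {: bool} = [:: true; false]).
  by rewrite /= !row_join_pair.
by rewrite enumT unlock.
Qed.

Lemma join_pair_inj : injective (fun u : {ffun V -> U} * {ffun V -> U} => join_pair u.1 u.2).
Proof.
move=> [s s'] [t t'] /= h; congr pair.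
  by have := row_join_pair s s' true; rewrite h row_join_pair.
by have := row_join_pair s s' false; rewrite h row_join_pair.
Qed.

Lemma meeting_old_vertices s s' : meeting s s' = (0 < #|old_vertices s [:: s']|)%N.
Proof.
rewrite /meeting card_gt0 -setI_eq0; apply/finset.set0Pn/finset.set0Pn => -[u].
  rewrite inE => /andP[us' /finset.imsetP[a _ ua]]; exists a.
  by rewrite !inE -ua us'.
by rewrite !inE orbF => us'; exists (s u); rewrite inE us' mem_vimage.
Qed.

(** Two rows with a common vertex are joined through it. *)
Lemma class_count_meeting s s' : meeting s s' -> class_count (join_pair s s') = 1%N.
Proof.
move=> ms; have /card_gt0P[x0 _] := V0.
apply/eqP; rewrite eqn_leq; apply/andP; split; last first.
  by apply: joined_classes_gt0; [exact: same_row_sym|exact: (true, x0)].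
have es := joined_connect_sym (join_pair s s') (@same_row_sym bool V).
move: ms; rewrite meeting_old_vertices => /card_gt0P[a]; rewrite !inE orbF => /finset.imsetP[b _ sab].
pose e := joined_rel (@same_row bool V) (join_pair s s').
have cross : connect e (true, a) (false, b).
  by apply: connect1; rewrite /e /joined_rel !ffunE /= sab eqxx ?orbT.
have same j x y : connect e (j, x) (j, y).
  by apply: connect1; rewrite /e /joined_rel /same_row /= eqxx.
have conn x : connect e (true, a) x.
  case: x => [[] x]; first exact: same.
  exact: connect_trans cross (same _ _ _).
apply/card_le1P => x; rewrite inE => /eqP rx y; rewrite !inE.
apply/eqP/eqP => [ry|->//]; rewrite -rx -ry; apply/(fingraph.rootP es).
by apply: connect_trans (conn x); rewrite es.
Qed.

Lemma card_vset_pair s s' : injective s -> injective s' ->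
  (#|vset [:: s; s']| + #|old_vertices s [:: s']| = 2 * #|V|)%N.
Proof.
move=> si si'; rewrite card_vset_cons // mul2n -addnn; congr addn.
by rewrite [vset [:: s']]finset.setU0 card_imset // cardsT.
Qed.

Lemma card_eset_pair s s' : injective s -> injective s' ->
  (#|eset H [:: s; s']| + #|old_edges H s [:: s']| = 2 * #|edges H|)%N.
Proof.
move=> si si'; rewrite card_eset_cons // mul2n -addnn; congr addn.
rewrite [eset H [:: s']]finset.setU0 card_imset //; exact: imset_inj.
Qed.

Lemma overlapping_old_vertices s s' : injective s -> injective s' -> overlapping s s' ->
  (#|old_vertices s [:: s']| < #|V|)%N.
Proof.
move=> si si' /andP[_]; apply: contraNT; rewrite -leqNgt => h.
have : old_vertices s [:: s'] == finset.setT.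
  by rewrite eqEcard finset.subsetT cardsT.
move=> /eqP old; rewrite eq_sym eqEcard; apply/andP; split; last by rewrite !card_imset.
apply/fintype.subsetP => _ /finset.imsetP[a _ ->].
have : a \in old_vertices s [:: s'] by rewrite old inE.
by rewrite !inE orbF.
Qed.

End Pairs.

Section PairCounting.
Variables (R : realType) (V : finType) (H : sgraph V) (n c : nat) (p : R).
Hypotheses (V0 : (0 < #|V|)%N) (p01 : 0 < p < 1) (c0 : (0 < c)%N).
Implicit Types (s : {ffun V -> 'I_n}).

Let Z s (w : colored_graph n c) := mono_embedding H w.1 w.2 s.

Lemma prob_pair s s' : injective s -> injective s' ->
  cg_expect p (fun w => (Z s w && Z s' w)%:R) =
  p ^+ #|eset H [:: s; s']| * c%:R ^- (#|vset [:: s; s']| - class_count (join_pair s s')).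
Proof.
move=> si si'; have := @prob_family R bool V H n c p c0 (join_pair s s').
have -> : inj_rows (join_pair s s').
  by apply/forallP => b; rewrite row_join_pair; apply/injectiveP; case: b.
rewrite mul1r /edge_size -card_vset_rows rows_join_pair => <-.
apply: eq_expect => w; congr (nat_of_bool _)%:R; apply/andP/forallP => [[h h'] b|h].
  by rewrite row_join_pair; case: b.
by have := h true; have := h false; rewrite !row_join_pair.
Qed.

Let C : nat := #|{ffun bool * V -> bool * V}|.

Lemma card_pairs_size m :
  (#|[set u : {ffun V -> 'I_n} * {ffun V -> 'I_n} | #|vset [:: u.1; u.2]| == m]%SET| <= C * n ^ m)%N.
Proof.
apply: leq_trans (card_image_size (bool * V)%type n m).
rewrite -(card_imset _ (@join_pair_inj _ _)); apply: subset_leq_card.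
apply/fintype.subsetP => _ /finset.imsetP[[s s'] + ->]; rewrite !inE /=.
by rewrite -card_vset_rows rows_join_pair.
Qed.

Lemma c_ge0 k : 0 <= (c%:R : R) ^- k.
Proof. by rewrite invr_ge0 exprn_ge0. Qed.

Lemma p_ge0 k : 0 <= p ^+ k.
Proof. by rewrite exprn_ge0 // ltW //; case/andP: p01. Qed.

(** The order of magnitude of the expected number of pairs of monochromatic
    embeddings whose common part has [a] vertices and [b] edges. *)
Definition overlap_term (a b : nat) : R :=
  n%:R ^+ (2 * #|V| - a) * p ^+ (2 * #|edges H| - b) * c%:R ^- (2 * #|V| - a - 1).

(** Group the overlapping pairs by their common part, a subgraph of [H] with
    fewer vertices; two copies that meet share their color. *)
Lemma overlap_bound : overlap_error H n c p <=
  \sum_(K : {set V} * {set {set V}} | nonempty_subgraph H K && (#|K.1| < #|V|)%N)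
    C%:R * overlap_term #|K.1| #|K.2|.
Proof.
rewrite /overlap_error pair_big_dep /= (bigID (fun u : {ffun V -> 'I_n} * {ffun V -> 'I_n} => injectiveb u.1 && injectiveb u.2)) /=.
rewrite [X in _ + X]big1 ?addr0 => [|[s s'] /andP[_ nij]]; last first.
  rewrite -[RHS](expect0 n c p); apply: eq_expect => w /=.
  rewrite (_ : _ && _ = false) //; apply: contraNF nij => /andP[/andP[-> _] /andP[-> _]] //.
rewrite (partition_big (fun u : {ffun V -> 'I_n} * {ffun V -> 'I_n} => (old_vertices u.1 [:: u.2], old_edges H u.1 [:: u.2]))
  (fun K => nonempty_subgraph H K && (#|K.1| < #|V|)%N)) /=; last first.
  move=> [s s'] /= /andP[ov /andP[/injectiveP si /injectiveP si']].
  rewrite overlapping_old_vertices // andbT; apply: old_subgraph => //.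
  by rewrite -meeting_old_vertices; case/andP: ov.
apply: ler_sum => -[A B] /= /andP[hK AV].
apply: (@le_trans _ _ (\sum_(u : {ffun V -> 'I_n} * {ffun V -> 'I_n} |
    #|vset [:: u.1; u.2]| == (2 * #|V| - #|A|)%N)
    (p ^+ (2 * #|edges H| - #|B|) * c%:R ^- (2 * #|V| - #|A| - 1)))).
  rewrite big_mkcond [leRHS]big_mkcond; apply: ler_sum => -[s s'] _ /=.
  case: ifP => [|_]; last by case: ifP => // _; rewrite mulr_ge0 ?p_ge0 ?c_ge0.
  move=> /andP[/andP[ov /andP[/injectiveP si /injectiveP si']] /eqP[oA oB]].
  have cv := card_vset_pair si si'; have ce := card_eset_pair H si si'.
  have -> : #|vset [:: s; s']| = (2 * #|V| - #|A|)%N by rewrite -cv oA addnK.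
  rewrite eqxx prob_pair // (class_count_meeting V0); last by case/andP: ov.
  by rewrite -ce -cv oA oB !addnK.
rewrite sumr_const -[leLHS]mulr_natl /overlap_term -[X in C%:R * X]mulrA [leRHS]mulrA.
apply: ler_wpM2r; first by rewrite mulr_ge0 ?p_ge0 ?c_ge0.
rewrite -natrX -natrM ler_nat; apply: leq_trans (card_pairs_size _).
by apply: eq_leq; apply: eq_card => u; rewrite !inE.
Qed.

Lemma prob_embedding_le s : 0 <= cg_expect p (fun w => (Z s w)%:R) <= p ^+ #|edges H| * c%:R ^- #|V|.-1.
Proof.
rewrite expect_ge0 //=; have [/injectiveP si|si] := boolP (injectiveb s).
  by rewrite prob_embedding.
rewrite [leLHS](_ : _ = 0) ?mulr_ge0 ?p_ge0 ?c_ge0 //.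
rewrite -[RHS](expect0 n c p); apply: eq_expect => w.
by rewrite /Z /mono_embedding (negbTE si).
Qed.

(** Each pair has the probability of a pair of disjoint copies, but occupies
    at least one vertex less. *)
Lemma meeting_bound : (0 < n)%N -> meeting_error H n c p <=
  (2 * #|V| * C)%N%:R * n%:R ^+ (2 * #|V| - 1) * (p ^+ #|edges H| * c%:R ^- #|V|.-1) ^+ 2.
Proof.
move=> n0; rewrite /meeting_error pair_big_dep /=.
set q := p ^+ _ * _.
have vs (u : {ffun V -> 'I_n} * {ffun V -> 'I_n}) : meeting u.1 u.2 -> injective u.1 -> injective u.2 ->
   (#|vset [:: u.1; u.2]| < 2 * #|V|)%N.
  by case: u => s s' /= ms si si'; rewrite -(card_vset_pair si si') -addn1 leq_add2l -meeting_old_vertices.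
apply: (@le_trans _ _ (\sum_(u : {ffun V -> 'I_n} * {ffun V -> 'I_n} |
    (#|vset [:: u.1; u.2]| < 2 * #|V|)%N) q ^+ 2)).
  rewrite big_mkcond [leRHS]big_mkcond; apply: ler_sum => -[s s'] _ /=.
  have q2 : 0 <= q ^+ 2 by rewrite exprn_ge0 // mulr_ge0 ?p_ge0 ?c_ge0.
  have zero (t : {ffun V -> 'I_n}) : ~~ injectiveb t -> cg_expect p (fun w : colored_graph n c => (mono_embedding H w.1 w.2 t)%:R) = 0 :> R.
    move=> ti; rewrite -[RHS](expect0 n c p); apply: eq_expect => w.
    by rewrite /mono_embedding (negbTE ti).
  case: ifP => [ms|_]; last by case: ifP.
  have [/injectiveP si|si] := boolP (injectiveb s); last first.
    by rewrite zero // mul0r; case: ifP.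
  have [/injectiveP si'|si'] := boolP (injectiveb s'); last first.
    by rewrite [X in _ * X]zero // mulr0; case: ifP.
  rewrite (vs (s, s')) // expr2.
  have /andP[a0 a1] := prob_embedding_le s; have /andP[b0 b1] := prob_embedding_le s'.
  exact: ler_pM.
rewrite sumr_const -[leLHS]mulr_natl; apply: ler_wpM2r.
  by rewrite exprn_ge0 // mulr_ge0 ?p_ge0 ?c_ge0.
rewrite -natrX -natrM ler_nat.
rewrite -sum1_card (partition_big (fun u : {ffun V -> 'I_n} * {ffun V -> 'I_n} => inord #|vset [:: u.1; u.2]| : 'I_(2 * #|V|).-1.+1) xpredT) //=.
have V2 : (2 * #|V|).-1.+1 = (2 * #|V|)%N by rewrite prednK // muln_gt0.
have -> : (2 * #|V| * C * n ^ (2 * #|V| - 1) =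
    \sum_(i < (2 * #|V|).-1.+1) C * n ^ (2 * #|V| - 1))%N.
  by rewrite sum_nat_const card_ord V2 mulnA.
apply: leq_sum => i _.
apply: (@leq_trans (C * n ^ i)); last first.
  rewrite leq_mul2l; apply/orP; right; rewrite leq_pexp2l // subn1 -ltnS.
  exact: ltn_ord.
apply: leq_trans (card_pairs_size i); rewrite sum1_card; apply: subset_leq_card.
apply/fintype.subsetP => u; rewrite !inE => /andP[h /eqP <-]; rewrite inordK ?V2 //.
Qed.

End PairCounting.

(** * Limits of Panjer recursions *)

Section PanjerLimit.
Variables (R : realType) (P rate : nat -> nat -> R) (err : nat -> R) (rho a : nat -> R) (B : R).
Hypothesis P_ge0 : forall n k, 0 <= P n k.
Hypothesis P_le1 : forall n K, \sum_(k < K) P n k <= 1.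
Hypothesis P_tail : forall n K, (0 < K)%N -> 1 - \sum_(k < K) P n k <= B / K%:R.
Hypothesis P_rec : forall n k,
  `|k%:R * P n k - \sum_(j < k.+1) rate n j * P n (k - j)%N| <= err n.
Hypothesis err0 : err n @[n --> \oo] --> 0.
Hypothesis rate_cvg : forall j, rate n j @[n --> \oo] --> rho j.
Hypothesis rate0 : forall n, rate n 0%N = 0.
Hypothesis a_pos : 0 < a 0%N.
Hypothesis a_rec : forall k, k%:R * a k = \sum_(j < k.+1) rho j * a (k - j)%N.
Hypothesis a_sum : \sum_(k < K) a k @[K --> \oo] --> (1 : R).

Let t n := P n 0%N / a 0%N.

Lemma panjer_ratio_bound n : `|t n| <= (a 0%N)^-1.
Proof.
rewrite ger0_norm ?divr_ge0 ?(ltW a_pos) // ler_pdivrMr // mulVf ?gt_eqF //.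
by have := P_le1 n 1; rewrite big_ord1.
Qed.

Lemma cvg0_mul_bounded (u w : nat -> R) M : (forall n, `|w n| <= M) ->
  u n @[n --> \oo] --> 0 -> u n * w n @[n --> \oo] --> 0.
Proof.
move=> wM u0; apply: (@cvg_squeeze0 _ 0 _ (fun n => `|u n| * M)).
  by move=> n _; rewrite normrM ler_wpM2l.
rewrite -(mul0r M); apply: cvgM; last exact: cvg_cst.
by rewrite -(@normr0 _ R); apply: cvg_norm.
Qed.

(** By induction on [k]: up to vanishing errors, the two sequences solve the
    same linear recursion, so that they stay in the ratio [t n] of their
    initial values. *)
Lemma panjer_proportional k : P n k - a k * t n @[n --> \oo] --> 0.
Proof.
elim/ltn_ind: k => k IH; have [->|k0] := posnP k.
  under eq_fun do rewrite /t mulrC divfK ?gt_eqF // subrr; exact: cvg_cst.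
have r0 : rho 0%N = 0.
  have h : rate n 0%N @[n --> \oo] --> (0 : R).
    by under eq_fun do rewrite rate0; exact: cvg_cst.
  by rewrite -(cvg_lim (@Rhausdorff R) (@rate_cvg 0%N)) (cvg_lim (@Rhausdorff R) h).
have kn0 : k%:R != 0 :> R by rewrite pnatr_eq0 -lt0n.
pose d n := k%:R * P n k - \sum_(j < k.+1) rate n j * P n (k - j)%N.
pose f j n := rate n j * (P n (k - j)%N - a (k - j)%N * t n) +
              (rate n j - rho j) * (a (k - j)%N * t n).
apply: (@cvg_eventually _ 0 (fun n => k%:R^-1 * (d n + \sum_(j < k.+1) f j n))).
  move=> n _; apply: (mulfI kn0); rewrite mulVKf // mulrBr mulrA a_rec /d -addrA; congr (_ + _).
  rewrite addrC mulr_suml -sumrB -sumrN; apply: eq_bigr => j _; rewrite /f; ring.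
rewrite -[X in _ --> X](mulr0 k%:R^-1); apply: cvgM; first exact: cvg_cst.
rewrite -[X in _ --> X]addr0; apply: cvgD.
  by apply: (@cvg_squeeze0 _ 0 _ err) => // n _; exact: P_rec.
apply: cvg_bigsum0 => j _.
rewrite -[X in _ --> X]addr0; apply: cvgD.
  have [j0|j0] := posnP j.
    under eq_fun do rewrite j0 rate0 mul0r; exact: cvg_cst.
  rewrite -(mulr0 (rho j)); apply: cvgM; first exact: rate_cvg.
  by apply: IH; have := ltn_ord j; lia.
apply: (@cvg0_mul_bounded _ _ (`|a (k - j)%N| * (a 0%N)^-1)).
  by move=> n; rewrite normrM ler_wpM2l // panjer_ratio_bound.
by rewrite -(subrr (rho j)); apply: cvgB; [exact: rate_cvg|exact: cvg_cst].
Qed.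

(** The recursion determines the law up to a constant factor, and the tail bound,
    which forbids the loss of mass at infinity, determines this factor. *)
Lemma panjer_limit k : P n k @[n --> \oo] --> a k.
Proof.
suff t1 : t n @[n --> \oo] --> (1 : R).
  apply: (@cvg_eventually _ 0 (fun n => (P n k - a k * t n) + a k * t n)).
    by move=> n _; rewrite subrK.
  rewrite -[X in _ --> X]add0r -[X in _ --> _ + X]mulr1; apply: cvgD; first exact: panjer_proportional.
  by apply: cvgM => //; exact: cvg_cst.
apply/cvgrPdist_lt => eps eps0.
have e3 : 0 < eps / 3 by rewrite divr_gt0.
have e4 : 0 < eps / 3 * a 0%N by rewrite mulr_gt0.
have : exists2 K : nat, (0 < K)%N /\ B / K%:R < eps / 3 & `|1 - \sum_(k < K) a k| < eps / 3 * a 0%N.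
  have h1 : B / n%:R @[n --> \oo] --> 0.
    by rewrite -(mulr0 B); apply: cvgM; [exact: cvg_cst|exact: cvg_natV].
  have h2 : \forall K \near \oo, [/\ (0 < K)%N, B / K%:R < eps / 3 & `|1 - \sum_(k < K) a k| < eps / 3 * a 0%N].
    near=> K; split.
    - by near: K; exact: nbhs_infty_gt.
    - apply: le_lt_trans (ler_norm _) _.
      by near: K; move/cvgr0Pnorm_lt : h1; apply.
    - by near: K; move/cvgrPdist_lt : a_sum; apply.
  have /filter_ex[K [K0 K1 K2]] := h2.
  by exists K.
move=> [K [K0 BK] AK].
have S0 : \sum_(k < K) P n k - (\sum_(k < K) a k) * t n @[n --> \oo] --> 0.
  apply: (@cvg_eventually _ 0 (fun n => \sum_(k < K) (P n k - a k * t n))).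
    by move=> n _; rewrite sumrB mulr_suml.
  apply: cvg_bigsum0 => j _.
  exact: panjer_proportional.
near=> n.
have -> : 1 - t n = (1 - \sum_(k < K) P n k) + (\sum_(k < K) P n k - (\sum_(k < K) a k) * t n) +
   (\sum_(k < K) a k - 1) * t n by ring.
have -> : eps = eps / 3 + eps / 3 + eps / 3 by field.
apply: le_lt_trans (ler_normD _ _) _; apply: ltrD.
  apply: le_lt_trans (ler_normD _ _) _; apply: ltrD.
    rewrite ger0_norm ?subr_ge0 ?P_le1 //.
    exact: le_lt_trans (P_tail _ K0) BK.
  by near: n; move/cvgr0Pnorm_lt : S0; apply.
rewrite normrM distrC; apply: (@le_lt_trans _ _ (`|1 - \sum_(k0 < K) a k0| * (a 0%N)^-1)).
  by rewrite ler_wpM2l // panjer_ratio_bound.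
by rewrite ltr_pdivrMr.
Unshelve. all: by end_near. Qed.

End PanjerLimit.

(** * Asymptotics of the error terms *)

Section DensityIdentities.
Variable R : realType.
Implicit Types N P C : R.

(** Raised to well chosen powers, the densities of a union of copies and of
    [H] contain the same power of [C]: this is how the number of colors is
    eliminated in favor of the mean, here and in the two next identities. *)
Lemma overlap_identity N P C (a d b b' : nat) :
  (N ^+ (a + 1 + 2 * d) * P ^+ (b + 2 * b') * C ^- (a + 2 * d)) ^+ (a + d) *
    (N ^+ d * P ^+ (b * (a + d))) =
  (N ^+ (a + 1 + d) * P ^+ (b + b') * C ^- (a + d)) ^+ (a + 2 * d) * P ^+ ((b + b') * a).
Proof.
rewrite !exprMn -!exprVn -!exprM.
have q (x y z x' y' : R) : x * y * z * (x' * y') = (x * x') * (y * y') * z by ring.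
rewrite q -!exprD.
have q' (x y z y' : R) : x * y * z * y' = x * (y * y') * z by ring.
rewrite q' -!exprD; congr (_ ^+ _ * _ ^+ _ * _ ^+ _); lia.
Qed.

Lemma density_identity N P C (a d b e : nat) :
  (N ^+ (a + 1) * P ^+ b * C ^- a) ^+ (a + d) * P ^+ (e * a) =
  N ^+ d * P ^+ (b * (a + d)) * (N ^+ (a + 1 + d) * P ^+ e * C ^- (a + d)) ^+ a.
Proof.
rewrite !exprMn -!exprVn -!exprM.
have q (x y z x' y' : R) : x' * y' * (x * y * z) = (x * x') * (y * y') * z by ring.
rewrite q -!exprD.
have q' (x y z y' : R) : x * y * z * y' = x * (y * y') * z by ring.
rewrite q' -!exprD; congr (_ ^+ _ * _ ^+ _ * _ ^+ _); lia.
Qed.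

Lemma term_identity N P C (m E r v e : nat) :
  (N ^+ m * P ^+ E * C ^- r) ^+ v * (N ^+ v.+1 * P ^+ e) ^+ r =
  N ^+ (m * v) * P ^+ (E * v) * (N ^+ v.+1 * P ^+ e * C ^- v) ^+ r.
Proof.
rewrite !exprMn -!exprVn -!exprM [(v * r)%N]mulnC; ring.
Qed.

End DensityIdentities.

Section Asymptotics.
Variables (R : realType) (V : finType) (H : sgraph V).
Variables (p : nat -> R) (c : nat -> nat) (lam : R).
Hypothesis V0 : (0 < #|V|)%N.
Hypothesis unbalanced : ~ balanced R H.
Hypothesis p01 : forall n, 0 < p n < 1.
Hypothesis c_gt0 : forall n, (0 < c n)%N.
Hypothesis mean_cvg : cg_expect (p n) (@Tmono R V H n (c n)) @[n --> \oo] --> lam.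

Let v := #|V|.
Let e := #|edges H|.
Let g := gamma R H.
Let Lam := lam * #|sg_aut H|%:R.

(** Up to a factor tending to [1], the expected number of monochromatic
    embeddings of a graph with [a] vertices and [b] edges, for positive [a].
    *)
Definition density (a b n : nat) : R := n%:R ^+ a * p n ^+ b * (c n)%:R ^- a.-1.

Lemma p_gt0 n : 0 < p n. Proof. by case/andP: (p01 n). Qed.
Lemma p_lt1 n : p n < 1. Proof. by case/andP: (p01 n). Qed.

Lemma cn_neq0 n : (c n)%:R != 0 :> R.
Proof. by rewrite pnatr_eq0 -lt0n. Qed.

Lemma mean_density n : (0 < n)%N ->
  cg_expect (p n) (@Tmono R V H n (c n)) =
  (n ^_ v)%:R / n%:R ^+ v * density v e n / #|sg_aut H|%:R.
Proof.
move=> n0; rewrite cg_expect_Tmono // mulnC bin_ffact /density.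
have n1 : (n%:R : R) ^+ v != 0 by rewrite expf_neq0 // pnatr_eq0 -lt0n.
have a0 := aut_neq0 R H; have cn := cn_neq0 n.
have ck : (c n)%:R ^+ v.-1 != 0 :> R by rewrite expf_neq0.
rewrite -/v -/e; move: n1 ck a0.
move: (_ ^+ v) (_ ^+ v.-1) (#|sg_aut H|%:R : R) ((n ^_ v)%:R : R) (_ ^+ e) => x y z f w x0 y0 z0.
by field; rewrite x0 y0 z0.
Qed.

Lemma density_full_cvg : density v e n @[n --> \oo] --> Lam.
Proof.
apply: (@cvg_eventually _ v (fun n => cg_expect (p n) (@Tmono R V H n (c n)) * #|sg_aut H|%:R /
    ((n ^_ v)%:R / n%:R ^+ v))).
  move=> n vn; have n0 : (0 < n)%N by apply: leq_trans vn.
  have a0 := aut_neq0 R H.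
  have n1 : (n%:R : R) ^+ v != 0 by rewrite expf_neq0 // pnatr_eq0 -lt0n.
  have f0 : (n ^_ v)%:R != 0 :> R by rewrite pnatr_eq0 -lt0n ffact_gt0.
  rewrite mean_density //; move: a0 n1 f0.
  move: (density _ _ _) (_ ^+ v) (#|sg_aut H|%:R : R) ((n ^_ v)%:R : R) => d x z f z0 x0 f0.
  by field; rewrite x0 z0 f0.
rewrite -[Lam]divr1; apply: cvgM; first by apply: cvgM => //; exact: cvg_cst.
by apply: cvgV; [exact: oner_neq0|exact: cvg_ffact].
Qed.

Lemma v_gt1 : (1 < v)%N. Proof. exact: (@card_vertices_gt1 R V H). Qed.

Lemma natr_gt0 n : (0 < n)%N -> 0 < n%:R :> R.
Proof. by rewrite ltr0n. Qed.

(** Raised to the power [v - 1], the expected number of pairs of copies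
    overlapping along a subgraph with [a] vertices and [b] edges is this ratio
    up to a convergent factor; that of the copies of the subgraph itself is
    the inverse ratio. *)
Definition overlap_ratio (a b n : nat) : R :=
  p n ^+ (e * a.-1) / (n%:R ^+ (v - a) * p n ^+ (b * v.-1)).

Lemma overlap_term_pow (a b n : nat) : (0 < n)%N -> (0 < a <= v)%N -> (b <= e)%N ->
  overlap_term H n (c n) (p n) a b ^+ v.-1 =
  density v e n ^+ (2 * v - a - 1) * overlap_ratio a b n.
Proof.
move=> n0 /andP[a0 av] be.
have := @overlap_identity R n%:R (p n) (c n)%:R a.-1 (v - a) b (e - b).
have -> : (a.-1 + 1 + 2 * (v - a) = 2 * v - a)%N by lia.
have -> : (b + 2 * (e - b) = 2 * e - b)%N by lia.
have -> : (a.-1 + 2 * (v - a) = 2 * v - a - 1)%N by lia.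
have -> : (a.-1 + (v - a) = v.-1)%N by lia.
have -> : (a.-1 + 1 + (v - a) = v)%N by lia.
have -> : (b + (e - b) = e)%N by lia.
move=> E; rewrite /overlap_term /overlap_ratio /density mulrA -E mulfK //.
by rewrite mulf_neq0 // expf_neq0 ?gt_eqF ?p_gt0 ?natr_gt0.
Qed.

Lemma density_pow (a b n : nat) : (0 < n)%N -> (0 < a <= v)%N ->
  density a b n ^+ v.-1 = density v e n ^+ a.-1 / overlap_ratio a b n.
Proof.
move=> n0 /andP[a0 av].
have := @density_identity R n%:R (p n) (c n)%:R a.-1 (v - a) b e.
have -> : (a.-1 + 1 = a)%N by lia.
have -> : (a.-1 + (v - a) = v.-1)%N by lia.
have -> : (a + (v - a) = v)%N by lia.
move=> E; rewrite /overlap_ratio /density invf_div mulrA [_ ^+ a.-1 * _]mulrC -E mulfK //.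
by rewrite expf_neq0 // gt_eqF ?p_gt0.
Qed.

Lemma overlap_term_ge0 a b n : 0 <= overlap_term H n (c n) (p n) a b.
Proof. by rewrite /overlap_term !mulr_ge0 ?exprn_ge0 ?invr_ge0 ?exprn_ge0 // ltW ?p_gt0. Qed.

Lemma density_ge0 a b n : 0 <= density a b n.
Proof. by rewrite /density !mulr_ge0 ?exprn_ge0 ?invr_ge0 ?exprn_ge0 // ltW ?p_gt0. Qed.

Lemma overlap_ratio_ge0 a b n : 0 <= overlap_ratio a b n.
Proof. by rewrite /overlap_ratio !mulr_ge0 ?exprn_ge0 ?invr_ge0 ?mulr_ge0 ?exprn_ge0 // ltW ?p_gt0. Qed.

Lemma overlap_term_cvg0 (a b : nat) : (0 < a <= v)%N -> (b <= e)%N ->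
  overlap_ratio a b n @[n --> \oo] --> 0 ->
  overlap_term H n (c n) (p n) a b @[n --> \oo] --> 0.
Proof.
move=> av be h; apply: (@cvg_root0 _ _ v.-1); first by have := v_gt1; lia.
  by move=> n; exact: overlap_term_ge0.
apply: (@cvg_eventually _ 1 (fun n => density v e n ^+ (2 * v - a - 1) * overlap_ratio a b n)).
  by move=> n n0; rewrite overlap_term_pow.
rewrite -(mulr0 (Lam ^+ (2 * v - a - 1))); apply: cvgM => //.
by apply: cvg_expn; exact: density_full_cvg.
Qed.

Lemma meeting_error_cvg0 : meeting_error H n (c n) (p n) @[n --> \oo] --> 0.
Proof.
pose C := (2 * #|V| * #|{ffun bool * V -> bool * V}|)%N.
apply: (@cvg_squeeze0 _ 1 _ (fun n => C%:R * (density v e n ^+ 2 * n%:R^-1))).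
  move=> n n0; rewrite ger0_norm; last first.
    by apply: sumr_ge0 => s _; apply: sumr_ge0 => s' _; rewrite mulr_ge0 // expect_ge0.
  apply: le_trans (meeting_bound H V0 (p01 n) (c_gt0 n) n0) _.
  rewrite -/C /density -/v -/e -mulrA; apply: ler_wpM2l => //.
  have -> : (n%:R : R) ^+ (2 * v - 1) = (n%:R ^+ v) ^+ 2 * n%:R^-1.
    rewrite -exprM; have -> : (v * 2 = (2 * v - 1).+1)%N by have := v_gt1; lia.
    by rewrite exprSr mulfK // gt_eqF ?natr_gt0.
  rewrite -/v !exprMn.
  by move: (_ ^+ 2) (_ ^+ 2) (_ ^+ 2) (n%:R^-1) => x y z w; rewrite le_eqVlt; apply/orP; left; apply/eqP; ring.
rewrite -(mulr0 C%:R); apply: cvgM; first exact: cvg_cst.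
rewrite -(mulr0 (Lam ^+ 2)); apply: cvgM; last exact: cvg_natV.
by apply: cvg_expn; exact: density_full_cvg.
Qed.

Lemma overlap_error_cvg0 :
  (forall K, nonempty_subgraph H K -> (#|K.1| < v)%N ->
     overlap_ratio #|K.1| #|K.2| n @[n --> \oo] --> 0) ->
  overlap_error H n (c n) (p n) @[n --> \oo] --> 0.
Proof.
move=> h.
apply: (@cvg_squeeze0 _ 0 _ (fun n => \sum_(K : {set V} * {set {set V}} | nonempty_subgraph H K && (#|K.1| < #|V|)%N)
    #|{ffun bool * V -> bool * V}|%:R * overlap_term H n (c n) (p n) #|K.1| #|K.2|)).
  move=> n _; rewrite ger0_norm; last first.
    by apply: sumr_ge0 => s _; apply: sumr_ge0 => s' _; rewrite expect_ge0.
  exact: overlap_bound.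
apply: cvg_bigsum0 => K /andP[hK Kv].
rewrite -[X in _ --> X](mulr0 #|{ffun bool * V -> bool * V}|%:R); apply: cvgM; first exact: cvg_cst.
have [k0 kv ke] := card_subgraph hK.
by apply: overlap_term_cvg0; rewrite ?k0 //; exact: h.
Qed.

Lemma gamma_denom_nat K : nonempty_subgraph H K -> (e * #|K.1|.-1 <= #|K.2| * v.-1)%N ->
  gamma_denom R H K = (#|K.2| * v.-1 - e * #|K.1|.-1)%N%:R.
Proof.
move=> hK h; have [k0 kv ke] := card_subgraph hK.
rewrite natrB // !natrM /gamma_denom.
have q (m : nat) : (0 < m)%N -> m.-1%:R = m%:R - 1 :> R by case: m => // m _; rewrite -natr1 addrK.
by rewrite !q.
Qed.

Lemma n_pow_gamma (x : R) (d k n : nat) : x * d%:R = k%:R -> (n%:R `^ x) ^+ d = n%:R ^+ k :> R.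
Proof. by move=> h; rewrite -powR_mulrn ?powR_ge0 // -powRrM h powR_mulrn. Qed.

(** If the denominator in the definition of [gamma] is not positive, the ratio
    is at most a negative power of [n]; otherwise, calling [d] this
    denominator, the minimality of [gamma] bounds the ratio by [(n ^ (- gamma)
    / p) ^ d]. *)
Lemma overlap_ratio_sparse K : nonempty_subgraph H K -> (#|K.1| < v)%N ->
  much_smaller (fun n => n%:R `^ (- g)) p ->
  overlap_ratio #|K.1| #|K.2| n @[n --> \oo] --> 0.
Proof.
move=> hK Kv hg; have [k0 kv ke] := card_subgraph hK.
have nv : (0 < v - #|K.1|)%N by rewrite subn_gt0.
(* The sign of [gamma_denom], written without subtraction. *)
have [h|h] := leqP (#|K.2| * v.-1) (e * #|K.1|.-1).
  apply: (@cvg_squeeze0 _ 1 _ (fun n => n%:R ^- (v - #|K.1|))); last exact: cvg_natXV.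
  move=> n n0; rewrite ger0_norm ?overlap_ratio_ge0 // /overlap_ratio invfM mulrCA.
  rewrite -[leRHS]mulr1; apply: ler_wpM2l; first by rewrite invr_ge0 exprn_ge0.
  rewrite -(subnK h) exprD mulfK ?expf_neq0 ?gt_eqF ?p_gt0 //.
  by apply: exprn_ile1; rewrite ltW ?p_gt0 ?p_lt1.
set d := (#|K.2| * v.-1 - e * #|K.1|.-1)%N.
have d0 : (0 < d)%N by rewrite subn_gt0.
have gd : g * d%:R <= (v - #|K.1|)%N%:R.
  by rewrite [leRHS]natrB // -(gamma_denom_nat hK (ltnW h)); exact: gamma_denom_le.
apply: (@cvg_squeeze0 _ 1 _ (fun n => (n%:R `^ (- g) / p n) ^+ d)); last first.
  by have := cvg_expn (k := d) hg; rewrite expr0n gtn_eqF.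
move=> n n0; rewrite ger0_norm ?overlap_ratio_ge0 // /overlap_ratio.
have -> : (#|K.2| * v.-1 = d + e * #|K.1|.-1)%N by rewrite /d subnK // ltnW.
have P0 k : p n ^+ k != 0 by rewrite expf_neq0 // gt_eqF ?p_gt0.
rewrite exprD mulrA invfM mulrCA divff // mulr1 invfM expr_div_n; apply: ler_wpM2r.
  by rewrite invr_ge0 exprn_ge0 // ltW ?p_gt0.
rewrite -[leRHS]powR_mulrn ?powR_ge0 // -powRrM -[X in X^-1]powR_mulrn // -powRN.
by apply: ler_powR; [rewrite ler1n|rewrite mulNr lerN2].
Qed.

Lemma overlap_ratio_dense K q : nonempty_subgraph H K -> (#|K.1| < v)%N ->
  (forall n, p n = q) -> overlap_ratio #|K.1| #|K.2| n @[n --> \oo] --> 0.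
Proof.
move=> hK Kv hq; have nv : (0 < v - #|K.1|)%N by rewrite subn_gt0.
apply: (@cvg_eventually _ 0 (fun n => n%:R ^- (v - #|K.1|) * (q ^+ (e * #|K.1|.-1) / q ^+ (#|K.2| * v.-1)))).
  by move=> n _; rewrite /overlap_ratio hq invfM mulrCA.
rewrite -[X in _ --> X](mul0r (q ^+ (e * #|K.1|.-1) / q ^+ (#|K.2| * v.-1))).
by apply: cvgM; [exact: cvg_natXV|exact: cvg_cst].
Qed.

Let T n (w : colored_graph n (c n)) : nat := mono_count H w.1 w.2.
Definition mono_pmf n k : R := cg_prob (p n) (fun w : colored_graph n (c n) => T w == k).

Lemma mono_pmf_ge0 n k : 0 <= mono_pmf n k.
Proof. by apply: prob_ge0. Qed.

Lemma sum_mono_pmf n K : \sum_(k < K) mono_pmf n k = cg_prob (p n) (fun w : colored_graph n (c n) => (T w < K)%N).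
Proof.
under eq_bigr do rewrite /mono_pmf probE.
rewrite -expect_sum probE; apply: eq_expect => w.
have [TK|TK] := ltnP (T w) K.
  rewrite (bigD1 (Ordinal TK)) //= eqxx big1 ?addr0 // => i ni.
  by rewrite (_ : T w == i = false) //; apply: contraNF ni => /eqP h; apply/eqP/val_inj.
rewrite big1 // => i _; rewrite (_ : T w == i = false) //; apply/eqP => h.
by have := ltn_ord i; rewrite -h ltnNge TK.
Qed.

(** Markov inequality. *)
Lemma mono_pmf_tail n K : (0 < K)%N ->
  1 - \sum_(k < K) mono_pmf n k <= cg_expect (p n) (@Tmono R V H n (c n)) / K%:R.
Proof.
move=> K0; rewrite sum_mono_pmf probE -[X in X - _](@expect_cst R n (c n) (p n) (c_gt0 n) 1) -expectB mulrC -expectZ.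
apply: le_expect => // w; rewrite TmonoE -/(T w).
have [TK|TK] := ltnP (T w) K; first by rewrite subrr mulr_ge0 ?invr_ge0.
by rewrite subr0 mulrC ler_pdivlMr ?ltr0n // mul1r ler_nat.
Qed.

(** When partial overlaps are negligible, the law of the number of copies
    solves the Panjer recursion in the limit, and it is tight because its mean
    converges. *)
Lemma mono_pmf_cvg (rho a : nat -> R) :
  (forall K, nonempty_subgraph H K -> (#|K.1| < v)%N ->
     overlap_ratio #|K.1| #|K.2| n @[n --> \oo] --> 0) ->
  (forall j, multiplicity_rate H n (c n) (p n) j @[n --> \oo] --> rho j) ->
  0 < a 0%N -> (forall k, k%:R * a k = \sum_(j < k.+1) rho j * a (k - j)%N) ->
  \sum_(k < K) a k @[K --> \oo] --> (1 : R) ->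
  forall k, mono_pmf n k @[n --> \oo] --> a k.
Proof.
move=> hK hrate a0 arec asum.
have /cvg_seq_bounded[M [_ hM]] : cvgn (fun n => cg_expect (p n) (@Tmono R V H n (c n))).
  by apply/cvg_ex; exists lam.
apply: (@panjer_limit R mono_pmf (fun n => multiplicity_rate H n (c n) (p n))
  (fun n => #|sg_aut H|%:R^-1 * (overlap_error H n (c n) (p n) + meeting_error H n (c n) (p n)))
  rho a (M + 1)) => //.
- exact: mono_pmf_ge0.
- by move=> n K; rewrite sum_mono_pmf prob_le1.
- move=> n K K0; apply: le_trans (mono_pmf_tail n K0) _.
  rewrite ler_wpM2r ?invr_ge0 //; apply: le_trans (ler_norm _) _.
  by apply: hM => //; rewrite ltrDl.
- by move=> n k; exact: panjer_approx.
- rewrite -(mulr0 #|sg_aut H|%:R^-1); apply: cvgM; first exact: cvg_cst.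
  rewrite -[X in _ --> X]addr0; apply: cvgD; last exact: meeting_error_cvg0.
  exact: overlap_error_cvg0.
- move=> n; rewrite /multiplicity_rate big1 ?mulr0 // => K /andP[/ncopies_gt0 + /eqP h].
  by rewrite h.
Qed.

End Asymptotics.

(** * Laws on the natural numbers *)

Section NatLaw.
Context (R : realType) (d : measure_display) (Omega : measurableType d).
Variable (P : probability Omega R).
Implicit Types (W : {RV P >-> R}).

Definition nat_set : set R := range (fun k : nat => k%:R).

Lemma measurable_sub_nat (A : set R) : A `<=` nat_set -> measurable A.
Proof.
move=> AN; apply: countable_measurable; first exact: measurable_set1.
apply/countable_injP; exists (@Num.truncn R) => x y /set_mem /AN[k _ <-] /set_mem /AN[l _ <-].
by rewrite !natrK => ->.
Qed.

Lemma measurable_nat_set : measurable nat_set.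
Proof. exact: measurable_sub_nat. Qed.

Lemma measurable_preimage W (A : set R) : measurable A -> measurable (W @^-1` A).
Proof. by move=> mA; rewrite -[_ @^-1` _]setTI; exact: measurable_funPT. Qed.

Definition nat_valued W := P (W @^-1` (~` nat_set)) = 0%E.

Definition law_pmf W k : R := fine (P (W @^-1` [set k%:R])).

Lemma law_pmfE W k : P (W @^-1` [set k%:R]) = (law_pmf W k)%:E.
Proof. by rewrite fineK // fin_num_measure //; exact: measurable_preimage. Qed.

Lemma measure_eq_mod_null (G A B : set Omega) : measurable G -> measurable A -> measurable B ->
  P (~` G) = 0%E -> A `&` G = B `&` G -> P A = P B.
Proof.
move=> mG mA mB G0 AB.
have h C : measurable C -> P C = P (C `&` G).
  move=> mC; rewrite (measureDI P mC mG) [X in (X + _)%E](_ : _ = 0%E) ?add0e //.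
  apply: (subset_measure0 _ _ _ G0); first exact: measurableD.
    exact: measurableC.
  by move=> x [].
by rewrite h // AB -h.
Qed.

Lemma prob_initial W K :
  P (W @^-1` [set y | exists2 k : nat, (k < K)%N & y = k%:R]) = (\sum_(k < K) law_pmf W k)%:E.
Proof.
elim: K => [|K IH].
  rewrite big_ord0 (_ : [set y | _] = set0) ?preimage_set0 ?measure0 //.
  by apply/seteqP; split => // y [].
rewrite big_ord_recr /= EFinD -IH -law_pmfE -measureU.
- rewrite -preimage_setU; congr (P (_ @^-1` _)); apply/seteqP; split => y /=.
    move=> [k]; rewrite ltnS leq_eqVlt => /orP[/eqP-> ->|kK ->]; first by right.
    by left; exists k.
  by move=> [[k kK ->]|->]; [exists k => //; exact: ltnW|exists K].
- by apply: measurable_preimage; apply: measurable_sub_nat => y [k _ ->]; exists k.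
- by apply: measurable_preimage; exact: measurable_set1.
- apply/seteqP; split => // w /= [[k kK ->]] /eqP; rewrite eqr_nat => /eqP kE.
  by rewrite kE ltnn in kK.
Qed.

Lemma nat_le_bound (x : R) : exists K : nat, forall m : nat, (m%:R <= x) = (m < K)%N.
Proof.
have [x0|x0] := ltP x 0.
  by exists 0%N => m; rewrite ltn0; apply/negbTE; rewrite -ltNge; apply: lt_le_trans x0 _.
by exists (Num.truncn x).+1 => m; rewrite ltnS truncn_ge_nat.
Qed.

Lemma cdf_nat_valued W (x : R) K : nat_valued W -> (forall m : nat, (m%:R <= x) = (m < K)%N) ->
  cdf W x = (\sum_(k < K) law_pmf W k)%:E.
Proof.
move=> W0 hK; rewrite -prob_initial /cdf /distribution /pushforward.
have mI : measurable [set y : R | exists2 k : nat, (k < K)%N & y = k%:R].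
  by apply: measurable_sub_nat => y [k _ ->]; exists k.
apply: (@measure_eq_mod_null (W @^-1` nat_set)) => //.
- exact: measurable_preimage measurable_nat_set.
- exact: measurable_preimage.
- exact: measurable_preimage.
- apply/seteqP; split => w /= [h [k _ kE]]; split; try (by exists k).
    by exists k; rewrite -?kE // -hK kE; move: h; rewrite in_itv.
  by rewrite in_itv /= -kE hK; case: h => k' k'K; rewrite -kE => /eqP; rewrite eqr_nat => /eqP ->.
Qed.

(** The partial sums are values of the distribution function. *)
Lemma law_pmf_sum_cvg W : nat_valued W -> \sum_(k < K) law_pmf W k @[K --> \oo] --> (1 : R).
Proof.
move=> W0; rewrite -cvg_shiftS /=.
have h : cdf W n%:R @[n --> \oo] --> 1%E.
  exact: (cvg_comp _ _ (@cvgr_idn R) (@cvg_cdfy1 _ _ _ _ W)).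
apply: cvg_trans (fine_cvg h); apply: near_eq_cvg; near=> n.
by rewrite /= (@cdf_nat_valued _ _ n.+1) // => m; rewrite ler_nat ltnS.
Unshelve. all: by end_near. Qed.

End NatLaw.

(** * Poisson and compound Poisson laws *)

Section PoissonLaw.
Variable R : realType.

Definition pois (mu : R) k : R := mu ^+ k / k`!%:R * expR (- mu).

Lemma pois0_gt0 mu : 0 < pois mu 0.
Proof. by rewrite /pois expr0 fact0 divr1 mul1r expR_gt0. Qed.

Lemma pois_rec mu k : k.+1%:R * pois mu k.+1 = mu * pois mu k.
Proof.
rewrite /pois factS natrM exprS.
have k0 : k.+1%:R != 0 :> R by rewrite pnatr_eq0.
have f0 : k`!%:R != 0 :> R by rewrite pnatr_eq0 -lt0n fact_gt0.
by move: k0 f0; move: (k.+1%:R : R) (k`!%:R : R) => x y x0 y0; field; rewrite x0 y0.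
Qed.

Lemma poisson_atom mu k : 0 <= mu -> poisson_prob mu 0 [set k] = (pois mu k)%:E.
Proof.
move=> mu0; rewrite /poisson_prob; case: ifP => [mu1|/negbT].
  by rewrite esum_set1 ?lee_fin ?poisson_pmf_ge0 // /poisson_pmf mu1.
rewrite -leNgt => mu1; have -> : mu = 0 by apply/eqP; rewrite eq_le mu1.
rewrite diracE /pois oppr0 expR0 mulr1 expr0n; case: k => [|k] /=.
  by rewrite mem_set // fact0 divr1.
by rewrite mul0r memNset.
Qed.

Lemma is_poisson_law (d : measure_display) (Omega : measurableType d)
    (P : probability Omega R) (W : {RV P >-> R}) mu : 0 <= mu -> is_poisson mu W ->
  nat_valued W /\ forall k, law_pmf W k = pois mu k.
Proof.
move=> mu0 hW; split.
  rewrite /nat_valued -[LHS]/(distribution P W _) hW; last by apply: measurableC; exact: measurable_nat_set.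
  rewrite /distribution /pushforward (_ : _ @^-1` _ = set0) ?measure0 //.
  by apply/seteqP; split => // k /=; apply; exists k.
move=> k; apply: EFin_inj; rewrite -law_pmfE -[LHS]/(distribution P W _) hW; last exact: measurable_set1.
rewrite /distribution /pushforward -poisson_atom //; congr (poisson_prob _ _ _).
by apply/seteqP; split => j /=; [move=> /eqP; rewrite eqr_nat => /eqP|move=> ->].
Qed.

Lemma poisson_rv_is_poisson mu : is_poisson mu (poisson_rv (mu : R)).
Proof. by []. Qed.

End PoissonLaw.

Section CompoundPoisson.
Context (R : realType) (d : measure_display) (Omega : measurableType d).
Variables (P : probability Omega R) (I : finType) (S : {set I}) (X : I -> {RV P >-> R}).
Variables (rate : I -> R) (N : I -> nat).
Hypothesis rate_ge0 : forall i, i \in S -> 0 <= rate i.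
Hypothesis N_gt0 : forall i, i \in S -> (0 < N i)%N.
Hypothesis indep : mutually_independent S X.
Hypothesis X_poisson : forall i, i \in S -> is_poisson (rate i) (X i).

Let W : {RV P >-> R} := \sum_(i in S) X i *+ N i.

Lemma compoundE w : W w = \sum_(i in S) X i w * (N i)%:R.
Proof. by rewrite /W mfun_sum; apply: eq_bigr => i _; rewrite mfunMn mulr_natr. Qed.

Let G : set Omega := \bigcap_(i in [set` S]) (X i @^-1` @nat_set R).

Lemma measurable_naturals : measurable G.
Proof.
apply: fin_bigcap_measurable => // i _.
by apply: measurable_preimage; exact: measurable_nat_set.
Qed.

Lemma prod_EFin (J : {set I}) (f : I -> \bar R) (g : I -> R) :
  (forall i, i \in J -> f i = (g i)%:E) -> (\prod_(i in J) f i)%E = (\prod_(i in J) g i)%:E.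
Proof.
move=> h; apply: (big_ind2 (fun (x : \bar R) (y : R) => x = y%:E)) => //.
by move=> x x' y y' -> ->; rewrite EFinM.
Qed.

Lemma prob_naturals : P (~` G) = 0%E.
Proof.
rewrite probability_setC; last exact: measurable_naturals.
rewrite /G (@indep S (fun=> @nat_set R)) //; last by move=> i; exact: measurable_nat_set.
rewrite (@prod_EFin _ _ (fun=> 1)); first by rewrite big1_eq subee.
move=> i iS; have [h _] := is_poisson_law (rate_ge0 iS) (X_poisson iS).
have mN : measurable (X i @^-1` @nat_set R).
  by apply: measurable_preimage; exact: measurable_nat_set.
have e : P (~` (X i @^-1` @nat_set R)) = 0%E := h.
have := probability_setC P mN; rewrite e => /esym/eqP.
by rewrite -(fineK (fin_num_measure P _ mN)) -EFinB eqe subr_eq0 => /eqP <-.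
Qed.

Lemma compound_nat_valued : nat_valued W.
Proof.
apply: (subset_measure0 _ _ _ prob_naturals).
- by apply: measurable_preimage; apply: measurableC; exact: measurable_nat_set.
- by apply: measurableC; exact: measurable_naturals.
move=> w /= nW Gw; apply: nW; rewrite compoundE.
exists (\sum_(i in S) Num.truncn (X i w) * N i)%N => //.
rewrite natr_sum; apply: eq_bigr => i iS; rewrite natrM; congr (_ * _).
by have [k _ <-] := Gw i iS; rewrite natrK.
Qed.

Lemma measure_disjoint_union (J : eqType) (r : seq J) (F : J -> set Omega) : uniq r ->
  (forall j, measurable (F j)) ->
  (forall i j, i \in r -> j \in r -> i != j -> F i `&` F j = set0) ->
  P (\big[setU/set0]_(j <- r) F j) = (\sum_(j <- r) P (F j))%E.
Proof.
move=> + mF; elim: r => [|j r IH] /= ; first by rewrite !big_nil measure0.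
move=> /andP[jr ur] dis; rewrite !big_cons measureU //.
- congr (_ + _)%E; apply: IH => // i i' ir i'r; apply: dis; by rewrite inE ?ir ?i'r orbT.
- by apply: bigsetU_measurable.
rewrite big_distrr /= big1_seq // => i /andP[_ ir]; apply: dis; rewrite ?inE ?eqxx ?ir ?orbT //.
by apply: contraNneq jr => ->.
Qed.

Definition tuple_weight K (m : {ffun I -> 'I_K.+1}) : nat := (\sum_(i in S) N i * m i)%N.

(** The multiplicities being positive, no variable exceeds [K] when [W = k];
    the event is then a finite disjoint union, and independence applies to
    each part. *)
Lemma compound_pmf_sum k K : (k <= K)%N -> law_pmf W k =
  \sum_(m : {ffun I -> 'I_K.+1} |
      (m \in pfamily ord0 (mem S) (fun=> predT)) && (tuple_weight m == k))
     \prod_(i in S) pois (rate i) (m i).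
Proof.
move=> kK; apply: EFin_inj; rewrite -law_pmfE.
pose Q (m : {ffun I -> 'I_K.+1}) := (m \in pfamily ord0 (mem S) (fun=> predT)) && (tuple_weight m == k).
pose B (m : {ffun I -> 'I_K.+1}) := \bigcap_(i in [set` S]) (X i @^-1` [set (m i)%:R : R]).
have mB m : measurable (B m) by apply: fin_bigcap_measurable => // i _.
have PB m : P (B m) = (\prod_(i in S) pois (rate i) (m i))%:E.
  rewrite /B (@indep S (fun i => [set (m i)%:R : R])) //.
  apply: prod_EFin => // i iS; have [_ h] := is_poisson_law (rate_ge0 iS) (X_poisson iS).
  by rewrite law_pmfE h.
transitivity (P (\big[setU/set0]_(m <- enum Q) B m)); last first.
  rewrite measure_disjoint_union ?enum_uniq // => [|m m' mQ m'Q mm'].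
    by rewrite big_enum /= -sumEFin; apply: eq_bigr => m _; exact: PB.
  apply/seteqP; split => // w [Bm Bm']; case/eqP: mm'.
  apply/ffunP => i; have [iS|iS] := boolP (i \in S).
    apply/val_inj/eqP; rewrite -(eqr_nat R); apply/eqP.
    by rewrite -(Bm i iS) -(Bm' i iS).
  move: mQ m'Q; rewrite !mem_enum => /andP[/pfamilyP[/fintype.subsetP h _] _] /andP[/pfamilyP[/fintype.subsetP h' _] _].
  have := contra (h i) iS; have := contra (h' i) iS; rewrite !supportE !negbK.
  by move=> /eqP -> /eqP ->.
apply: (measure_eq_mod_null measurable_naturals).
- by apply: measurable_preimage; exact: measurable_set1.
- exact: bigsetU_measurable.
- exact: prob_naturals.
rewrite -bigcup_seq; apply/seteqP; split => w [h Gw]; split => //.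
  have tE i : i \in S -> X i w = (Num.truncn (X i w))%:R.
    by move=> iS; have [l _ <-] := Gw i iS; rewrite natrK.
  have Wk : (\sum_(i in S) N i * Num.truncn (X i w))%N = k.
    apply/eqP; rewrite -(eqr_nat R) -h compoundE natr_sum; apply/eqP; apply: eq_bigr => i iS.
    by rewrite natrM mulrC -tE.
  have tk i : i \in S -> (Num.truncn (X i w) < K.+1)%N.
    move=> iS; rewrite ltnS; apply: leq_trans kK; rewrite -Wk (bigD1 i) //=.
    by apply: leq_trans (leq_addr _ _); rewrite leq_pmull // N_gt0.
  pose m := [ffun i => if i \in S then inord (Num.truncn (X i w)) else ord0] : {ffun I -> 'I_K.+1}.
  have mE i : i \in S -> m i = Num.truncn (X i w) :> nat.
    by move=> iS; rewrite ffunE iS inordK // tk.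
  exists m; last by move=> i iS /=; rewrite mE // -tE.
  rewrite /= mem_enum; apply/andP; split; last first.
    by rewrite /tuple_weight -[X in _ == X]Wk; apply/eqP; apply: eq_bigr => i iS; rewrite mE.
  apply/pfamilyP; split => //; apply/fintype.subsetP => i; rewrite supportE ffunE.
  by case: ifP => //; rewrite eqxx.
case: h => m; rewrite /= mem_enum => /andP[_ /eqP <-] Bm; rewrite compoundE /tuple_weight natr_sum.
by apply: eq_bigr => i iS; rewrite natrM mulrC (Bm i iS).
Qed.

Definition gen_poly K i : {poly R} := \sum_(j < K.+1) pois (rate i) j *: 'X^(N i * j).

Lemma compound_pmf_coef k K : (k <= K)%N -> law_pmf W k = (\prod_(i in S) gen_poly K i)`_k.
Proof.
move=> kK; rewrite (compound_pmf_sum kK) (big_distr_big_dep ord0) /= coef_sum.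
rewrite big_mkcondr /=; apply: eq_bigr => m _; have -> : \prod_(i in S) (pois (rate i) (m i) *: 'X^(N i * m i)) =
  (\prod_(i in S) pois (rate i) (m i)) *: 'X^(tuple_weight m) by rewrite scaler_prod prodrXr.
rewrite coefZ coefXn eq_sym.
by case: ifP; rewrite ?mulr1 ?mulr0.
Qed.

(** A factor truncates [exp (r (x ^ N - 1))] and thus solves [x Q' = r N x ^ N
    Q] up to high order terms; logarithmic derivatives add up in products. *)
Lemma gen_poly_deriv K : exists r : {poly R},
  'X * (\prod_(i in S) gen_poly K i)^`() =
  (\sum_(i in S) (rate i * (N i)%:R) *: 'X^(N i)) * \prod_(i in S) gen_poly K i + 'X^(K.+1) * r.
Proof.
apply: (big_ind2 (fun Q c : {poly R} => exists r : {poly R}, 'X * Q^`() = c * Q + 'X^(K.+1) * r)).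
- by exists 0; rewrite derivC !mulr0 mul0r addr0.
- move=> Q c Q' c' [r h] [r' h']; exists (r * Q' + Q * r').
  rewrite derivM mulrDr mulrA h mulrCA h'; ring.
move=> i iS; exists (- (rate i * (N i)%:R * pois (rate i) K) *: 'X^(N i * K.+1 - K.+1)).
have NK : (K.+1 <= N i * K.+1)%N by rewrite leq_pmull // N_gt0.
rewrite -scalerAr -exprD subnKC // /gen_poly raddf_sum mulr_sumr.
have E (j : nat) : 'X * (pois (rate i) j *: 'X^(N i * j))^`() = ((N i * j)%N%:R * pois (rate i) j) *: 'X^(N i * j) :> {poly R}.
  rewrite derivZ derivXn -scalerAr mulrnAr.
  case: (N i * j)%N => [|l]; first by rewrite !mulr0n scaler0 mul0r scale0r.
  by rewrite -exprS -scaler_nat scalerA mulrC.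
under eq_bigr do rewrite E.
rewrite big_ord_recl muln0 mul0r scale0r add0r.
rewrite big_ord_recr /= mulrDr -addrA.
rewrite [X in _ + (X + _)](_ : _ = (rate i * (N i)%:R * pois (rate i) K) *: 'X^(N i * K.+1)); last first.
  by rewrite mulnS exprD -scalerAl -scalerAr scalerA.
rewrite scaleNr subrr addr0 mulr_sumr; apply: eq_bigr => j _.
have -> : (rate i * (N i)%:R) *: 'X^(N i) * (pois (rate i) j *: 'X^(N i * j)) =
   (rate i * (N i)%:R * pois (rate i) j) *: 'X^(N i * j.+1).
  by rewrite mulnS exprD -scalerAl -scalerAr scalerA.
rewrite /bump add1n; congr (_ *: _).
rewrite natrM -mulrA pois_rec; ring.
Qed.

Lemma coefX_deriv (Q : {poly R}) k : ('X * Q^`())`_k = k%:R * Q`_k.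
Proof. by rewrite coefXM coef_deriv; case: k => [|k]; rewrite ?mul0r // mulr_natl. Qed.

(** Compare coefficients in the differential equation of the generating
    function: this is the Panjer recursion of a compound Poisson law. *)
Lemma compound_rec k : k%:R * law_pmf W k =
  \sum_(i in S) rate i * (N i)%:R * (if (k < N i)%N then 0 else law_pmf W (k - N i)%N).
Proof.
rewrite (compound_pmf_coef (leqnn k)).
set Q := \prod_(i in S) _.
have [r h] := gen_poly_deriv k.
rewrite -coefX_deriv h coefD coefXnM ltnSn addr0 mulr_suml coef_sum; apply: eq_bigr => i _.
rewrite -scalerAl coefZ coefXnM; congr (_ * _); case: ifP => // _.
by rewrite (@compound_pmf_coef _ k) // leq_subr.
Qed.

Lemma compound_pmf0_gt0 : 0 < law_pmf W 0.
Proof.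
rewrite (compound_pmf_coef (leqnn 0)).
have -> : \prod_(i in S) gen_poly 0 i = (\prod_(i in S) pois (rate i) 0)%:P.
  rewrite rmorph_prod; apply: eq_bigr => i _.
  by rewrite /gen_poly big_ord1 muln0 expr0 alg_polyC.
by rewrite coefC eqxx; apply: prodr_gt0 => i _; exact: pois0_gt0.
Qed.

End CompoundPoisson.

(** * Limits away from the threshold *)

Section Subgraph.
Variables (V : finType) (A : {set V}) (B : {set {set V}}).
Hypothesis B2 : forall e, e \in B -> #|e| = 2%N.
Hypothesis BA : forall e, e \in B -> e \subset A.

Let VA : finType := {x : V | x \in A}.

Definition trace_edge (e : {set V}) : {set VA} := [set x | val x \in e]%SET.

Lemma val_trace_edge (e : {set V}) : e \subset A -> [set val x | x in trace_edge e]%SET = e.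
Proof.
move=> /fintype.subsetP eA; apply/finset.setP => y; apply/finset.imsetP/idP => [[x + ->]|ye].
  by rewrite inE.
by exists (exist _ y (eA y ye)); rewrite ?inE.
Qed.

Lemma card_trace_edge (e : {set V}) : e \subset A -> #|trace_edge e| = #|e|.
Proof. by move=> /val_trace_edge h; rewrite -[in RHS]h card_imset //; exact: val_inj. Qed.

Fact trace_graph_subproof :
  [forall e in [set trace_edge e | e in B]%SET, #|e| == 2%N].
Proof.
apply/forallP => e; apply/implyP => /finset.imsetP[e' e'B ->].
by rewrite card_trace_edge ?BA // B2.
Qed.

Definition trace_graph : sgraph VA := SGraph trace_graph_subproof.

Lemma card_trace_graph : #|edges trace_graph| = #|B|.
Proof.
rewrite card_in_imset // => e e' eB e'B h.
by rewrite -(val_trace_edge (BA eB)) h val_trace_edge ?BA.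
Qed.

Lemma trace_embedding (H : sgraph V) (U C : finType) (G : sgraph U) (X : {ffun U -> C}) s :
  B \subset edges H -> mono_embedding H G X s ->
  mono_embedding trace_graph G X [ffun x : VA => s (val x)].
Proof.
move=> /fintype.subsetP BH /and3P[/injectiveP si /forallP sH /forallP sX]; apply/and3P; split.
- by apply/injectiveP => x y; rewrite !ffunE => /si/val_inj.
- apply/forallP => e; apply/implyP => /finset.imsetP[e' e'B ->].
  have -> : [ffun x => s (val x)] @: trace_edge e' = s @: e'; last first.
    by have := sH e'; rewrite BH.
  rewrite -[in RHS](val_trace_edge (BA e'B)) -imset_comp.
  by apply: eq_imset => x; rewrite ffunE.
- apply/forallP => x; apply/forallP => y; rewrite !ffunE.
  by have /forallP := sX (val x).
Qed.

End Subgraph.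

Section MainParts.
Variables (R : realType) (V : finType) (H : sgraph V).
Variables (p : nat -> R) (c : nat -> nat) (lam : R).
Hypothesis V0 : (0 < #|V|)%N.
Hypothesis unbalanced : ~ balanced R H.
Hypothesis p01 : forall n, 0 < p n < 1.
Hypothesis c_gt0 : forall n, (0 < c n)%N.
Hypothesis mean_cvg : cg_expect (p n) (@Tmono R V H n (c n)) @[n --> \oo] --> lam.

Let v := #|V|.
Let e := #|edges H|.
Let g := gamma R H.

(** First moment bound: a copy of [H] contains a copy of each of its
    subgraphs. *)
Lemma prob_copy_le_density K n (eps : R) : nonempty_subgraph H K -> 0 < eps ->
  cg_prob (p n) (fun w : colored_graph n (c n) => eps < `|Tmono R H w - 0|) <=
  density p c #|K.1| #|K.2| n.
Proof.
move=> hK eps0; have [k0 kv ke] := card_subgraph hK.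
case: K hK k0 kv ke => A B /= /and3P[/= _ BH /forallP BA'] k0 kv ke.
have B2 e' : e' \in B -> #|e'| = 2%N by move=> /(fintype.subsetP BH)/edge_card2.
have BA e' : e' \in B -> e' \subset A by move=> eB; have := BA' e'; rewrite eB.
pose VA : finType := {x : V | x \in A}.
pose K := trace_graph B2 BA.
have cVA : #|VA| = #|A| by rewrite card_sig.
have VA0 : (0 < #|VA|)%N by rewrite cVA.
rewrite probE.
apply: (@le_trans _ _ (cg_expect (p n) (fun w : colored_graph n (c n) =>
   \sum_(t : {ffun VA -> 'I_n}) (mono_embedding K w.1 w.2 t)%:R))).
  apply: le_expect => // w; case: ltP => // h; last by apply: sumr_ge0.
  have : (0 < #|[set s | mono_embedding H w.1 w.2 s]%SET|)%N.
    rewrite mono_countE muln_gt0 sg_aut_gt0 andbT lt0n; apply: contraTneq h => h0.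
    by rewrite TmonoE h0 subrr normr0 -leNgt ltW.
  move=> /card_gt0P[s]; rewrite inE => /(trace_embedding B2 BA BH) ht.
  by rewrite (bigD1 _ (erefl : xpredT [ffun x : VA => s (val x)])) /= ht lerDl sumr_ge0.
rewrite expect_sum.
apply: (@le_trans _ _ (\sum_(t : {ffun VA -> 'I_n}) (p n ^+ #|edges K| * (c n)%:R ^- #|VA|.-1))).
  by apply: ler_sum => t _; have /andP[] := prob_embedding_le K VA0 (p01 n) (c_gt0 n) t.
rewrite sumr_const card_ffun card_ord cVA card_trace_graph -[leLHS]mulr_natl natrX /density mulrA.
by [].
Qed.

(** As [K] attains the minimum, the powers of [n] and [p] combine into a power
    of [n ^ gamma * p]. *)
Lemma overlap_ratio_minimizer K n : (0 < n)%N -> nonempty_subgraph H K -> 0 < gamma_denom R H K ->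
  g * gamma_denom R H K = v%:R - #|K.1|%:R ->
  (overlap_ratio H p #|K.1| #|K.2| n)^-1 =
  (n%:R `^ g * p n) ^+ (#|K.2| * v.-1 - e * #|K.1|.-1).
Proof.
move=> n0 hK DK gD; have [k0 kv ke] := card_subgraph hK.
have [h|/ltnW h] := leqP (#|K.2| * v.-1) (e * #|K.1|.-1).
  have q (m : nat) : (0 < m)%N -> m%:R - 1 = m.-1%:R :> R by case: m => // m _; rewrite -natr1 addrK.
  by move: DK; rewrite /gamma_denom !q // -!natrM subr_gt0 ltr_nat ltnNge h.
rewrite exprMn (@n_pow_gamma _ _ _ (v - #|K.1|)); last first.
  by rewrite [RHS]natrB // -gD (gamma_denom_nat _ V0 hK h).
rewrite /overlap_ratio invf_div -/v -/e -[in p n ^+ (#|K.2| * v.-1)](subnK h) exprD mulrA mulfK //.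
by rewrite expf_neq0 // gt_eqF //; case/andP: (p01 n).
Qed.

Lemma minimizer_density_pow K n : (0 < n)%N -> nonempty_subgraph H K -> 0 < gamma_denom R H K ->
  g * gamma_denom R H K = v%:R - #|K.1|%:R ->
  density p c #|K.1| #|K.2| n ^+ v.-1 =
  density p c v e n ^+ #|K.1|.-1 * (n%:R `^ g * p n) ^+ (#|K.2| * v.-1 - e * #|K.1|.-1).
Proof.
move=> n0 hK DK gD; have [k0 kv ke] := card_subgraph hK.
by rewrite (density_pow H c V0 p01) ?k0 // overlap_ratio_minimizer.
Qed.

Lemma minimizer_exponent_gt0 K : nonempty_subgraph H K -> 0 < gamma_denom R H K ->
  (0 < #|K.2| * v.-1 - e * #|K.1|.-1)%N.
Proof.
move=> hK DK; have [k0 kv ke] := card_subgraph hK.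
rewrite subn_gt0 ltnNge; apply: contraTN DK => h.
have q (m : nat) : (0 < m)%N -> m%:R - 1 = m.-1%:R :> R by case: m => // m _; rewrite -natr1 addrK.
by rewrite /gamma_denom !q // -!natrM -leNgt subr_le0 ler_nat.
Qed.

(** The expected number of copies of a minimizer tends to [0], although that
    of [H] does not. *)
Lemma below_threshold : much_smaller p (fun n => n%:R `^ (- g)) ->
  cvg_in_probability p (fun n => @Tmono R V H n (c n)) 0.
Proof.
move=> hp eps eps0; have [K [hK Kv DK gD]] := gamma_attained V0 unbalanced.
have v1 : (0 < v.-1)%N by have := v_gt1 V0 unbalanced; rewrite /v; lia.
apply: (@cvg_squeeze0 _ 0 _ (density p c #|K.1| #|K.2|)).
  by move=> n _; rewrite ger0_norm ?prob_ge0 //; exact: prob_copy_le_density.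
apply: (cvg_root0 v1) => [n|]; first exact: density_ge0.
apply: (@cvg_eventually _ 1 (fun n => density p c v e n ^+ #|K.1|.-1 *
    (n%:R `^ g * p n) ^+ (#|K.2| * v.-1 - e * #|K.1|.-1))).
  by move=> n n0; rewrite minimizer_density_pow.
rewrite -(mulr0 ((lam * #|sg_aut H|%:R) ^+ #|K.1|.-1)); apply: cvgM.
  by apply: cvg_expn; exact: (density_full_cvg V0 c_gt0 mean_cvg).
have h : n%:R `^ g * p n @[n --> \oo] --> 0.
  apply: (@cvg_eventually _ 0 _ _ _ _ hp) => n _.
  by rewrite powRN invrK mulrC.
by have := cvg_expn (k := #|K.2| * v.-1 - e * #|K.1|.-1) h; rewrite expr0n gtn_eqF // minimizer_exponent_gt0.
Qed.

Lemma cvg_in_distribution_nat (d : measure_display) (Omega : measurableType d)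
    (P : probability Omega R) (W : {RV P >-> R}) : nat_valued W ->
  (forall k, mono_pmf H p c n k @[n --> \oo] --> law_pmf W k) ->
  cvg_in_distribution p (fun n => @Tmono R V H n (c n)) W.
Proof.
move=> W0 h x _; have [K hK] := nat_le_bound x; rewrite (cdf_nat_valued W0 hK).
apply: cvg_EFin; first by near=> n.
apply: (@cvg_eventually _ 0 (fun n => \sum_(k < K) mono_pmf H p c n k)).
  move=> n _ /=; rewrite sum_mono_pmf; apply: eq_bigl => w.
  by rewrite TmonoE hK.
by apply: cvg_bigsum => k _.
Unshelve. all: by end_near. Qed.

(** A vertex set carrying a copy of [H] and one more edge costs an additional
    factor [p n]. *)
Lemma rate_sparse j : much_smaller p (fun=> 1) ->
  multiplicity_rate H n (c n) (p n) j @[n --> \oo] --> lam * (j == 1%N)%:R.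
Proof.
move=> hp; apply: cvgM => //.
have p0 : p n @[n --> \oo] --> 0 by apply: (@cvg_eventually _ 0 _ _ _ _ hp) => n _; rewrite divr1.
have -> : (j == 1%N)%:R = \sum_(K : sgraph V | (edges H \subset edges K) && (ncopies H K == j)) (K == H)%:R :> R.
  have [j1|j1] := eqVneq j 1%N.
    rewrite (bigD1 H) /= ?fintype.subxx ?ncopies_self ?j1 // eqxx big1 ?addr0 // => K /andP[_ /negbTE ->] //.
  by rewrite big1 // => K /andP[_ /eqP Kj]; case: eqP => // KH; rewrite -Kj KH ncopies_self eqxx in j1.
apply: cvg_bigsum => K /andP[HK _].
have p1 : (1 - p n) ^+ ('C(#|V|, 2) - #|edges K|) @[n --> \oo] --> (1 : R).
  rewrite -[X in _ --> X](expr1n _ ('C(#|V|, 2) - #|edges K|)); apply: cvg_expn.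
  by rewrite -[X in _ --> X]subr0; apply: cvgB => //; exact: cvg_cst.
rewrite -[X in _ --> X]mulr1; apply: cvgM => //.
have := cvg_expn (k := #|edges K| - #|edges H|) p0; rewrite expr0n subn_eq0.
suff -> : (#|edges K| <= #|edges H|)%N = (K == H) by [].
apply/idP/eqP => [h|->//]; apply: edgesI; apply/eqP.
by rewrite eq_sym eqEcard HK h.
Qed.

Hypothesis lam_gt0 : 0 < lam.

(** Overlaps vanish and only multiplicity one survives: the Panjer recursion
    becomes that of the Poisson law. *)
Lemma poisson_regime : much_smaller (fun n => n%:R `^ (- g)) p -> much_smaller p (fun=> 1) ->
  cvg_in_distribution p (fun n => @Tmono R V H n (c n)) (poisson_rv lam).
Proof.
move=> hg hp; have [W0 Wk] := is_poisson_law (ltW lam_gt0) (@poisson_rv_is_poisson R lam).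
apply: cvg_in_distribution_nat => // k.
apply: (@mono_pmf_cvg _ _ _ _ _ lam V0 unbalanced p01 c_gt0 mean_cvg (fun j => lam * (j == 1%N)%:R) (law_pmf (poisson_rv lam))).
- by move=> K hK Kv; exact: (overlap_ratio_sparse V0 unbalanced).
- by move=> j; exact: rate_sparse.
- by rewrite Wk pois0_gt0.
- case=> [|l]; first by rewrite mul0r big_ord1 /= mulr0 mul0r.
  rewrite Wk pois_rec !big_ord_recl /= mulr0 mul0r add0r mulr1 subn1 Wk big1 ?addr0 // => i _.
  by rewrite mul0r.
- exact: law_pmf_sum_cvg.
Qed.

Lemma multiplicity_classes q j :
  lam * \sum_(K : sgraph V | (edges H \subset edges K) && (ncopies H K == j)) supergraph_mass H q K =
  \sum_(F in supergraph_classes H) (ncopies H F == j)%:R * ((ncopies H F)%:R * supergraph_rate H F lam q).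
Proof.
pose gm (K : sgraph V) : R := (ncopies H K == j)%:R * supergraph_mass H q K.
rewrite big_mkcondr /= (eq_bigr gm); last first.
  by move=> K _; rewrite /gm; case: (_ == j); rewrite ?mul1r ?mul0r.
rewrite sum_supergraph_classes; last first.
  by move=> s F; rewrite /gm /supergraph_mass ncopies_relabel card_relabel.
rewrite mulr_sumr; apply: eq_bigr => F _; rewrite /gm /supergraph_mass /supergraph_rate.
by move: (_ / _) (_ ^+ _) (_ ^+ _) => x y z; ring.
Qed.

(** The induced graph on a monochromatic vertex set is now random, and a class
    [F] of such graphs contributes [ncopies H F] copies at a time: the
    limiting recursion is that of a compound Poisson law. *)
Lemma dense_regime q : (forall n, p n = q) ->
  forall (d : measure_display) (Omega : measurableType d)
    (P : probability Omega R) (X : sgraph V -> {RV P >-> R}),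
  mutually_independent (supergraph_classes H) X ->
  (forall F, F \in supergraph_classes H -> is_poisson (supergraph_rate H F lam q) (X F)) ->
  cvg_in_distribution p (fun n => @Tmono R V H n (c n))
    (\sum_(F in supergraph_classes H) X F *+ ncopies H F : {RV P >-> R}).
Proof.
move=> hq d Omega P X ind pX.
have q01 : 0 < q < 1 by rewrite -(hq 0%N).
have rate_ge0 F : F \in supergraph_classes H -> 0 <= supergraph_rate H F lam q.
  move=> _; case/andP: q01 => q0 q1; rewrite /supergraph_rate !mulr_ge0 ?invr_ge0 ?exprn_ge0 ?subr_ge0 // ltW //.
have N0 F : F \in supergraph_classes H -> (0 < ncopies H F)%N by exact: supergraph_classes_gt0.
have W0 := compound_nat_valued (ncopies H) rate_ge0 ind pX.
apply: cvg_in_distribution_nat => // k.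
apply: (@mono_pmf_cvg _ _ _ _ _ lam V0 unbalanced p01 c_gt0 mean_cvg (fun j =>
  \sum_(F in supergraph_classes H) (ncopies H F == j)%:R * ((ncopies H F)%:R * supergraph_rate H F lam q))).
- by move=> K hK Kv; exact: (overlap_ratio_dense hK Kv hq).
- move=> j; rewrite -multiplicity_classes; apply: cvgM => //.
  by under eq_fun do rewrite hq; exact: cvg_cst.
- exact: (compound_pmf0_gt0 rate_ge0 N0 ind pX).
- move=> l; rewrite (compound_rec rate_ge0 N0 ind pX).
  under [RHS]eq_bigr do rewrite mulr_suml.
  rewrite exchange_big /=; apply: eq_bigr => F FS.
  case: ltnP => lN.
    rewrite mulr0 big1 // => j _; rewrite (_ : _ == _ = false) ?mul0r //.
    by apply/eqP => h; have := ltn_ord j; rewrite -h; lia.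
  rewrite (bigD1 (Ordinal (lN : (ncopies H F < l.+1)%N))) //= eqxx mul1r [X in _ = _ + X]big1 ?addr0 => [|j nj].
    by rewrite [_%:R * _]mulrC.
  rewrite (_ : _ == _ = false) ?mul0r //; apply: contraNF nj => /eqP h; exact/eqP/val_inj.
- exact: law_pmf_sum_cvg.
Qed.

End MainParts.

(** * Moments at the threshold *)

Section MomentExpansion.
Variables (R : realType) (J V : finType) (H : sgraph V) (n c : nat) (p : R).
Hypothesis c0 : (0 < c)%N.

Let weight (f : {ffun J * V -> J * V}) : R :=
  (inj_rows f)%:R * (p ^+ edge_size H f * c%:R ^- (image_size f - class_count f)).

Lemma prod_sum_rows (F : {ffun V -> 'I_n} -> R) :
  (\sum_s F s) ^+ #|J| = \sum_(f : {ffun J * V -> 'I_n}) \prod_j F (copy_row f j).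
Proof.
rewrite -prodr_const (bigA_distr_bigA (fun _ : J => F)) /=.
pose row_family (f : {ffun J * V -> 'I_n}) : {ffun J -> {ffun V -> 'I_n}} := [ffun j => copy_row f j].
rewrite (reindex row_family) /=.
  by apply: eq_bigr => f _; apply: eq_bigr => j _; rewrite ffunE.
exists (fun t : {ffun J -> {ffun V -> 'I_n}} => [ffun x => t x.1 x.2]) => t _; last first.
  by apply/ffunP => j; apply/ffunP => a; rewrite !ffunE.
by apply/ffunP => -[j a]; rewrite !ffunE.
Qed.

(** Tuples of embeddings are grouped by the way in which they overlap; what
    remains is a finite sum whose index set is independent of [n]. *)
Lemma moment_patterns :
  #|sg_aut H|%:R ^+ #|J| * cg_expect p (fun w : colored_graph n c => Tmono R H w ^+ #|J|) =
  \sum_(k : {ffun J * V -> J * V} | is_pattern k) (n ^_ (image_size k))%:R * weight k.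
Proof.
rewrite -(@sum_by_pattern _ _ n (fun f =>
  cg_expect p (fun w : colored_graph n c => [forall j, mono_embedding H w.1 w.2 (copy_row f j)]%:R))); last first.
  move=> f; rewrite prob_family // /weight.
  by rewrite inj_rows_pattern edge_size_pattern image_size_pattern class_count_pattern.
rewrite -expect_sum -expectZ; apply: eq_expect => w.
rewrite TmonoE -exprMn -sum_embeddings prod_sum_rows; apply: eq_bigr => f _.
have [/forallP h|/forallPn[j nj]] := boolP [forall j, mono_embedding H w.1 w.2 (copy_row f j)].
  by rewrite big1 // => j _; rewrite h.
by rewrite (bigD1 j) //= (negbTE nj) mul0r.
Qed.

End MomentExpansion.

Section Gluing.
Variables (V : finType) (H : sgraph V).
Hypothesis V0 : (0 < #|V|)%N.

Lemma image_size_join (U : finType) (s s' : {ffun V -> U}) :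
  image_size (join_pair s s') = #|vset [:: s; s']|.
Proof. by rewrite -card_vset_rows rows_join_pair. Qed.

Lemma edge_size_join (U : finType) (s s' : {ffun V -> U}) :
  edge_size H (join_pair s s') = #|eset H [:: s; s']|.
Proof. by rewrite /edge_size rows_join_pair. Qed.

Lemma inj_rows_join (U : finType) (s s' : {ffun V -> U}) :
  injective s -> injective s' -> inj_rows (join_pair s s').
Proof. by move=> si si'; apply/forallP => b; rewrite row_join_pair; apply/injectiveP; case: b. Qed.

Lemma edge_size_join_le (U : finType) (s s' : {ffun V -> U}) :
  injective s -> injective s' -> (edge_size H (join_pair s s') <= 2 * #|edges H|)%N.
Proof. by move=> si si'; rewrite edge_size_join -(card_eset_pair H si si') leq_addr. Qed.

(** Pairs of embeddings matter only up to their kernel, so that models with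
    values in [V + V] or in [V] stand for the pairs of embeddings into large
    graphs. *)
Definition disjoint_pair : {ffun bool * V -> V + V} :=
  join_pair [ffun a => inl a] [ffun a => inr a].

Definition same_pair (t : {perm V}) : {ffun bool * V -> V} :=
  join_pair [ffun a => a] [ffun a => t a].

Definition glued_pair (A : {set V}) : {ffun bool * V -> V + V} :=
  join_pair [ffun a => inl a] [ffun a => if a \in A then inl a else inr a].

Lemma inl_row_inj : injective ([ffun a => inl a] : {ffun V -> V + V}).
Proof. by move=> a b; rewrite !ffunE => -[]. Qed.

Lemma inr_row_inj : injective ([ffun a => inr a] : {ffun V -> V + V}).
Proof. by move=> a b; rewrite !ffunE => -[]. Qed.

Lemma id_row_inj : injective ([ffun a => a] : {ffun V -> V}).
Proof. by move=> a b; rewrite !ffunE. Qed.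

Lemma perm_row_inj (t : {perm V}) : injective ([ffun a => t a] : {ffun V -> V}).
Proof. by move=> a b; rewrite !ffunE; exact: perm_inj. Qed.

Lemma glued_row_inj (A : {set V}) :
  injective ([ffun a => if a \in A then inl a else inr a] : {ffun V -> V + V}).
Proof. by move=> a b; rewrite !ffunE; do 2![case: ifP => _] => // -[]. Qed.

Lemma disjoint_pair_size : image_size disjoint_pair = (2 * #|V|)%N.
Proof.
rewrite image_size_join -(card_vset_pair inl_row_inj inr_row_inj).
rewrite [X in (_ + X)%N](_ : _ = 0%N) ?addn0 //; apply/eqP; rewrite cards_eq0.
apply/eqP/finset.setP => a; rewrite !inE orbF; apply/negbTE/finset.imsetP => -[b _].
by rewrite !ffunE.
Qed.

(** Disjoint rows are not joined, hence are colored independently. *)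
Lemma disjoint_pair_classes : (1 < class_count disjoint_pair)%N.
Proof.
have /card_gt0P[a _] := V0.
have es := joined_connect_sym disjoint_pair (@same_row_sym bool V).
pose r := joined_rel (@same_row bool V) disjoint_pair.
have conn x y : connect r x y -> x.1 = y.1.
  move=> /connectP[q + ->]; elim: q x => [//|z q IH] x /= /andP[xz /IH <-].
  case: x z xz {IH} => b x [b' z] /=; rewrite /r /joined_rel /same_row /= => /orP[/eqP//|].
  by rewrite /disjoint_pair /join_pair !ffunE /=; case: b; case: b'.
rewrite /class_count /joined_classes -/r.
have h b : fingraph.root r (b, a) \in [set x | roots r x]%SET by rewrite inE roots_root.
have -> : (2 = #|[set fingraph.root r (b, a) | b : bool]%SET|)%N.
  rewrite card_imset ?card_bool // => b b' /(fingraph.rootP es)/conn //.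
by apply: subset_leq_card; apply/fintype.subsetP => _ /finset.imsetP[b _ ->].
Qed.

Lemma same_pair_size t : image_size (same_pair t) = #|V|.
Proof.
apply/eqP; rewrite eqn_leq max_card /= image_size_join -cardsT; apply: subset_leq_card.
by apply/fintype.subsetP => a _; rewrite inE; apply/orP; left; apply/finset.imsetP; exists a; rewrite ?ffunE.
Qed.

Lemma same_pair_meeting (t : {perm V}) : meeting ([ffun a => a] : {ffun V -> V}) [ffun a => t a].
Proof.
have /card_gt0P[a _] := V0.
rewrite /meeting -setI_eq0; apply/finset.set0Pn; exists a; rewrite inE.
apply/andP; split; apply/finset.imsetP; last by exists a; rewrite ?ffunE.
by exists (t^-1 a)%g; rewrite ?ffunE ?permKV.
Qed.

Lemma same_pair_edges t : t \in sg_aut H -> (edge_size H (same_pair t) <= #|edges H|)%N.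
Proof.
move=> tH; rewrite edge_size_join; apply: subset_leq_card; apply/fintype.subsetP => f.
have im (u : {perm V}) (e : {set V}) : [ffun a => u a] @: e = [set u x | x in e]%SET.
  by apply: eq_imset => x; rewrite ffunE.
rewrite !inE orbF => /orP[] /finset.imsetP[e eH ->].
  by rewrite (_ : _ @: e = e) //; apply/finset.setP => x; apply/finset.imsetP/idP => [[y ye ->]|xe]; rewrite ?ffunE //; exists x; rewrite ?ffunE.
by rewrite im; have := tH; rewrite sg_autE => /eqP <-; rewrite mem_relabel.
Qed.

Lemma same_pair_inj t u : kernel_pattern (same_pair t) = kernel_pattern (same_pair u) -> t = u.
Proof.
move=> h; apply/permP => a.
have := kernel_patternP (same_pair t) (true, t a) (false, a).
by rewrite h kernel_patternP /same_pair /join_pair !ffunE /= eqxx => /eqP.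
Qed.

Section Glued.
Variable A : {set V}.
Hypothesis A0 : (0 < #|A|)%N.

Lemma glued_old_vertices :
  old_vertices [ffun a => inl a] [:: [ffun a => if a \in A then inl a else inr a]] = A :> {set V}.
Proof.
apply/finset.setP => a; rewrite !inE orbF; apply/finset.imsetP/idP => [[b _]|aA].
  by rewrite !ffunE; case: ifP => // bA [->].
by exists a; rewrite // !ffunE aA.
Qed.

Lemma glued_pair_size : image_size (glued_pair A) = (2 * #|V| - #|A|)%N.
Proof.
by rewrite image_size_join -(card_vset_pair inl_row_inj (@glued_row_inj A)) glued_old_vertices addnK.
Qed.

Lemma glued_pair_classes : class_count (glued_pair A) = 1%N.
Proof. by apply: class_count_meeting => //; rewrite meeting_old_vertices glued_old_vertices. Qed.

Lemma glued_pair_edges (B : {set {set V}}) : B \subset edges H ->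
  (forall e, e \in B -> e \subset A) -> (edge_size H (glued_pair A) <= 2 * #|edges H| - #|B|)%N.
Proof.
move=> /fintype.subsetP BH BA.
rewrite edge_size_join -(card_eset_pair H inl_row_inj (@glued_row_inj A)).
rewrite -[leqLHS](addnK #|B|); apply: leq_sub2r; rewrite leq_add2l; apply: subset_leq_card.
apply/fintype.subsetP => e eB; rewrite inE BH //= [eset _ _]finset.setU0; apply/finset.imsetP; exists e; first exact: BH.
by apply: eq_in_imset => x xe; rewrite !ffunE (fintype.subsetP (BA e eB) _ xe).
Qed.

End Glued.
End Gluing.

Section Critical.
Variables (R : realType) (V : finType) (H : sgraph V).
Variables (p : nat -> R) (c : nat -> nat) (lam kappa : R).
Hypothesis V0 : (0 < #|V|)%N.
Hypothesis unbalanced : ~ balanced R H.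
Hypothesis p01 : forall n, 0 < p n < 1.
Hypothesis c_gt0 : forall n, (0 < c n)%N.
Hypothesis lam_gt0 : 0 < lam.
Hypothesis mean_cvg : cg_expect (p n) (@Tmono R V H n (c n)) @[n --> \oo] --> lam.
Hypothesis kappa_gt0 : 0 < kappa.
Hypothesis p_cvg : n%:R `^ gamma R H * p n @[n --> \oo] --> kappa.

Let v := #|V|.
Let e := #|edges H|.
Let g := gamma R H.
Let kap n : R := n%:R `^ g * p n.
Let Lam := lam * #|sg_aut H|%:R.

Lemma Lam_gt0 : 0 < Lam.
Proof. by rewrite mulr_gt0 // ltr0n sg_aut_gt0. Qed.

Lemma cvg_nonneg_root (u : nat -> R) (k : nat) (l : R) : (0 < k)%N -> (forall n, 0 <= u n) ->
  0 < l -> u n ^+ k @[n --> \oo] --> l -> u n @[n --> \oo] --> l `^ k%:R^-1.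
Proof.
move=> k0 u0 l0 uk; apply: (@cvg_eventually _ 0 (fun n => (u n ^+ k) `^ k%:R^-1)).
  move=> n _; rewrite -powR_mulrn // -powRrM divff ?powRr1 //.
  by rewrite pnatr_eq0 -lt0n.
exact: cvg_powR.
Qed.

Lemma n_p_pow (j k n : nat) : (0 < n)%N ->
  n%:R ^+ j * p n ^+ k = n%:R `^ (j%:R - g * k%:R) * kap n ^+ k.
Proof.
move=> n0; have n1 : n%:R != 0 :> R by rewrite pnatr_eq0 -lt0n.
rewrite /kap exprMn mulrA; congr (_ * _).
by rewrite -[X in _ * X]powR_mulrn ?powR_ge0 // -powRrM -powRD ?n1 ?implybT // subrK powR_mulrn.
Qed.

(** Raised to the power [v - 1] and expressed through [n ^ gamma * p] and the
    density of [H], which both converge to positive limits, the term becomes a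
    power of [n] with nonpositive exponent times a convergent factor. *)
Lemma pattern_term_cvg (m E r : nat) :
  (v%:R - 1) * (m%:R - g * E%:R) <= r%:R * (v%:R - g * e%:R) :> R ->
  exists l : R, n%:R ^+ m * p n ^+ E * (c n)%:R ^- r @[n --> \oo] --> l.
Proof.
set x := r%:R * _; set y := _ * _ => yx.
have v1 : (0 < v.-1)%N by have := v_gt1 V0 unbalanced; rewrite /v; lia.
have t0 n : 0 <= n%:R ^+ m * p n ^+ E * (c n)%:R ^- r.
  by rewrite !mulr_ge0 ?exprn_ge0 ?invr_ge0 ?exprn_ge0 // ltW //; case/andP: (p01 n).
pose q n := kap n ^+ (E * v.-1) / kap n ^+ (e * r) * density p c v e n ^+ r.
have qcvg : q n @[n --> \oo] --> kappa ^+ (E * v.-1) / kappa ^+ (e * r) * Lam ^+ r.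
  apply: cvgM; last by apply: cvg_expn; exact: (density_full_cvg V0 c_gt0 mean_cvg).
  apply: cvgM; first exact: cvg_expn.
  by apply: cvgV; [rewrite expf_neq0 // gt_eqF|exact: cvg_expn].
have tpow n : (0 < n)%N -> (n%:R ^+ m * p n ^+ E * (c n)%:R ^- r) ^+ v.-1 = n%:R `^ (y - x) * q n.
  move=> n0; have n1 : n%:R != 0 :> R by rewrite pnatr_eq0 -lt0n.
  have k0 : 0 < kap n by rewrite mulr_gt0 ?powR_gt0 ?ltr0n //; case/andP: (p01 n).
  have := @term_identity R n%:R (p n) (c n)%:R m E r v.-1 e; rewrite prednK // -/(density p c v e n).
  rewrite (n_p_pow v e n0) (n_p_pow (m * v.-1) (E * v.-1) n0) [X in _ * X = _]exprMn -[(_ `^ _) ^+ r]powR_mulrn ?powR_ge0 // -powRrM.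
  have -> : (m * v.-1)%N%:R - g * (E * v.-1)%N%:R = y.
    by rewrite /y !natrM -subn1 natrB //; ring.
  rewrite [(_ - _) * r%:R]mulrC -/x -exprM => h.
  have X0 : n%:R `^ x != 0 :> R by rewrite gt_eqF ?powR_gt0 ?ltr0n.
  have K0 : kap n ^+ (e * r) != 0 by rewrite expf_neq0 // gt_eqF.
  apply: (mulIf (mulf_neq0 X0 K0)); rewrite h /q powRD ?n1 ?implybT // powRN.
  have q' (a b f d k : R) : a != 0 -> b != 0 -> f * d * k = f / a * (d / b * k) * (a * b).
    by move=> a0 b0; field; rewrite a0 b0.
  exact: q'.
have [xy|xy] := eqVneq y x.
  exists ((kappa ^+ (E * v.-1) / kappa ^+ (e * r) * Lam ^+ r) `^ v.-1%:R^-1).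
  apply: cvg_nonneg_root => //; last first.
    apply: (@cvg_eventually _ 1 q); last exact: qcvg.
    by move=> n n0; rewrite tpow // xy subrr powRr0 mul1r.
  by rewrite !mulr_gt0 ?invr_gt0 ?exprn_gt0 // Lam_gt0.
exists 0; apply: (@cvg_root0 _ _ v.-1) => //.
apply: (@cvg_eventually _ 1 (fun n => n%:R `^ (y - x) * q n)).
  by move=> n n0; rewrite tpow.
rewrite -(mul0r (kappa ^+ (E * v.-1) / kappa ^+ (e * r) * Lam ^+ r)); apply: cvgM => //.
by apply: cvg_nat_powR_neg; rewrite subr_lt0 lt_neqAle xy.
Qed.

Lemma moments_cvg (r : nat) :
  exists l : R, cg_expect (p n) (fun w : colored_graph n (c n) => Tmono R H w ^+ r) @[n --> \oo] --> l.
Proof.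
pose J : finType := 'I_r.
pose term n (k : {ffun J * V -> J * V}) : R := (n ^_ (image_size k))%:R *
  ((inj_rows k)%:R * (p n ^+ edge_size H k * (c n)%:R ^- (image_size k - class_count k))).
have h k : exists l : R, term n k @[n --> \oo] --> l.
  rewrite /term; case: (boolP (inj_rows k)) => ki; last first.
    by exists 0; apply: (@cvg_eventually _ 0 (fun=> 0)) => [n _|]; [rewrite mul0r mulr0|exact: cvg_cst].
  have [l hl] := pattern_term_cvg (pattern_exponent_le V0 unbalanced ki).
  exists (1 * l); apply: (@cvg_eventually _ 1 (fun n => (n ^_ (image_size k))%:R / n%:R ^+ image_size k *
      (n%:R ^+ image_size k * p n ^+ edge_size H k * (c n)%:R ^- (image_size k - class_count k)))).
    move=> n n0; rewrite mul1r -!mulrA mulKf // expf_neq0 // pnatr_eq0; by case: n n0.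
  by apply: cvgM => //; exact: cvg_ffact.
have [l hl] := choice h.
exists (#|sg_aut H|%:R ^- r * \sum_(k | is_pattern k) l k).
apply: (@cvg_eventually _ 0 (fun n => #|sg_aut H|%:R ^- r * \sum_(k | is_pattern k) term n k)).
  move=> n _; have := @moment_patterns R J V H n (c n) (p n) (c_gt0 n).
  rewrite card_ord => <-; rewrite mulKf // expf_neq0 //; exact: aut_neq0.
by apply: cvgM; [exact: cvg_cst|exact: cvg_bigsum].
Qed.

Lemma join_term_le (U : finType) (f : {ffun bool * V -> U}) (n E r : nat) :
  inj_rows f -> (edge_size H f <= E)%N -> (image_size f - class_count f <= r)%N ->
  (n ^_ (image_size f))%:R * (p n ^+ E * (c n)%:R ^- r) <=
  (n ^_ (image_size f))%:R * ((inj_rows f)%:R *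
    (p n ^+ edge_size H f * (c n)%:R ^- (image_size f - class_count f))).
Proof.
move=> -> fE fr; rewrite mul1r ler_wpM2l //; have /andP[p0 p1] := p01 n.
apply: ler_pM.
- by rewrite exprn_ge0 // ltW.
- by rewrite invr_ge0 exprn_ge0.
- by apply: ler_wiXn2l => //; exact: ltW.
- by rewrite lef_pV2 ?posrE ?exprn_gt0 ?ltr0n // ler_weXn2l // ler1n.
Qed.

(** Only three kinds of pairs of embeddings are kept: the disjoint ones, those
    with the same image, and those glued along [K]. For a minimizer [K], the
    last kind is what a Poisson law leaves no room for. *)
Lemma second_moment_ge K n : nonempty_subgraph H K -> (#|K.1| < v)%N ->
  (n ^_ (2 * v))%:R * (p n ^+ (2 * e) * (c n)%:R ^- (2 * v - 2)) +
   ((n ^_ (2 * v - #|K.1|))%:R * (p n ^+ (2 * e - #|K.2|) * (c n)%:R ^- (2 * v - #|K.1| - 1)) +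
    #|sg_aut H|%:R * ((n ^_ v)%:R * (p n ^+ e * (c n)%:R ^- v.-1))) <=
  #|sg_aut H|%:R ^+ 2 * cg_expect (p n) (fun w : colored_graph n (c n) => Tmono R H w ^+ 2).
Proof.
move=> hK Kv; have [k0 kv ke] := card_subgraph hK.
case: K hK Kv k0 kv ke => A B /= /and3P[/= _ BH /forallP BA'] Kv k0 kv ke.
have BA e' : e' \in B -> e' \subset A by move=> eB; have := BA' e'; rewrite eB.
have := @moment_patterns R bool V H n (c n) (p n) (c_gt0 n); rewrite card_bool => ->.
set F := BIG_F; pose term := F; rewrite -[F]/term.
have termE (U : finType) (f : {ffun bool * V -> U}) : term (kernel_pattern f) =
    (n ^_ (image_size f))%:R * ((inj_rows f)%:R *
    (p n ^+ edge_size H f * (c n)%:R ^- (image_size f - class_count f))).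
  by rewrite /term /F inj_rows_pattern edge_size_pattern image_size_pattern class_count_pattern.
have term_ge0 k : 0 <= term k.
  by rewrite /term /F !mulr_ge0 ?invr_ge0 ?exprn_ge0 // ltW //; case/andP: (p01 n).
pose k1 := kernel_pattern (disjoint_pair V); pose k3 := kernel_pattern (glued_pair A).
pose k2 (t : {perm V}) := kernel_pattern (same_pair t).
have s1 : image_size k1 = (2 * v)%N by rewrite image_size_pattern disjoint_pair_size.
have s2 t : image_size (k2 t) = v by rewrite image_size_pattern same_pair_size.
have s3 : image_size k3 = (2 * v - #|A|)%N by rewrite image_size_pattern glued_pair_size.
(* The image sizes tell the three kinds of pairs apart. *)
have k31 : k3 != k1 by apply: contraTneq Kv => h; move: s3; rewrite h s1; lia.
have k21 t : k2 t != k1 by apply: contraTneq Kv => h; move: (s2 t); rewrite h s1; lia.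
have k23 t : k2 t != k3 by apply: contraTneq Kv => h; move: (s2 t); rewrite h s3; lia.
rewrite (bigD1 k1) /= ?kernel_pattern_is_pattern // (bigD1 k3) /= ?kernel_pattern_is_pattern ?k31 //.
apply: lerD; last apply: lerD.
- rewrite /k1 termE -(disjoint_pair_size V); apply: join_term_le.
  + exact: inj_rows_join (@inl_row_inj V) (@inr_row_inj V).
  + exact: edge_size_join_le (@inl_row_inj V) (@inr_row_inj V).
  + by rewrite disjoint_pair_size; apply: leq_sub2l; exact: disjoint_pair_classes.
- rewrite /k3 termE -glued_pair_size; apply: join_term_le.
  + exact: inj_rows_join (@inl_row_inj V) (@glued_row_inj V A).
  + exact: glued_pair_edges.
  + by rewrite glued_pair_classes.
- rewrite mulr_natl -sumr_const.
  apply: (@le_trans _ _ (\sum_(t in sg_aut H) term (k2 t))).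
    apply: ler_sum => t tH; rewrite /k2 termE -[v in (n ^_ v)%:R](same_pair_size t); apply: join_term_le.
    + exact: inj_rows_join (@id_row_inj V) (@perm_row_inj V t).
    + exact: same_pair_edges.
    + rewrite same_pair_size class_count_meeting ?subn1 //; exact: same_pair_meeting.
  rewrite -(big_imset term) /=; last by move=> t u _ _; exact: same_pair_inj.
  rewrite big_mkcond [leRHS]big_mkcond; apply: ler_sum => k _.
  case: ifP => [/finset.imsetP[t _ ->]|_]; last by case: ifP.
  by rewrite /k2 kernel_pattern_is_pattern k21 k23.
Qed.

(** In the previous bound, the disjoint pairs tend to [lam ^ 2] and the pairs
    with the same image to [lam], while at the threshold the pairs glued along
    a minimizer keep a positive limit. *)
Lemma second_moment_excess l :
  cg_expect (p n) (fun w : colored_graph n (c n) => Tmono R H w ^+ 2) @[n --> \oo] --> l ->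
  lam ^+ 2 + lam < l.
Proof.
move=> hl; have [K [hK Kv DK gD]] := gamma_attained V0 unbalanced.
have [k0 kv ke] := card_subgraph hK.
have v1 : (1 < v)%N := v_gt1 V0 unbalanced.
have dcvg := density_full_cvg V0 c_gt0 mean_cvg; rewrite -/v -/e -/Lam in dcvg.
have nz n j : (0 < n)%N -> (n%:R : R) ^+ j != 0 by move=> n0; rewrite expf_neq0 // pnatr_eq0 -lt0n.
pose d := (#|K.2| * v.-1 - e * #|K.1|.-1)%N.
pose L := (Lam ^+ (2 * v - #|K.1| - 1) / kappa ^+ d) `^ v.-1%:R^-1.
have Lp : 0 < Lam ^+ (2 * v - #|K.1| - 1) / kappa ^+ d.
  by rewrite mulr_gt0 ?invr_gt0 ?exprn_gt0 // Lam_gt0.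
have L0 : 0 < L by rewrite powR_gt0.
have t1 : (n ^_ (2 * v))%:R * (p n ^+ (2 * e) * (c n)%:R ^- (2 * v - 2)) @[n --> \oo] --> Lam ^+ 2.
  apply: (@cvg_eventually _ 1 (fun n => (n ^_ (2 * v))%:R / n%:R ^+ (2 * v) * density p c v e n ^+ 2)).
    move=> n n0; rewrite /density !exprMn -!exprVn -!exprM -!mulrA.
    have -> : (v.-1 * 2 = 2 * v - 2)%N by lia.
    by rewrite [(v * 2)%N]mulnC [(e * 2)%N]mulnC exprVn mulKf // nz.
  rewrite -[X in _ --> X]mul1r; apply: cvgM; first exact: cvg_ffact.
  exact: cvg_expn.
have t2 : (n ^_ v)%:R * (p n ^+ e * (c n)%:R ^- v.-1) @[n --> \oo] --> Lam.
  apply: (@cvg_eventually _ 1 (fun n => (n ^_ v)%:R / n%:R ^+ v * density p c v e n)).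
    by move=> n n0; rewrite /density -!mulrA mulKf // nz.
  by rewrite -[X in _ --> X]mul1r; apply: cvgM; first exact: cvg_ffact.
have t3 : (n ^_ (2 * v - #|K.1|))%:R *
    (p n ^+ (2 * e - #|K.2|) * (c n)%:R ^- (2 * v - #|K.1| - 1)) @[n --> \oo] --> L.
  apply: (@cvg_eventually _ 1 (fun n => (n ^_ (2 * v - #|K.1|))%:R / n%:R ^+ (2 * v - #|K.1|) *
     overlap_term H n (c n) (p n) #|K.1| #|K.2|)).
    by move=> n n0; rewrite /overlap_term -!mulrA mulKf // nz.
  rewrite -[X in _ --> X]mul1r; apply: cvgM; first exact: cvg_ffact.
  apply: cvg_nonneg_root => //; [lia|by move=> n; exact: overlap_term_ge0|].
  apply: (@cvg_eventually _ 1 (fun n => density p c v e n ^+ (2 * v - #|K.1| - 1) / kap n ^+ d)).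
    move=> n n0; rewrite (overlap_term_pow c V0 p01) ?k0 // -/v -/e; congr (_ * _).
    by rewrite -(overlap_ratio_minimizer V0 p01 n0 hK DK gD) invrK.
  apply: cvgM; first exact: cvg_expn.
  by apply: cvgV; [rewrite expf_neq0 // gt_eqF|exact: cvg_expn].
set a : R := #|sg_aut H|%:R; have a0 : 0 < a by rewrite ltr0n sg_aut_gt0.
have : Lam ^+ 2 + (L + a * Lam) <= a ^+ 2 * l.
  apply: (@ler_cvg_to _ _ _ _ _ _ _ _ (cvgD t1 (cvgD t3 (cvgM (cvg_cst a) t2))) (cvgM (cvg_cst (a ^+ 2)) hl)).
  by near=> n; exact: second_moment_ge.
have -> : Lam ^+ 2 + (L + a * Lam) = a ^+ 2 * (lam ^+ 2 + lam) + L by rewrite /Lam -/a; ring.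
move=> h; rewrite -(@ltr_pM2l _ (a ^+ 2)) ?exprn_gt0 //; apply: lt_le_trans h.
by rewrite ltrDl.
Unshelve. all: by end_near. Qed.

Section PoissonLimit.
Variables (d : measure_display) (Omega : measurableType d) (P : probability Omega R).
Variables (W : {RV P >-> R}) (mu : R).
Hypothesis W_limit : cvg_in_distribution p (fun n => @Tmono R V H n (c n)) W.
Hypothesis mu_ge0 : 0 <= mu.
Hypothesis W_poisson : is_poisson mu W.

Let T n (w : colored_graph n (c n)) : nat := mono_count H w.1 w.2.
Let falling j n := cg_expect (p n) (fun w : colored_graph n (c n) => (T w ^_ j)%:R).

(** The distribution function of a law on the natural numbers is continuous at
    half-integers. *)
Lemma sum_pmf_limit K : \sum_(k < K) mono_pmf H p c n k @[n --> \oo] --> \sum_(k < K) pois mu k.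
Proof.
have [W0 Wk] := is_poisson_law mu_ge0 W_poisson.
case: K => [|K]; first by under eq_fun do rewrite big_ord0; rewrite big_ord0; exact: cvg_cst.
have half (y : R) : `|K%:R + 2^-1 - y| < 2^-1 -> forall m : nat, (m%:R <= y) = (m < K.+1)%N.
  rewrite ltr_norml => /andP[y1 y2] m; rewrite ltnS; have [mK|mK] := leqP m K.
    by have : m%:R <= K%:R :> R; [rewrite ler_nat|lra].
  have : K.+1%:R <= m%:R :> R by rewrite ler_nat.
  by rewrite -natr1 => h; apply/negbTE; rewrite -ltNge; lra.
pose x : R := K%:R + 2^-1.
have xK : forall m : nat, (m%:R <= x) = (m < K.+1)%N by apply: half; rewrite subrr normr0.
have cx : {for x, continuous (cdf W)}.
  apply: (near_cst_continuous (cdf W x)); near=> y.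
  rewrite (cdf_nat_valued W0 xK) (@cdf_nat_valued _ _ _ _ _ y K.+1) //; apply: half.
  by near: y; exact: (nbhsx_ballx x (2^-1 : R)).
have := W_limit cx; rewrite (cdf_nat_valued W0 xK) => /fine_cvg /= h.
have -> : \sum_(k < K.+1) pois mu k = \sum_(k < K.+1) law_pmf W k.
  by apply: eq_bigr => k _; rewrite Wk.
apply: (@cvg_eventually _ 0 _ _ _ _ h) => n _ /=.
by rewrite sum_mono_pmf; apply: eq_bigl => w; rewrite TmonoE xK.
Unshelve. all: by end_near. Qed.

Lemma pmf_limit k : mono_pmf H p c n k @[n --> \oo] --> pois mu k.
Proof.
have -> : pois mu k = \sum_(j < k.+1) pois mu j - \sum_(j < k) pois mu j.
  by rewrite big_ord_recr /= addrAC subrr add0r.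
apply: (@cvg_eventually _ 0 _ _ _ _ (cvgB (@sum_pmf_limit k.+1) (@sum_pmf_limit k))) => n _ /=.
by rewrite /GRing.sub_fun /= big_ord_recr /= addrAC subrr add0r.
Qed.

(** Truncation costs one more moment: [k ^_ j] is at most [k ^ j.+1 / K] when
    [k] is at least [K]. *)
Lemma falling_truncation j n K : (0 < K)%N ->
  `|falling j n - \sum_(k < K) (k ^_ j)%:R * mono_pmf H p c n k| <=
  cg_expect (p n) (fun w : colored_graph n (c n) => Tmono R H w ^+ j.+1) / K%:R.
Proof.
move=> K0; rewrite (eq_bigr (fun k : 'I_K => cg_expect (p n)
    (fun w : colored_graph n (c n) => (k ^_ j)%:R * (T w == k)%:R))); last first.
  by move=> k _; rewrite /mono_pmf probE expectZ.
rewrite -expect_sum /falling -expectB mulrC -expectZ.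
apply: le_trans (norm_expect (p01 n) _) _; apply: le_expect => // w.
rewrite TmonoE -/(T w); have [TK|TK] := ltnP (T w) K.
  rewrite (bigD1 (Ordinal TK)) //= eqxx mulr1 big1 ?addr0 ?subrr ?normr0.
    by rewrite mulr_ge0 ?invr_ge0 ?exprn_ge0.
  by move=> i ni; rewrite (_ : T w == i = false) ?mulr0 //; apply: contraNF ni => /eqP h; apply/eqP/val_inj.
rewrite big1 ?subr0 => [|i _]; last first.
  by rewrite (_ : T w == i = false) ?mulr0 //; apply/eqP => h; have := ltn_ord i; rewrite -h ltnNge TK.
rewrite ger0_norm // mulrC ler_pdivlMr ?ltr0n // -natrM -natrX ler_nat expnSr.
by apply: leq_mul => //; exact: ffact_le.
Qed.

Lemma sum_falling_pois j K :
  \sum_(k < K + j) (k ^_ j)%:R * pois mu k = mu ^+ j * \sum_(k < K) pois mu k.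
Proof.
have h k : ((k + j) ^_ j)%:R * pois mu (k + j) = mu ^+ j * pois mu k.
  elim: j => [|j IH]; first by rewrite addn0 ffactn0 !mul1r.
  rewrite addnS ffactSS natrM mulrAC pois_rec exprS -mulrA -IH; ring.
rewrite addnC big_split_ord /= big1 ?add0r => [|i _]; last by rewrite ffact_small ?mul0r.
by rewrite mulr_sumr; apply: eq_bigr => k _; rewrite addnC h.
Qed.

(** The convergence of the moment of order [j + 1] makes the variables of
    order [j] uniformly integrable. *)
Lemma falling_limit j : falling j n @[n --> \oo] --> mu ^+ j.
Proof.
have [W0 Wk] := is_poisson_law mu_ge0 W_poisson.
have [l hl] := moments_cvg j.+1.
have /cvg_seq_bounded[M [_ hM]] : cvgn (fun n => cg_expect (p n) (fun w : colored_graph n (c n) => Tmono R H w ^+ j.+1)).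
  by apply/cvg_ex; exists l.
pose B := M + 1.
have BP n : cg_expect (p n) (fun w : colored_graph n (c n) => Tmono R H w ^+ j.+1) <= B.
  by apply: le_trans (ler_norm _) _; apply: hM => //; rewrite ltrDl.
apply/cvgrPdist_lt => eps eps0.
have e3 : 0 < eps / 3 by rewrite divr_gt0.
have [K [K0 BK SK]] : exists K : nat, [/\ (0 < K)%N, B / K%:R < eps / 3 &
    `|mu ^+ j - \sum_(k < K) (k ^_ j)%:R * pois mu k| < eps / 3].
  have h1 : B / n%:R @[n --> \oo] --> 0.
    by rewrite -(mulr0 B); apply: cvgM; [exact: cvg_cst|exact: cvg_natV].
  have h2 : \sum_(k < K) (k ^_ j)%:R * pois mu k @[K --> \oo] --> mu ^+ j.
    rewrite -(cvg_shiftn j) /=; apply: (@cvg_eventually _ 0 (fun K => mu ^+ j * \sum_(k < K) law_pmf W k)).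
      by move=> K _; rewrite sum_falling_pois; congr (_ * _); apply: eq_bigr => k _.
    by rewrite -[X in _ --> X]mulr1; apply: cvgM; [exact: cvg_cst|exact: law_pmf_sum_cvg].
  have h3 : \forall K \near \oo, [/\ (0 < K)%N, B / K%:R < eps / 3 &
      `|mu ^+ j - \sum_(k < K) (k ^_ j)%:R * pois mu k| < eps / 3].
    near=> K; split.
    - by near: K; exact: nbhs_infty_gt.
    - apply: le_lt_trans (ler_norm _) _.
      by near: K; move/cvgr0Pnorm_lt : h1; apply.
    - by near: K; move/cvgrPdist_lt : h2; apply.
  exact: (filter_ex h3).
have h4 : \sum_(k < K) (k ^_ j)%:R * mono_pmf H p c n k @[n --> \oo] --> \sum_(k < K) (k ^_ j)%:R * pois mu k.
  by apply: cvg_bigsum => k _; apply: cvgM; [exact: cvg_cst|exact: pmf_limit].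
pose s := \sum_(k < K) (k ^_ j)%:R * pois mu k; pose t n := \sum_(k < K) (k ^_ j)%:R * mono_pmf H p c n k.
near=> n.
have -> : mu ^+ j - falling j n = (mu ^+ j - s) + (s - t n) + - (falling j n - t n) by ring.
have -> : eps = eps / 3 + eps / 3 + eps / 3 by field.
apply: le_lt_trans (ler_normD _ _) _; apply: ltrD; last first.
  rewrite normrN; apply: le_lt_trans (falling_truncation _ _ K0) _; apply: le_lt_trans BK.
  by rewrite ler_wpM2r ?invr_ge0.
apply: le_lt_trans (ler_normD _ _) _; apply: ltrD => //.
by near: n; move/cvgrPdist_lt : h4; apply.
Unshelve. all: by end_near. Qed.

(** Then [mu = lam] by the first moment, and the limit of the second moment
    would be [lam ^ 2 + lam]. *)
Lemma not_poisson : False.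
Proof.
have [l hl] := moments_cvg 2.
have muE : mu = lam.
  have := @falling_limit 1; rewrite expr1 => h; symmetry; apply: (cvg_unique _ mean_cvg).
    exact: Rhausdorff.
  apply: (@cvg_eventually _ 0 _ _ _ _ h) => n _; apply: eq_expect => w.
  by rewrite TmonoE ffactn1.
have h2 : l = lam ^+ 2 + lam.
  apply: (cvg_unique _ hl); first exact: Rhausdorff.
  have h := @falling_limit 2; rewrite muE in h.
  apply: (@cvg_eventually _ 0 _ _ _ _ (cvgD h mean_cvg)) => n _ /=.
  rewrite -expectD; apply: eq_expect => w; rewrite TmonoE -/(T w) -natrX -natrD; congr (_%:R).
  by rewrite ffactnS ffactn1; case: (T w) => // k; rewrite /= addnC -mulnS.
by have := second_moment_excess hl; rewrite h2 ltxx.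
Qed.

End PoissonLimit.
End Critical.

Theorem theorem1p4 (R : realType) (V : finType) (H : sgraph V)
    (p : nat -> R) (c : nat -> nat) (lam : R)
    (H_connected : sg_connected H)
    (H_unbalanced : ~ balanced R H)
    (p01 : forall n, 0 < p n < 1)
    (c_gt0 : forall n, (0 < c n)%N)
    (c_infty : c n @[n --> \oo] --> \oo)
    (lam_gt0 : 0 < lam)
    (mean_cvg : cg_expect (p n) (@Tmono R V H n (c n)) @[n --> \oo] --> lam) :
  let T := fun n => @Tmono R V H n (c n) in
  [/\ (much_smaller (fun n => n%:R `^ (- (#|V|%:R / #|edges H|%:R))) p ->
       much_smaller p (fun n => n%:R `^ (- gamma R H)) ->
       cvg_in_probability p T 0),
      (forall kappa : R, 0 < kappa ->
       n%:R `^ gamma R H * p n @[n --> \oo] --> kappa ->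
       (forall r : nat, (0 < r)%N ->
          exists l : R,
            cg_expect (p n) (fun w => T n w ^+ r) @[n --> \oo] --> l) /\
       (forall (d : measure_display) (Omega : measurableType d)
          (P : probability Omega R) (W : {RV P >-> R}),
          cvg_in_distribution p T W ->
          forall mu : R, 0 <= mu -> ~ is_poisson mu W)),
      (much_smaller (fun n => n%:R `^ (- gamma R H)) p ->
       much_smaller p (fun=> 1) ->
       cvg_in_distribution p T (poisson_rv lam))
    & (forall q : R, (forall n, p n = q) ->
       forall (d : measure_display) (Omega : measurableType d)
         (P : probability Omega R) (X : sgraph V -> {RV P >-> R}),
         mutually_independent (supergraph_classes H) X ->
         (forall F, F \in supergraph_classes H ->
            is_poisson (supergraph_rate H F lam q) (X F)) ->
         cvg_in_distribution p T
           (\sum_(F in supergraph_classes H) X F *+ ncopies H F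
              : {RV P >-> R}))].
Proof.
have V0 : (0 < #|V|)%N by case/andP: H_connected.
split.
- by move=> _; exact: (below_threshold V0 H_unbalanced p01 c_gt0 mean_cvg).
- move=> kappa kappa0 pk; split=> [r _|d Omega P W WT mu mu0 Wmu].
    exact: (moments_cvg V0 H_unbalanced p01 c_gt0 lam_gt0 mean_cvg kappa0 pk).
  exact: (not_poisson V0 H_unbalanced p01 c_gt0 lam_gt0 mean_cvg kappa0 pk WT mu0 Wmu).
- exact: (poisson_regime V0 H_unbalanced p01 c_gt0 mean_cvg lam_gt0).
- exact: (dense_regime V0 H_unbalanced p01 c_gt0 mean_cvg lam_gt0).
Qed.
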